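(* Let $\Phi$ be a nearest-neighbour interaction on $\mathbb{Z}^d$ with finite alphabet $\mathcal{A}$, let $\mu$ be an equilibrium state for $\Phi$, and let $\nu$ be a shift-invariant Borel probability measure on $\mathcal{A}^{\mathbb{Z}^d}$ with $\operatorname{supp}(\nu)\subseteq\operatorname{supp}(\mu)$. Suppose that $\operatorname{supp}(\mu)$ satisfies topological strong spatial mixing (TSSM) and that $\mu$ satisfies strong spatial mixing (SSM). Then $P(\Phi)=\int (I_\mu+A_\Phi)\,d\nu$.
   Context: Configurations: for $S\subseteq\mathbb{Z}^d$ a configuration on $S$ is $u\in\mathcal{A}^S$; $x(S)$ denotes restriction. The shift is $(\sigma_px)(q)=x(p+q)$; $\mathbb{Z}^d$ is a graph with edges $\{p,q\}$, $\|p-q\|=1$, $\|p\|=\sum_i|p_i|$; $\operatorname{dist}(A,B)=\min_{p\in A,q\in B}\|p-q\|$ ($\infty$ if one set is empty); $\partial S=\{p\notin S:\operatorname{dist}(\{p\},S)=1\}$; $e_1,\dots,e_d$ is the canonical basis. A shift space is a closed shift-invariant $X\subseteq\mathcal{A}^{\mathbb{Z}^d}$; $[u]_X=\{x\in X:x(S)=u\}$, and $[us]_X=[u]_X\cap[s]_X$, etc. $\mathrm{B}_n=\{p:|p_i|\le n\ \forall i\}$. For a measure $\mu$ and $u\in\mathcal{A}^S$, $S$ finite, $\mu(u)$ is the measure of $\{x:x(S)=u\}$; $\operatorname{supp}(\mu)=\{x:\mu(x(S))>0\ \forall\text{ finite }S\}$. Interaction: a nearest-neighbour (n.n.) interaction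 $\Phi$ is a shift-invariant function from configurations on single vertices and on edges of $\mathbb{Z}^d$ to $\mathbb{R}\cup\{\infty\}$, finite on vertices. $\mathsf{X}(\Phi)=\{x\in\mathcal{A}^{\mathbb{Z}^d}:\Phi(x(\{p,p+e_i\}))\ne\infty\ \forall p,i\}$. For finite $S$, $w\in\mathcal{A}^S$: $U^\Phi_S(w)=\sum_{p\in S}\Phi(w(p))+\sum_{e\subseteq S}\Phi(w(e))$ (edges $e$ contained in $S$), $Z_S^\Phi=\sum_{w\in\mathcal{A}^S}e^{-U_S^\Phi(w)}$ ($e^{-\infty}=0$). $P(\Phi)=\lim_n\frac1{|\mathrm{B}_n|}\log Z^\Phi_{\mathrm{B}_n}$. For $x\in\mathsf{X}(\Phi)$, $A_\Phi(x)=-\Phi(x(0))-\sum_{i=1}^d\Phi(x(\{0,e_i\}))$. Equilibrium state for $\Phi$: a shift-invariant Borel probability measure $\mu$ with $\operatorname{supp}(\mu)\subseteq\mathsf{X}(\Phi)$ maximizing $h(\mu)+\int A_\Phi\,d\mu$ among all such measures, where $h(\mu)=\lim_n\frac{-1}{|\mathrm{B}_n|}\sum_{w\in\mathcal{A}^{\mathrm{B}_n}}\mu(w)\log\mu(w)$. Equilibrium states for n.n. interactions are Markov random fields. Markov random field (MRF): a shift-invariant $\mu$ such that for every finite $S$, $u\in\mathcal{A}^S$, finite $T$ with $\partial S\subseteq T\subseteq\mathbb{Z}^d\setminus S$, $\delta\in\mathcal{A}^T$ with $\mu(\delta)>0$: $\mu(u\mid\delta)=\mu(u\mid\delta(\partial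 S))$. Write $\mu^\delta=\mu(\cdot\mid\delta)$. SSM: an MRF $\mu$ satisfies SSM if there is $f:\mathbb{N}\to\mathbb{R}_{\ge0}$ with $f(n)\to0$ (and $f(\infty)=0$) such that for every finite $W$, $U\subseteq W$, $u\in\mathcal{A}^U$, $\delta_1,\delta_2\in\mathcal{A}^{\partial W}$ with $\mu(\delta_1),\mu(\delta_2)>0$: $|\mu^{\delta_1}(u)-\mu^{\delta_2}(u)|\le|U|f(\operatorname{dist}(U,\Sigma))$, $\Sigma=\{p\in\partial W:\delta_1(p)\ne\delta_2(p)\}$. TSSM: $X$ satisfies TSSM if for some $g\in\mathbb{N}$, for all finite $U,V,S\subset\mathbb{Z}^d$ (possibly empty) with $\operatorname{dist}(U,V)\ge g$ and all $u\in\mathcal{A}^U,v\in\mathcal{A}^V,s\in\mathcal{A}^S$: $[us]_X,[sv]_X\ne\emptyset\Rightarrow[usv]_X\ne\emptyset$. Information function: lexicographic order: $q\prec p$ iff $q\neq p$ and $q_i<p_i$ for the smallest $i$ with $q_i\ne p_i$; $\mathcal{P}_n=\{p\in\mathrm{B}_n:p\prec0\}$. $p_\mu(x)=\lim_n\mu(x(0)\mid x(\mathcal{P}_n))$ and $I_\mu(x)=-\log p_\mu(x)$, wherever the limit exists (under the hypotheses it exists for every $x\in\operatorname{supp}(\mu)$). *)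

(* Defs.v *)
(* Nearest-neighbour interactions, equilibrium states and spatial mixing on A^(Z^d). *)
From HB Require Import structures.
From mathcomp Require Import all_boot all_order all_algebra finmap.
From mathcomp Require Import all_classical all_reals all_analysis.
From mathcomp Require Import zify.

Set Implicit Arguments.
Unset Strict Implicit.
Unset Printing Implicit Defensive.

Import Order.TTheory GRing.Theory Num.Theory.
Import numFieldNormedType.Exports.

Local Open Scope classical_set_scope.
Local Open Scope ring_scope.

Notation lattice d := {ffun 'I_d -> int}.

Section Lattice.
Variable d : nat.
Implicit Types (p q : lattice d) (A B S : {fset lattice d}).

Definition basis (i : 'I_d) : lattice d := [ffun j => (j == i)%:Z].

Definition norm1 p : nat := (\sum_(i < d) absz (p i))%N.
Arguments norm1 _%_R.

(* Distances live in nat + {oo}, encoded as [option nat] with [None] for oo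
   (the minimum over an empty set). *)
Definition min_seq (s : seq nat) : option nat :=
  if s is n :: s' then Some (foldr minn n s') else None.

Definition dist A B : option nat :=
  min_seq [seq norm1 (p - q) | p <- enum_fset A, q <- enum_fset B].

Definition dist_ge (g : nat) (o : option nat) : bool :=
  if o is Some n then (g <= n)%N else true.

(* [fset_set] is the empty set on infinite sets; [in_boundary] and [in_box]
   below show that the sets to which it is applied are finite. *)
Definition boundary S : {fset lattice d} :=
  fset_set [set p : lattice d | p \notin S /\ dist [fset p]%fset S = Some 1%N].

Definition box (n : nat) : {fset lattice d} :=
  fset_set [set p : lattice d | forall i, (absz (p i) <= n)%N].

Definition lexlt q p : bool :=
  [exists i : 'I_d, [forall j : 'I_d, (j < i)%N ==> (q j == p j)] && (q i < p i)].

Definition past (n : nat) : {fset lattice d} := [fset p in box n | lexlt p 0]%fset.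

Lemma min_seqP (s : seq nat) (m : nat) :
  min_seq s = Some m <-> m \in s /\ (forall n, n \in s -> (m <= n)%N).
Proof.
case: s => [|a s] /=; first by split=> [|[]].
have minP : forall t, foldr minn a t \in a :: t /\
    (forall n, n \in a :: t -> (foldr minn a t <= n)%N).
  elim=> [|b t [IH1 IH2]] /=.
    by split=> [|n]; rewrite inE // => /eqP ->.
  split; last first.
    move=> n; rewrite !inE => /or3P[/eqP->|/eqP->|nt]; rewrite geq_min ?leqnn//.
      by rewrite IH2 ?orbT// inE eqxx.
    by rewrite IH2 ?orbT// inE nt orbT.
  rewrite /minn; case: ifP => _; first by rewrite !inE eqxx orbT.
  by move: IH1; rewrite !inE => /orP[->//|->]; rewrite !orbT.
have [i1 i2] := minP s; split=> [[<-]//|[ms mle]]; congr Some.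
by apply/eqP; rewrite eqn_leq i2//= mle.
Qed.

Lemma distP A B (m : nat) :
  dist A B = Some m <->
  (exists p q, [/\ p \in A, q \in B & norm1 (p - q) = m]) /\
  (forall p q, p \in A -> q \in B -> (m <= norm1 (p - q))%N).
Proof.
split=> [/min_seqP[/allpairsP[[p q] /= [pA qB ->]] mle]|].
  split=> [|p' q' pA' qB']; first by exists p, q.
  by apply: mle; apply/allpairsP; exists (p', q').
move=> [[p [q [pA qB <-]]] mle]; apply/min_seqP; split.
  by apply/allpairsP; exists (p, q).
by move=> n /allpairsP[[p' q'] /= [pA' qB' ->]]; apply: mle.
Qed.

Lemma finite_box (n : nat) : finite_set [set p : lattice d | forall i, (absz (p i) <= n)%N].
Proof.
pose h (f : {ffun 'I_d -> 'I_(n + n).+1}) : lattice d :=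
  [ffun i => (f i : nat)%:Z - n%:Z].
apply: (@sub_finite_set _ _ (range h)); last exact/finite_image/finite_finset.
move=> p /= pn.
have hlt i : (absz (p i + n%:Z)%R < (n + n).+1)%N by have := pn i; lia.
exists [ffun i => Ordinal (hlt i)] => //; apply/ffunP => i; rewrite !ffunE /=.
by have := pn i; lia.
Qed.

Lemma in_box (n : nat) p : (p \in box n) = [forall i, (absz (p i) <= n)%N].
Proof.
rewrite in_fset_set; last exact: finite_box.
by apply/idP/forallP => [/set_mem//|pn]; apply/mem_set.
Qed.

Lemma in_boundary S p :
  p \in boundary S <-> p \notin S /\ dist [fset p]%fset S = Some 1%N.
Proof.
rewrite in_fset_set; first by split=> [/set_mem|/mem_set].
apply: (@sub_finite_set _ _ [set q + v | q in [set` S] & v in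
  [set v : lattice d | forall i, (absz (v i) <= 1)%N]]); last first.
  by apply: finite_image2; [exact: finite_fset|exact: finite_box].
move=> r /= [_ /distP[[a [q [/fset1P-> qS rq]]] _]].
exists q => //; exists (r - q); last by rewrite addrC subrK.
by move=> i; rewrite -rq /norm1 (bigD1 i)//= leq_addr.
Qed.

End Lattice.

#[short(type="pfinType")]
HB.structure Definition PointedFinite := {A of Finite A & Pointed A}.

(* A^(Z^d) with the Borel sigma-algebra of the product of the discrete
   topologies.  Measurable types are pointed, whence the pointed alphabet; an
   empty alphabet carries no probability measure anyway. *)
Notation conf_top d A := {ptws lattice d -> discrete_topology A}.
Notation conf d A := (g_sigma_algebraType (@open (conf_top d A))).

Section Configurations.
Variables (d : nat) (A : pfinType).
Implicit Types (S T : {fset lattice d}) (x : conf d A).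

Definition restr S x : {ffun S -> A} := [ffun p : S => x (val p)].

Definition subrestr S T (ST : (S `<=` T)%fset) (u : {ffun T -> A}) : {ffun S -> A} :=
  [ffun p : S => u (fincl ST p)].

Definition cyl S (u : {ffun S -> A}) : set (conf d A) := [set x | restr S x = u].

Lemma open_cyl S (u : {ffun S -> A}) : open (cyl u : set (conf_top d A)).
Proof.
have -> : cyl u = \bigcap_(p in [set` enum (fset_sub_type S)]) [set x : conf_top d A | x (val p) = u p].
  apply/seteqP; split=> [x /= <- p _ /=|x xu]; first by rewrite ffunE.
  by apply/ffunP => p; rewrite ffunE; apply: (xu p); rewrite /= mem_enum.
rewrite bigcap_seq; apply: big_ind => [|B C oB oC|p _]; [exact: openT|exact: openI|].
apply: (@open_comp (conf_top d A) (discrete_topology A) (fun x => x (val p)) [set u p]).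
  by move=> x _; exact: (@proj_continuous _ (fun _ => discrete_topology A) (val p)).
exact: discrete_open.
Qed.

Lemma measurable_cyl S (u : {ffun S -> A}) : measurable (cyl u).
Proof. by apply: sub_sigma_algebra; exact: open_cyl. Qed.

Definition shift (p : lattice d) (x : conf d A) : conf d A := fun q => x (p + q).

Definition TSSM (X : set (conf d A)) : Prop :=
  exists g : nat, forall (U V S : {fset lattice d})
    (u : {ffun U -> A}) (v : {ffun V -> A}) (s : {ffun S -> A}),
  dist_ge g (dist U V) ->
  X `&` cyl u `&` cyl s !=set0 ->
  X `&` cyl s `&` cyl v !=set0 ->
  X `&` cyl u `&` cyl s `&` cyl v !=set0.

End Configurations.

Section Measures.
Variables (R : realType) (d : nat) (A : pfinType).
Implicit Types (mu : probability (conf d A) R) (S : {fset lattice d}).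

Definition shift_invariant mu : Prop :=
  forall (p : lattice d) (E : set (conf d A)), measurable E ->
  mu (shift p @^-1` E) = mu E.

Definition supp mu : set (conf d A) :=
  [set x | forall S, (0 < mu (cyl (restr S x)))%E].

(* Equal to 0 when [mu F = 0]. *)
Definition condp mu (E F : set (conf d A)) : R :=
  fine (mu (E `&` F)) / fine (mu F).

Definition MRF mu : Prop :=
  shift_invariant mu /\
  forall (S T : {fset lattice d}) (bT : (boundary S `<=` T)%fset),
    [disjoint T & S]%fset ->
  forall (u : {ffun S -> A}) (delta : {ffun T -> A}),
    (0 < mu (cyl delta))%E ->
  condp mu (cyl u) (cyl delta) = condp mu (cyl u) (cyl (subrestr bT delta)).

Definition disagreement S (u v : {ffun S -> A}) : {fset lattice d} :=
  [fset val p | p in [pred p : S | u p != v p]]%fset.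

Definition rate (f : nat -> R) (o : option nat) : R :=
  if o is Some n then f n else 0.

Definition SSM mu : Prop :=
  MRF mu /\
  exists f : nat -> R,
    [/\ forall n, 0 <= f n, f @ \oo --> 0 &
      forall (W U : {fset lattice d}), (U `<=` W)%fset ->
      forall (u : {ffun U -> A}) (delta1 delta2 : {ffun boundary W -> A}),
        (0 < mu (cyl delta1))%E -> (0 < mu (cyl delta2))%E ->
        `| condp mu (cyl u) (cyl delta1) - condp mu (cyl u) (cyl delta2) |
          <= #|` U|%:R * rate f (dist U (disagreement delta1 delta2))].

(* [ln 0 = 0], so null words contribute 0. *)
Definition entropy mu : R :=
  limn (fun n : nat => - (#|` box d n|%:R)^-1 *
    \sum_(w : {ffun box d n -> A}) fine (mu (cyl w)) * ln (fine (mu (cyl w)))).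

Definition pcond mu (x : conf d A) : R :=
  limn (fun n : nat => condp mu (cyl (restr [fset 0]%fset x)) (cyl (restr (past d n) x))).

Definition information mu (x : conf d A) : \bar R := (- lne (pcond mu x)%:E)%E.

End Measures.

(* [edge p i a b] is the value on the edge {p, p + e_i} of the configuration
   equal to a at p and to b at p + e_i. *)
Record interaction (R : realType) (d : nat) (A : Type) := Interaction {
  vertex : lattice d -> A -> R;
  edge : lattice d -> 'I_d -> A -> A -> \bar R;
  edge_ninfty : forall p i a b, edge p i a b != -oo%E;
  vertex_shift : forall q p a, vertex (q + p) a = vertex p a;
  edge_shift : forall q p i a b, edge (q + p) i a b = edge p i a b }.

Section Thermodynamics.
Variables (R : realType) (d : nat) (A : pfinType) (Phi : interaction R d A).
Implicit Types (mu : probability (conf d A) R) (S : {fset lattice d}).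
Local Open Scope ereal_scope.

Definition admissible : set (conf d A) :=
  [set x | forall p i, edge Phi p i (x p) (x (p + basis i)%R) != +oo].

Definition energy S (w : {ffun S -> A}) : \bar R :=
  \sum_(p : S) (vertex Phi (val p) (w p))%:E +
  \sum_(p : S) \sum_(q : S) \sum_(i < d | val q == (val p + basis i)%R)
    edge Phi (val p) i (w p) (w q).

Definition partition_function S : \bar R :=
  \sum_(w : {ffun S -> A}) expeR (- energy w).

Definition pressure : \bar R :=
  limn (fun n : nat =>
    ((#|` box d n|%:R)^-1)%:E * lne (partition_function (box d n))).

(* Meaningful on [admissible] (where it is finite), just as [information mu] is
   on [supp mu]; elsewhere the values are conventional. *)
Definition A_fun (x : conf d A) : \bar R :=
  - (vertex Phi 0%R (x 0%R))%:E - \sum_(i < d) edge Phi 0%R i (x 0%R) (x (basis i)).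

Definition free_energy mu : \bar R := (entropy mu)%:E + \int[mu]_x A_fun x.

Definition equilibrium_state mu : Prop :=
  [/\ shift_invariant mu, supp mu `<=` admissible &
    forall nu : probability (conf d A) R,
      shift_invariant nu -> supp nu `<=` admissible ->
      free_energy nu <= free_energy mu].

End Thermodynamics.

(* Main.v *)
(* Let M be the marginals of mu.  The variational principle, proved by taking limits
   of shift-averaged free-boundary Gibbs laws, identifies the pressure with the limit of
   - E_mu (ln M(B_n) + U_{B_n}) / |B_n|.  By a Lanford-Ruelle argument mu is Gibbs: words
   that agree near the boundary of B_n have the same value of ln M(B_n) + U_{B_n}.
   Together with TSSM, which lets any two words be joined across a shell at bounded
   conditional cost, this makes the oscillation of ln M(B_n) + U_{B_n} on the support
   o(|B_n|), so that E_mu may be replaced by E_nu.  The chain rule along the lexicographic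
   order writes - ln M(B_n) as a sum of conditional informations given parts of the past,
   which SSM makes uniformly close to translates of I_mu; the energy term averages to
   - A_Phi. *)

Require Import Defs.
From HB Require Import structures.
From mathcomp Require Import all_boot all_order all_algebra finmap.
From mathcomp Require Import all_classical all_reals all_analysis.
From mathcomp Require Import zify ring lra.

Set Implicit Arguments.
Unset Strict Implicit.
Unset Printing Implicit Defensive.

Import Order.TTheory GRing.Theory Num.Theory.
Import numFieldNormedType.Exports.

Local Open Scope classical_set_scope.
Local Open Scope ring_scope.

(** * Sums over words and cylinder measures *)

(** No hypothesis says that [mu] has Gibbs conditional laws or that its conditional probabilities
    stay away from 0; both are drawn from maximality. A first-order perturbation settles the former:
    modifying weights at a positive density of far-apart sites keeps the partition function, so a
    linear gain in the parameter, of either sign, would contradict the equality of free energy and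
    pressure. The latter follows from the Gibbs identity and TSSM: given any word on a finite set, a
    symbol that can occur has probability at least 1/K, with K independent of the set. This makes
    [ln] Lipschitz where it is applied, so that SSM, which controls differences of probabilities,
    also controls differences of information. The free-boundary laws are neither invariant nor
    consistent in n. Shift averaging repairs the first in the limit, an ultrafilter gives the limit
    on all events at once, and Shearer's inequality compares the entropy on a large box with that of
    the average on a fixed one. Marginals are functions [M S x] of a finite set and a total
    configuration, so that the same lemmas serve [mu], [nu] and averages that are not yet
    measures. *)

Section Sums.
Variables (R : realType) (d : nat) (A : pfinType).
Local Notation L := (lattice d).
Local Notation cfg := (lattice d -> A).
Implicit Types (S T : {fset L}) (x y : cfg) (p q : L) (F G : cfg -> R).

(** Total configurations let words on different finite sets live in one type; [point] is only a
    filler. *)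
Definition ext S (w : {ffun S -> A}) : cfg :=
  fun p => if insub p is Some q then w q else point.

Definition upd x p (a : A) : cfg := fun q => if q == p then a else x q.

Definition mask S x : cfg := fun p => if p \in S then x p else point.

Definition mix S x y : cfg := fun p => if p \in S then x p else y p.

Definition agree S x y := forall p, p \in S -> x p = y p.

Definition agreeb S x y : bool := restr S x == restr S y.

Definition trans p x : cfg := fun q => x (p + q).

(* Words on [S] are the total configurations equal to [point] off [S]. *)
Definition sumS S F : R := \sum_(w : {ffun S -> A}) F (ext w).

Definition local_on S F := forall x y, agree S x y -> F x = F y.

Lemma agreeP S x y : reflect (agree S x y) (agreeb S x y).
Proof.
apply: (iffP eqP) => [/ffunP e p pS|e].
  by have := e [` pS]%fset; rewrite !ffunE.
by apply/ffunP => p; rewrite !ffunE; apply: e; exact: valP.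
Qed.

Lemma agree_restr S x y : agree S x y -> restr S x = restr S y.
Proof. by move/agreeP/eqP. Qed.

Lemma extT S (w : {ffun S -> A}) (p : S) : ext w (val p) = w p.
Proof. by rewrite /ext valK. Qed.

Lemma extF S (w : {ffun S -> A}) p : p \notin S -> ext w p = point.
Proof. by move=> pS; rewrite /ext insubN. Qed.

Lemma restr_ext S (w : {ffun S -> A}) : restr S (ext w) = w.
Proof. by apply/ffunP => p; rewrite ffunE extT. Qed.

Lemma ext_restr S x : ext (restr S x) = mask S x.
Proof.
apply/funext => p; rewrite /mask; case: ifPn => pS; last by rewrite extF.
by rewrite (_ : p = val [` pS]%fset)// extT ffunE.
Qed.

Lemma mask_ext S (w : {ffun S -> A}) : mask S (ext w) = ext w.
Proof. by rewrite -ext_restr restr_ext. Qed.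

Lemma agree_mask S x : agree S (mask S x) x.
Proof. by move=> p pS; rewrite /mask pS. Qed.

Lemma agree_sym S x y : agree S x y -> agree S y x.
Proof. by move=> h p /h. Qed.

Lemma agree_trans S x y z : agree S x y -> agree S y z -> agree S x z.
Proof. by move=> h k p pS; rewrite h// k. Qed.

Lemma agree_sub S T x y : (S `<=` T)%fset -> agree T x y -> agree S x y.
Proof. by move=> /fsubsetP ST h p /ST /h. Qed.

Lemma agree_mixl S x y : agree S (mix S x y) x.
Proof. by move=> p pS; rewrite /mix pS. Qed.

Lemma eq_sumS S F G : (forall x, mask S x = x -> F x = G x) -> sumS S F = sumS S G.
Proof. by move=> h; apply: eq_bigr => w _; apply: h; rewrite mask_ext. Qed.

Lemma sumS0 F : sumS fset0 F = F (fun=> point).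
Proof.
rewrite /sumS (big_pred1 [ffun=> point]) => [|w].
  by congr F; apply/funext => p; rewrite extF// inE.
by apply/esym/eqP/ffunP => -[p pS]; exfalso; rewrite inE in pS.
Qed.

Lemma sumS_U1 S p F : p \notin S ->
  sumS (p |` S)%fset F = sumS S (fun x => \sum_a F (upd x p a)).
Proof.
move=> pS; rewrite /sumS pair_big/=.
pose h (u : {ffun S -> A} * A) : {ffun (p |` S)%fset -> A} :=
  restr (p |` S)%fset (upd (ext u.1) p u.2).
have hE u : ext (h u) = upd (ext u.1) p u.2.
  rewrite /h ext_restr; apply/funext => q; rewrite /mask /upd !inE.
  case: (eqVneq q p) => [->//|qp] /=.
  by case: ifPn => // qS; rewrite extF.
rewrite (reindex h) /=; last first.
  exists (fun w => (restr S (ext w), ext w p)) => [[w a] _|w _]/=.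
    rewrite hE /=; congr pair; last by rewrite /upd eqxx.
    apply/ffunP => q; rewrite ffunE /upd ifN ?extT//.
    by apply: contraNneq pS => <-; exact: valP.
  rewrite /h /= -[RHS]restr_ext; apply: agree_restr => q.
  rewrite !inE /upd ext_restr /mask; case: eqP => [->//|_]/= ->; by [].
by apply: eq_bigr => u _; rewrite hE.
Qed.

Lemma sumS_add S F G : sumS S (fun x => F x + G x) = sumS S F + sumS S G.
Proof. exact: big_split. Qed.

Lemma sumS_scale S (c : R) F : sumS S (fun x => c * F x) = c * sumS S F.
Proof. by rewrite /sumS mulr_sumr. Qed.

Lemma sumS_sub S F G : sumS S (fun x => F x - G x) = sumS S F - sumS S G.
Proof. by rewrite /sumS sumrB. Qed.

Lemma sumS_opp S F : sumS S (fun x => - F x) = - sumS S F.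
Proof. by rewrite /sumS sumrN. Qed.

Lemma sumS_sum S (I : Type) (r : seq I) (P : pred I) (F : I -> cfg -> R) :
  sumS S (fun x => \sum_(i <- r | P i) F i x) = \sum_(i <- r | P i) sumS S (F i).
Proof. exact: exchange_big. Qed.

Lemma ler_sumS S F G : (forall x, mask S x = x -> F x <= G x) -> sumS S F <= sumS S G.
Proof. by move=> h; apply: ler_sum => w _; apply: h; rewrite mask_ext. Qed.

Lemma sumS_ge0 S F : (forall x, mask S x = x -> 0 <= F x) -> 0 <= sumS S F.
Proof. by move=> h; apply: sumr_ge0 => w _; apply: h; rewrite mask_ext. Qed.

Lemma sumS_pick S x F : local_on S F ->
  sumS S (fun w => if agreeb S w x then F w else 0) = F x.
Proof.
move=> lF; rewrite /sumS (bigD1 (restr S x))//= ext_restr.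
have -> : agreeb S (mask S x) x by apply/agreeP/agree_mask.
rewrite big1 ?addr0; first by apply: lF; exact: agree_mask.
move=> w wx; case: ifPn => // /eqP; rewrite restr_ext => e.
by rewrite e eqxx in wx.
Qed.

(** Change of variables for maps that keep words on [S] and square to the identity; applied to
    [swap], it shows that an odd summand has sum 0. *)
Lemma sumS_invol S (h : cfg -> cfg) F :
  (forall x, mask S x = x -> mask S (h x) = h x) ->
  (forall x, mask S x = x -> h (h x) = x) ->
  sumS S (F \o h) = sumS S F.
Proof.
move=> hm hh; rewrite /sumS; apply/esym.
rewrite (reindex_inj (h := fun w => restr S (h (ext w)))).
  apply: eq_bigr => w _; congr F; by rewrite ext_restr hm// mask_ext.
apply: (can_inj (g := fun w => restr S (h (ext w)))) => w.
by rewrite ext_restr hm ?mask_ext// hh ?mask_ext// restr_ext.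
Qed.

Lemma sumS_U S T F : [disjoint S & T]%fset ->
  sumS (S `|` T)%fset F = sumS S (fun x => sumS T (fun y => F (mix S x y))).
Proof.
elim/fset1U_rect: T F => [|p T pT IH] F.
  move=> _; rewrite fsetU0; apply: eq_sumS => x xm; rewrite sumS0; congr F.
  by rewrite -{1}xm.
rewrite fdisjointXU fdisjointX1 => /andP[pS dj].
have pST : p \notin (S `|` T)%fset by rewrite inE negb_or pS.
rewrite fsetUCA sumS_U1// IH//.
apply: eq_sumS => x _; rewrite sumS_U1//; apply: eq_sumS => y _.
apply: eq_bigr => a _; congr F; apply/funext => q; rewrite /upd /mix.
by case: eqP => [->|//]; rewrite (negbTE pS).
Qed.

Lemma sumS_const S (c : R) : sumS S (fun=> c) = (#|A| ^ #|` S|)%:R * c.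
Proof.
by rewrite /sumS sumr_const card_ffun -cardfE mulr_natl.
Qed.

Definition shiftfs p S : {fset L} := [fset (p + q)%R | q in S]%fset.

Lemma in_shiftfs p S q : (q \in shiftfs p S) = (q - p \in S).
Proof.
apply/imfsetP/idP => /= [[r rS ->]|qS]; first by rewrite addrC addKr.
by exists (q - p) => //; rewrite addrC subrK.
Qed.

Lemma card_shiftfs p S : #|` shiftfs p S| = #|` S|.
Proof. by rewrite card_imfset//; exact: addrI. Qed.

Lemma agree_trans_cfg p S x y : agree (shiftfs p S) x y <-> agree S (trans p x) (trans p y).
Proof.
split=> h q; first by move=> qS; apply: h; rewrite in_shiftfs addrC addKr.
by rewrite in_shiftfs => /h; rewrite /trans addrCA subrr addr0.
Qed.

Lemma transK p x : trans (- p) (trans p x) = x.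
Proof. by apply/funext => q; rewrite /trans addrA subrr add0r. Qed.

Lemma transNK p x : trans p (trans (- p) x) = x.
Proof. by apply/funext => q; rewrite /trans addrA addNr add0r. Qed.

Lemma transD p q x : trans p (trans q x) = trans (q + p) x.
Proof. by apply/funext => r; rewrite /trans addrA. Qed.

Lemma shiftfsU1 p q S : shiftfs p (q |` S)%fset = ((p + q)%R |` shiftfs p S)%fset.
Proof.
apply/fsetP => r; rewrite !(in_shiftfs, inE); congr (_ || _).
by rewrite subr_eq addrC.
Qed.

Lemma shiftfs0 p : shiftfs p fset0 = fset0 :> {fset L}.
Proof. by apply/fsetP => q; rewrite in_shiftfs !inE. Qed.

Lemma sumS_shift p S F : sumS (shiftfs p S) (F \o trans p) = sumS S F.
Proof.
elim/fset1U_rect: S F => [|q S qS IH] F; first by rewrite shiftfs0 !sumS0 /=; congr F.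
have pq : p + q \notin shiftfs p S by rewrite in_shiftfs addrC addKr.
rewrite shiftfsU1 !sumS_U1// -IH; apply: eq_sumS => x _ /=; apply: eq_bigr => a _.
congr F; apply/funext => r; rewrite /trans /upd.
by rewrite (inj_eq (addrI p)).
Qed.

End Sums.
Section CylinderMeasures.
Variables (R : realType) (d : nat) (A : pfinType).
Local Notation L := (lattice d).
Local Notation cfg := (lattice d -> A).
Implicit Types (S T : {fset L}) (x y : cfg) (p q : L) (F G : cfg -> R).
Implicit Types (M : {fset L} -> cfg -> R).

(* [M S x] stands for the measure of the cylinder of the configurations that agree
   with [x] on [S]. *)
Definition cylmeas M := [/\ forall S x, 0 <= M S x,
  forall S, local_on S (M S),
  forall S x p, p \notin S -> M S x = \sum_a M (p |` S)%fset (upd x p a) &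
  forall x, M fset0 x = 1].

Definition expect M S F : R := sumS S (fun x => M S x * F x).

Definition invariant M := forall p S x, M (shiftfs p S) x = M S (trans p x).

Lemma fsetU_setD S T : (S `<=` T)%fset -> (S `|` (T `\` S))%fset = T.
Proof.
move=> /fsubsetP ST; apply/fsetP => p; rewrite !inE.
by case: (boolP (p \in S)) => [/ST->|].
Qed.

Lemma disjoint_setD S T : [disjoint S & (T `\` S)%fset]%fset.
Proof. by apply/fdisjointP => p pS; rewrite inE pS. Qed.

Variables (M : {fset L} -> cfg -> R) (cM : cylmeas M).

Lemma M_ge0 S x : 0 <= M S x. Proof. by have [h _ _ _] := cM. Qed.

Lemma M_local S : local_on S (M S). Proof. by have [_ h _ _] := cM. Qed.

Lemma M_total S T x : [disjoint S & T]%fset ->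
  M S x = sumS T (fun w => M (S `|` T)%fset (mix S x w)).
Proof.
elim/fset1U_rect: T => [|p T pT IH].
  by move=> _; rewrite sumS0 fsetU0; apply: M_local => p pS; rewrite agree_mixl.
rewrite fdisjointXU fdisjointX1 => /andP[pS dj].
rewrite IH// sumS_U1//; apply: eq_sumS => y _; rewrite fsetUCA.
have [_ _ h _] := cM; rewrite (h _ _ p) ?inE ?negb_or ?pS//.
apply: eq_bigr => a _; congr M; apply/funext => q; rewrite /upd /mix.
by case: eqP => [->|//]; rewrite (negbTE pS).
Qed.

(** Consistency of the marginals sums out the sites of [T] outside [S]. Expectations of local
    functions can thus be taken over any common larger set. *)
Lemma expect_sub S T F : (S `<=` T)%fset -> local_on S F -> expect M T F = expect M S F.
Proof.
move=> ST lF; rewrite /expect -{1 2}(fsetU_setD ST).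
rewrite sumS_U ?disjoint_setD//; apply: eq_sumS => x _.
rewrite (@M_total S (T `\` S)%fset) ?disjoint_setD// mulrC -sumS_scale.
apply: eq_sumS => y _; rewrite mulrC; congr (_ * _).
by apply: lF; exact: agree_mixl.
Qed.

Lemma expect_cst S (c : R) : expect M S (fun=> c) = c.
Proof.
rewrite (@expect_sub fset0)// /expect sumS0.
by have [_ _ _ ->] := cM; rewrite mul1r.
Qed.

Lemma expect_ind S T x : (S `<=` T)%fset ->
  expect M T (fun w => (agreeb S w x)%:R) = M S x.
Proof.
move=> ST; rewrite (expect_sub ST); last first.
  move=> y z yz; congr (nat_of_bool _)%:R.
  by apply/agreeP/agreeP; apply: agree_trans => //; exact: agree_sym.
rewrite -[RHS](sumS_pick x (@M_local S)); apply: eq_sumS => y _.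
by case: ifP; rewrite (mulr1, mulr0).
Qed.

Lemma expect_add S F G : expect M S (fun x => F x + G x) = expect M S F + expect M S G.
Proof. by rewrite /expect -sumS_add; apply: eq_sumS => x _; rewrite mulrDr. Qed.

Lemma expect_scale S (c : R) F : expect M S (fun x => c * F x) = c * expect M S F.
Proof. by rewrite /expect -sumS_scale; apply: eq_sumS => x _; rewrite mulrCA. Qed.

Lemma expect_opp S F : expect M S (fun x => - F x) = - expect M S F.
Proof. by rewrite /expect -sumS_opp; apply: eq_sumS => x _; rewrite mulrN. Qed.

Lemma expect_sum S (I : Type) (r : seq I) (P : pred I) (F : I -> cfg -> R) :
  expect M S (fun x => \sum_(i <- r | P i) F i x) = \sum_(i <- r | P i) expect M S (F i).
Proof.
by rewrite /expect -sumS_sum; apply: eq_sumS => x _; rewrite mulr_sumr.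
Qed.

Lemma eq_expect S F G : (forall x, 0 < M S x -> F x = G x) -> expect M S F = expect M S G.
Proof.
move=> h; apply: eq_sumS => x _; have := M_ge0 S x.
by rewrite le_eqVlt => /predU1P[<-|/h->//]; rewrite !mul0r.
Qed.

Lemma ler_expect S F G : (forall x, 0 < M S x -> F x <= G x) -> expect M S F <= expect M S G.
Proof.
move=> h; apply: ler_sumS => x _; have := M_ge0 S x.
rewrite le_eqVlt => /predU1P[<-|Mx]; first by rewrite !mul0r.
by rewrite ler_wpM2l ?h// ltW.
Qed.

Lemma ler_norm_expect S F G (e : R) : (forall x, 0 < M S x -> `|F x - G x| <= e) ->
  `|expect M S F - expect M S G| <= e.
Proof.
move=> h; rewrite ler_norml lerBrDr lerBlDr; apply/andP; split.
  rewrite -{1}(expect_cst S (- e)) -expect_add; apply: ler_expect => x /h.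
  by rewrite ler_norml => /andP[]; lra.
rewrite -{1}(expect_cst S e) -expect_add; apply: ler_expect => x /h.
by rewrite ler_norml => /andP[]; lra.
Qed.

Lemma M_mono S T x : (S `<=` T)%fset -> M T x <= M S x.
Proof.
move=> ST; rewrite -(expect_ind _ (fsubset_refl T)) -(expect_ind _ ST).
apply: ler_expect => y _; rewrite ler_nat; case: agreeP => //= h.
suff -> : agreeb S y x by [].
by apply/agreeP; exact: agree_sub ST h.
Qed.

Lemma M_pos_sub S T x : (S `<=` T)%fset -> 0 < M T x -> 0 < M S x.
Proof. by move=> ST h; apply: lt_le_trans (M_mono _ ST). Qed.

Lemma M_le1 S x : M S x <= 1.
Proof.
by have [_ _ _ h] := cM; rewrite -(h x) M_mono ?fsub0set.
Qed.

Lemma expect_shift p S F : invariant M ->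
  expect M (shiftfs p S) (F \o trans p) = expect M S F.
Proof.
move=> iM; rewrite /expect -[RHS](sumS_shift p); apply: eq_sumS => x _ /=.
by rewrite iM.
Qed.

End CylinderMeasures.

(** * Boxes, their translates and the volume of their shells *)

Section Boxes.
Variable (d : nat).
Local Notation L := (lattice d).
Local Notation B := (box d).
Implicit Types (p q : L).

Lemma latD p q (i : 'I_d) : (p + q) i = p i + q i.
Proof. by rewrite [LHS]ffunE. Qed.

Lemma latN p (i : 'I_d) : (- p) i = - p i.
Proof. by rewrite [LHS]ffunE. Qed.

Lemma in_boxP n p : reflect (forall i : 'I_d, (absz (p i) <= n)%N) (p \in B n).
Proof. by rewrite in_box; exact: forallP. Qed.

Lemma box_le m n : (m <= n)%N -> (B m `<=` B n)%fset.
Proof.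
by move=> mn; apply/fsubsetP => p /in_boxP h; apply/in_boxP => i; exact: leq_trans mn.
Qed.

Lemma box_add m n p q : p \in B m -> q \in B n -> p + q \in B (m + n).
Proof.
move=> /in_boxP pm /in_boxP qn; apply/in_boxP => i; rewrite latD.
by have := pm i; have := qn i; lia.
Qed.

Lemma box_opp n p : (- p \in B n) = (p \in B n).
Proof. by rewrite !in_box; apply: eq_forallb => i; rewrite latN abszN. Qed.

Lemma box_sub m n p q : p \in B m -> q \in B n -> p - q \in B (m + n).
Proof. by move=> pm qn; rewrite box_add ?box_opp. Qed.

Lemma box_shift m n p : p \in B m -> (shiftfs p (B n) `<=` B (m + n))%fset.
Proof.
move=> pm; apply/fsubsetP => q; rewrite in_shiftfs => qn.
by rewrite -(subrK p q) addrC box_add.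
Qed.

Lemma box0 n : 0 \in B n.
Proof. by apply/in_boxP => i; rewrite ffunE. Qed.

Lemma basis_box (i : 'I_d) n : (0 < n)%N -> Defs.basis i \in B n.
Proof.
move=> n0; apply/in_boxP => j; rewrite ffunE.
by case: (j == i).
Qed.

Lemma absz_shift (z : int) n : (absz z <= n)%N ->
  (absz (z + n%:Z)%R < (n + n).+1)%N /\ z = (absz (z + n%:Z)%R)%:Z - n%:Z.
Proof. by move=> zn; split; lia. Qed.

Lemma card_box n : #|` B n| = ((n + n).+1 ^ d)%N.
Proof.
pose h (f : {ffun 'I_d -> 'I_(n + n).+1}) : L := [ffun i => (f i : nat)%:Z - n%:Z].
have -> : B n = [fset h f | f in {ffun 'I_d -> 'I_(n + n).+1}]%fset.
  apply/fsetP => p; apply/in_boxP/imfsetP => [pn|[f _ ->] i].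
    have hlt i : (absz (p i + n%:Z)%R < (n + n).+1)%N by case: (absz_shift (pn i)).
    exists [ffun i => Ordinal (hlt i)] => //; apply/ffunP => i; rewrite !ffunE /=.
    by case: (absz_shift (pn i)).
  by rewrite ffunE; move: (f i) => [m /= mn]; lia.
rewrite card_imfset/=; last first.
  move=> f g /ffunP fg; apply/ffunP => i; apply/val_inj => /=.
  by have := fg i; rewrite !ffunE; lia.
by rewrite -cardE card_ffun !card_ord.
Qed.

End Boxes.

Lemma cvg_exp (R : realType) (u : nat -> R) (l : R) k :
  u @ \oo --> l -> (fun n => u n ^+ k) @ \oo --> l ^+ k.
Proof.
move=> ul; elim: k => [|k IH].
  by rewrite expr0 (_ : (fun n => u n ^+ 0) = (fun=> 1)); [exact: cvg_cst | apply/funext => n; rewrite expr0].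
rewrite exprS (_ : (fun n => u n ^+ k.+1) = (fun n => u n * u n ^+ k)); last first.
  by apply/funext => n; rewrite exprS.
exact: cvgM.
Qed.

Section Shells.
Variables (R : realType) (d : nat).
Local Notation L := (lattice d).
Local Notation B := (box d).

Definition vol n : R := #|` B n|%:R.
(** Two-sided: this one quantity bounds both the inner layer of [B n] of depth [k] and the overhang
    of its translates by sites of [B k]. For [n < k] the truncated subtraction shrinks the inner box
    to the origin. *)
Definition shell k n : R := vol (n + k) - vol (n - k).

Lemma vol_gt0 n : 0 < vol n.
Proof. by rewrite ltr0n card_box expn_gt0. Qed.

Lemma vol_neq0 n : vol n != 0.
Proof. by rewrite gt_eqF// vol_gt0. Qed.

Lemma vol_le m n : (m <= n)%N -> vol m <= vol n.
Proof. by move=> mn; rewrite ler_nat fsubset_leq_card// box_le. Qed.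

Lemma card_box_diff k n : #|` (B n `\` B (n - k))%fset|%:R <= shell k n.
Proof.
rewrite cardfsDS ?box_le ?leq_subr// natrB ?fsubset_leq_card ?box_le ?leq_subr//.
by rewrite lerB ?vol_le ?leq_addr.
Qed.

(** Volumes are [d]-th powers of side lengths; the sides differ by a bounded amount while [b n]
    tends to infinity, so their ratio tends to 1. *)
Lemma vol_ratio_cvg (a b : nat -> nat) (c : R) :
  (forall n, `|((a n + a n).+1)%:R - ((b n + b n).+1)%:R| <= c :> R) ->
  (forall k, \forall n \near \oo, (k <= b n)%N) ->
  (fun n => vol (a n) / vol (b n)) @ \oo --> (1 : R).
Proof.
move=> ab boo.
have h1 : (fun n => ((a n + a n).+1)%:R / ((b n + b n).+1)%:R) @ \oo --> (1 : R).
  apply/cvgrPdist_le => e e0.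
  near=> n; rewrite -[X in X - _](@divff _ (b n + b n).+1%:R) ?pnatr_eq0//.
  rewrite -mulrBl normrM normfV distrC normr_nat ler_pdivrMr ?ltr0n//.
  apply: le_trans (ab n) _; rewrite mulrC -ler_pdivrMr//.
  apply: ltW; apply: lt_le_trans (unstable.ltr_bound _) _.
  rewrite ler_nat; apply: (@leq_trans (b n)); last by lia.
  by near: n; exact: boo.
have -> : (fun n => vol (a n) / vol (b n)) =
    (fun n => (((a n + a n).+1)%:R / ((b n + b n).+1)%:R : R) ^+ d).
  by apply/funext => n; rewrite /vol !card_box !natrX expr_div_n.
by have := cvg_exp (k := d) h1; rewrite expr1n.
Unshelve. all: by end_near. Qed.

Lemma shell_cvg k : (fun n => shell k n / vol n) @ \oo --> (0 : R).
Proof.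
rewrite -(subrr 1) /shell; under eq_fun do rewrite mulrBl.
apply: cvgB.
  apply: (@vol_ratio_cvg (fun n => n + k)%N id (k + k)%:R).
    move=> n; rewrite -natrB; last by lia.
    by rewrite ger0_norm// ler_nat; lia.
  by move=> m; near=> n; near: n; exact: nbhs_infty_ge.
apply: (@vol_ratio_cvg (fun n => n - k)%N id (k + k)%:R).
  move=> n; rewrite distrC -natrB; last by lia.
  by rewrite ger0_norm// ler_nat; lia.
by move=> m; near=> n; near: n; exact: nbhs_infty_ge.
Unshelve. all: by end_near. Qed.

End Shells.
(** * Entropy and Shearer's inequality *)

Section Entropy.
Variables (R : realType) (d : nat) (A : pfinType).
Local Notation L := (lattice d).
Local Notation cfg := (lattice d -> A).
Implicit Types (S T Q : {fset L}) (x y : cfg) (p q : L) (F G : cfg -> R).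
Implicit Types (M : {fset L} -> cfg -> R).

Definition eta (t : R) : R := - (t * ln t).

Definition ent M S : R := sumS S (fun x => eta (M S x)).

Lemma ln_le_sub1 (t : R) : 0 < t -> ln t <= t - 1.
Proof. by move=> t0; have := @le_ln1Dx R (t - 1); rewrite [1 + _]addrC subrK; apply; lra. Qed.

Lemma eta_ge0 (t : R) : 0 <= t -> t <= 1 -> 0 <= eta t.
Proof.
move=> t0 t1; rewrite /eta oppr_ge0 mulr_ge0_le0//; exact: ln_le0.
Qed.

(** The right-hand side is the tangent to the concave [eta] at [s], evaluated at [t]. The hypothesis
    about [s = 0] guards against the convention [ln 0 = 0]. Submodularity, Jensen's inequality,
    upper semicontinuity and the Gibbs inequality below all come from this one bound. *)
Lemma eta_tangent (s t : R) : 0 <= t -> (s = 0 -> t = 0) -> 0 <= s ->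
  eta t <= - t * ln s + s - t.
Proof.
move=> t0 st s0; rewrite /eta.
have [tE|tn] := eqVneq t 0; first by rewrite tE; lra.
have tp : 0 < t by rewrite lt_neqAle eq_sym tn.
have sp : 0 < s by rewrite lt_neqAle s0 andbT; apply: contraNneq tn => /esym/st->.
have := ln_le_sub1 (divr_gt0 sp tp); rewrite ln_div ?posrE// => h.
have : t * (ln s - ln t) <= t * (s / t - 1) by rewrite ler_pM2l.
by rewrite mulrBr mulrBr [t * (s / t)]mulrC divfK ?gt_eqF// mulr1; lra.
Qed.

Lemma eta_le1 (t : R) : 0 <= t -> eta t <= 1.
Proof.
move=> t0; have := @eta_tangent 1 t t0.
by rewrite ln1 mulr0 => h; apply: le_trans (h _ _) _ => //; lra.
Qed.

(** Nonnegativity of mutual information for an unnormalised table of mass [t]: each entry is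
    compared, by the tangent bound, with the product [r i * c j / t] of its marginals, whose total
    mass is again [t]. *)
Lemma eta_submod (a b : finType) (P : a -> b -> R) : (forall i j, 0 <= P i j) ->
  \sum_i \sum_j eta (P i j) + eta (\sum_i \sum_j P i j) <=
  \sum_i eta (\sum_j P i j) + \sum_j eta (\sum_i P i j).
Proof.
move=> P0; set t := \sum_i \sum_j P i j.
pose r i := \sum_j P i j; pose c j := \sum_i P i j.
have r0 i : 0 <= r i by apply: sumr_ge0.
have c0 j : 0 <= c j by apply: sumr_ge0.
have tE : t = \sum_j c j by rewrite /t exchange_big.
have [t0|tn] := eqVneq t 0.
  have rE i : r i = 0 by exact: (psumr_eq0P (fun i _ => r0 i) t0).
  have PE i j : P i j = 0 by exact: (psumr_eq0P (fun j _ => P0 i j) (rE i)).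
  have cE j : c j = 0 by rewrite /c big1.
  under eq_bigr do under eq_bigr do rewrite PE.
  under [X in _ <= X + _]eq_bigr do rewrite -/(r _) rE.
  under [X in _ <= _ + X]eq_bigr do rewrite -/(c _) cE.
  by rewrite t0 /eta mul0r oppr0 !big1// => *; rewrite big1.
have tp : 0 < t by rewrite lt_neqAle eq_sym tn; apply: sumr_ge0 => i _; exact: r0.
have key i j : eta (P i j) <= - P i j * (ln (r i) + ln (c j) - ln t) + r i * c j / t - P i j.
  have [Pz|Pn] := eqVneq (P i j) 0.
    have := divr_ge0 (mulr_ge0 (r0 i) (c0 j)) (ltW tp).
    by rewrite Pz /eta !mul0r oppr0 mul0r; lra.
  have Pp : 0 < P i j by rewrite lt_neqAle eq_sym Pn P0.
  have rp : 0 < r i by apply: lt_le_trans Pp _; rewrite /r (bigD1 j)//= lerDl sumr_ge0.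
  have cp : 0 < c j by apply: lt_le_trans Pp _; rewrite /c (bigD1 i)//= lerDl sumr_ge0.
  have rc := divr_gt0 (mulr_gt0 rp cp) tp.
  rewrite -lnM ?posrE// -ln_div ?posrE ?mulr_gt0//.
  by apply: eta_tangent => //; [move=> /eqP; rewrite gt_eqF | exact: ltW].
have : \sum_i \sum_j eta (P i j) <=
    \sum_i \sum_j (- P i j * (ln (r i) + ln (c j) - ln t) + r i * c j / t - P i j).
  by apply: ler_sum => i _; apply: ler_sum => j _.
have -> : \sum_i \sum_j (- P i j * (ln (r i) + ln (c j) - ln t) + r i * c j / t - P i j)
  = \sum_i eta (r i) + \sum_j eta (c j) - eta t.
  transitivity (\sum_i \sum_j (- P i j * ln (r i)) + \sum_i \sum_j (- P i j * ln (c j))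
     + \sum_i \sum_j (P i j * ln t) + \sum_i \sum_j r i * c j / t - \sum_i \sum_j P i j).
    rewrite -!big_split -sumrB/=; apply: eq_bigr => i _.
    rewrite -!big_split -sumrB/=; apply: eq_bigr => j _; ring.
  have -> : \sum_i \sum_j (- P i j * ln (r i)) = \sum_i eta (r i).
    by apply: eq_bigr => i _; rewrite -mulr_suml sumrN /eta mulNr.
  have -> : \sum_i \sum_j (- P i j * ln (c j)) = \sum_j eta (c j).
    by rewrite exchange_big; apply: eq_bigr => j _; rewrite -mulr_suml sumrN /eta mulNr.
  have -> : \sum_i \sum_j (P i j * ln t) = - eta t.
    rewrite /eta opprK /t mulr_suml; apply: eq_bigr => i _; by rewrite mulr_suml.
  have -> : \sum_i \sum_j r i * c j / t = t.
    under eq_bigr do rewrite -mulr_suml -mulr_sumr -tE -mulrA divff// mulr1.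
    by [].
  by rewrite -/t; ring.
by rewrite -/t; lra.
Qed.

Section OneMeasure.
Variables (M : {fset L} -> cfg -> R) (cM : cylmeas M).
Local Notation H := (ent M).

(** Conditional mutual information of the symbols at [p] and [q]: for every word on [Q], the table
    of their joint masses is fed to [eta_submod]. *)
Lemma ent_submod1 Q p q : p \notin Q -> q \notin Q -> p != q ->
  H (p |` (q |` Q))%fset + H Q <= H (p |` Q)%fset + H (q |` Q)%fset.
Proof.
move=> pQ qQ pq; have [M0 Ml Ms _] := cM.
have pqQ : p \notin (q |` Q)%fset by rewrite !inE negb_or pq.
have qpQ : q \notin (p |` Q)%fset by rewrite !inE negb_or eq_sym pq.
rewrite /ent !sumS_U1// -!sumS_add; apply: ler_sumS => x _.
pose P a b := M (p |` (q |` Q))%fset (upd (upd x q b) p a).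
have := @eta_submod A A P (fun _ _ => M0 _ _).
have -> : \sum_a \sum_b P a b = M Q x.
  rewrite exchange_big (Ms Q x q)//; apply: eq_bigr => b _; by rewrite (Ms _ _ p).
have -> : \sum_a eta (\sum_b P a b) = \sum_a eta (M (p |` Q)%fset (upd x p a)).
  apply: eq_bigr => a _; congr eta; rewrite (Ms _ _ q)// fsetUCA.
  apply: eq_bigr => b _; congr M; apply/funext => r; rewrite /upd.
  by case: (eqVneq r p) => // ->; rewrite (negbTE pq).
have -> : \sum_b eta (\sum_a P a b) = \sum_b eta (M (q |` Q)%fset (upd x q b)).
  by apply: eq_bigr => b _; congr eta; rewrite (Ms _ _ p).
by rewrite exchange_big.
Qed.

(** The sites of [T] outside [Q] join the condition one at a time, each by [ent_submod1]. *)
Lemma ent_cond_le Q T p : (Q `<=` T)%fset -> p \notin T ->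
  H (p |` T)%fset - H T <= H (p |` Q)%fset - H Q.
Proof.
move=> QT; rewrite -(fsetU_setD QT) fsetUC; move: (disjoint_setD Q T).
elim/fset1U_rect: (T `\` Q)%fset => [|q D qD IH]; first by rewrite fset0U.
rewrite fdisjointXU fdisjointX1 => /andP[qQ dj].
rewrite -fsetUA !inE !negb_or => /andP[pq pDQ].
apply: le_trans (IH dj _); last by rewrite inE negb_or.
have := @ent_submod1 (D `|` Q)%fset p q; rewrite !inE !negb_or pDQ qD qQ pq.
by move=> /(_ isT isT isT); lra.
Qed.

Lemma ent_ge0 S : 0 <= H S.
Proof. by apply: sumS_ge0 => x _; rewrite eta_ge0 ?M_ge0 ?M_le1. Qed.

(** Far from the sharp bound, which is linear in the number of sites, but it is applied only to sets
    no larger than a fixed box, where any bound independent of [n] will do. *)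
Lemma ent_crude S : H S <= (#|A| ^ #|` S|)%:R.
Proof.
rewrite -[leRHS]mulr1 -sumS_const; apply: ler_sumS => x _.
by rewrite eta_le1// M_ge0.
Qed.

Lemma ent0 : H fset0 = 0.
Proof. by have [_ _ _ h] := cM; rewrite /ent sumS0 h /eta ln1 mulr0 oppr0. Qed.

(* Shearer's inequality: build [T] one site at a time; every set of the cover
   that contains the new site gains at least the conditional entropy given all of [T]. *)
Lemma shearer (I : Type) (s : seq I) (C : I -> {fset L}) (K : nat) T :
  (forall p, p \in T -> count (fun i => p \in C i) s = K) ->
  K%:R * H T <= \sum_(i <- s) H (C i `&` T)%fset.
Proof.
elim/fset1U_rect: T => [|p T pT IH] hK.
  by rewrite ent0 mulr0 sumr_ge0// => i _; exact: ent_ge0.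
have {}IH : K%:R * H T <= \sum_(i <- s) H (C i `&` T)%fset.
  by apply: IH => q qT; apply: hK; rewrite !inE qT orbT.
have Kp : count (fun i => p \in C i) s = K by apply: hK; rewrite !inE eqxx.
have -> : K%:R * H (p |` T)%fset = K%:R * H T + K%:R * (H (p |` T)%fset - H T) by ring.
have -> : \sum_(i <- s) H (C i `&` (p |` T))%fset =
    \sum_(i <- s) H (C i `&` T)%fset +
    \sum_(i <- s) (H (C i `&` (p |` T))%fset - H (C i `&` T)%fset).
  by rewrite -big_split/=; apply: eq_bigr => i _; rewrite addrC subrK.
apply: lerD => //.
rewrite -Kp -sum1_count natr_sum mulr_suml big_mkcond/=; apply: ler_sum => i _.
case: ifPn => pC; last first.
  suff -> : (C i `&` (p |` T) = C i `&` T)%fset by rewrite subrr.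
  apply/fsetP => q; rewrite !inE; case: (eqVneq q p) => [->|//].
  by rewrite (negbTE pC).
have -> : (C i `&` (p |` T) = p |` (C i `&` T))%fset.
  by apply/fsetP => q; rewrite !inE; case: (eqVneq q p) => [->|//]; rewrite pC.
by rewrite mul1r ent_cond_le ?fsubsetIr.
Qed.

End OneMeasure.

End Entropy.

(** * Shift averages and convergence of the entropy rate *)

Section Averages.
Variables (R : realType) (d : nat) (A : pfinType).
Local Notation L := (lattice d).
Local Notation cfg := (lattice d -> A).
Local Notation B := (box d).
Local Notation vol := (vol R d).
Local Notation shell := (shell R d).
Implicit Types (S T Q : {fset L}) (x y : cfg) (p q : L) (F G : cfg -> R).
Implicit Types (M : {fset L} -> cfg -> R).

Lemma eta_concave (I : Type) (s : seq I) (N : R) (t : I -> R) :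
  0 < N -> N = (size s)%:R -> (forall i, 0 <= t i) ->
  \sum_(i <- s) eta (t i) <= N * eta (N^-1 * \sum_(i <- s) t i).
Proof.
move=> N0 Ns t0; set m := N^-1 * _.
have tE : \sum_(i <- s) t i = N * m by rewrite /m mulrA divff ?gt_eqF// mul1r.
have m0 : 0 <= m by rewrite /m mulr_ge0 ?sumr_ge0// invr_ge0 ltW.
(* There is no tangent at mean 0; but then all the terms vanish. *)
have [mz|mn] := eqVneq m 0.
  have st : \sum_(i <- s) t i = 0 by rewrite tE mz mulr0.
  rewrite mz /eta mul0r oppr0 mulr0; elim: s st {Ns m tE m0 mz} => [|i s IH].
    by rewrite !big_nil.
  rewrite !big_cons => st.
  have s0 : 0 <= \sum_(i <- s) t i by apply: sumr_ge0.
  have ti : t i = 0 by have := t0 i; lra.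
  by rewrite ti mul0r oppr0 add0r IH//; lra.
apply: (@le_trans _ _ (\sum_(i <- s) (- t i * ln m + m - t i))).
  by apply: ler_sum => i _; apply: eta_tangent => // mE; rewrite mE eqxx in mn.
rewrite sumrB big_split/= -mulr_suml sumrN tE big_const_seq count_predT iter_addr_0.
rewrite -mulr_natr -Ns /eta le_eqVlt; apply/orP; left; apply/eqP; ring.
Qed.

(** Marginals of the average of the translates of [M] over [B n]. As a formula on marginals it makes
    sense before any measure is at hand. *)
Definition avg M n S x : R := (vol n)^-1 * \sum_(p <- B n) M (shiftfs p S) (trans (- p) x).

Lemma avg_inv M n : invariant M -> avg M n = M.
Proof.
move=> iM; apply/funext => S; apply/funext => x; rewrite /avg.
under eq_bigr do rewrite iM transNK.
rewrite big_const_seq count_predT iter_addr_0 -(mulr_natl (M S x)) mulrA mulVf ?mul1r//.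
exact: vol_neq0.
Qed.

Lemma cylmeas_avg M n : cylmeas M -> cylmeas (avg M n).
Proof.
move=> [M0 Ml Ms M1]; split=> [S x|S x y xy|S x p pS|x].
- by rewrite mulr_ge0 ?invr_ge0 ?ler0n// sumr_ge0.
- congr (_ * _); apply: eq_bigr => p _; apply: Ml; apply/agree_trans_cfg.
  by rewrite !transNK.
- rewrite -mulr_sumr; congr (_ * _); rewrite exchange_big; apply: eq_bigr => q _ /=.
  rewrite (Ms _ _ (q + p)) ?in_shiftfs ?(addrC q) ?addrK//; apply: eq_bigr => a _.
  rewrite shiftfsU1 (addrC q); congr M; apply/funext => r; rewrite /upd /trans.
  by rewrite -subr_eq (addrC r).
- rewrite /avg; under eq_bigr do rewrite shiftfs0 M1.
  by rewrite big_const_seq count_predT iter_addr_0 mulVf// vol_neq0.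
Qed.

Lemma expect_avg M n S F : cylmeas M ->
  expect (avg M n) S F =
  (vol n)^-1 * \sum_(p <- B n) expect M (shiftfs p S) (F \o trans p).
Proof.
move=> cM; rewrite /expect.
transitivity ((vol n)^-1 * sumS S (fun x => \sum_(p <- B n) (M (shiftfs p S) (trans (- p) x) * F x))).
  by rewrite -sumS_scale; apply: eq_sumS => x _; rewrite /avg -mulr_suml mulrA.
rewrite sumS_sum; congr (_ * _); apply: eq_bigr => p _.
by rewrite -[LHS](sumS_shift p); apply: eq_sumS => x _; rewrite /= transK.
Qed.

Lemma ent_shift_avg M n S : cylmeas M ->
  \sum_(p <- B n) ent M (shiftfs p S) <= vol n * ent (avg M n) S.
Proof.
move=> [M0 _ _ _].
have -> : \sum_(p <- B n) ent M (shiftfs p S) =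
    \sum_(p <- B n) sumS S (fun x => eta (M (shiftfs p S) (trans (- p) x))).
  apply: eq_bigr => p _; rewrite -[RHS](sumS_shift p).
  by apply: eq_sumS => x _; rewrite /= transK.
rewrite -sumS_sum /ent -sumS_scale; apply: ler_sumS => x _.
by apply: eta_concave => //; exact: vol_gt0.
Qed.

(** Centres range over [B (n + k)], not [B n], so that sites near the boundary are covered as often
    as the others, as [shearer] demands. *)
Lemma count_cover k n q : q \in B n ->
  count (fun p => q \in shiftfs p (B k)) (B (n + k)) = #|` B k|.
Proof.
move=> qn; rewrite -size_filter.
have -> : #|` B k| = #|` [fset (q - p)%R | p in B k]%fset|.
  by rewrite card_imfset// => a b /addrI /oppr_inj.
apply: perm_size; apply: uniq_perm; rewrite ?filter_uniq ?fset_uniq// => p.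
rewrite mem_filter in_shiftfs; apply/andP/imfsetP => /= [[h _]|[r rk ->]].
  by exists (q - p) => //; rewrite subKr.
by rewrite subKr; split => //; exact: box_sub.
Qed.

(** Shearer's inequality for the translates of [B k]. Those centred in [B (n - k)] lie inside [B n]
    and are absorbed by the average, through concavity of [eta]; the others number at most
    [shell k n] and are bounded crudely. *)
Lemma ent_avg_le M n k : cylmeas M -> (k <= n)%N ->
  vol k * ent M (B n) <=
  vol n * ent (avg M n) (B k) + (#|A| ^ #|` B k|)%:R * shell k n.
Proof.
move=> cM kn; apply: le_trans (lerD (ent_shift_avg _ _ cM) (lexx _)).
apply: le_trans (shearer cM (C := fun p => shiftfs p (B k)) (s := B (n + k)) (K := #|` B k|) _) _.
  by move=> p pn; rewrite count_cover.
have sub : (B (n - k) `<=` B (n + k))%fset by rewrite box_le//; lia.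
rewrite (big_fsetID _ (mem (B (n - k))))/=.
have -> : [fset x | x in B (n + k) & x \in B (n - k)]%fset = B (n - k).
  by apply/fsetP => p; rewrite !inE/=; apply: andb_idl => /(fsubsetP sub).
have -> : [fset x | x in B (n + k) & x \notin B (n - k)]%fset = (B (n + k) `\` B (n - k))%fset.
  by apply/fsetP => p; rewrite !inE/= andbC.
apply: lerD.
  have sub' := box_le d (leq_subr k n).
  rewrite [leRHS](big_fsetID _ (mem (B (n - k))))/=.
  have -> : [fset x | x in B n & x \in B (n - k)]%fset = B (n - k).
    by apply/fsetP => p; rewrite !inE/=; apply: andb_idl => /(fsubsetP sub').
  rewrite -[leLHS]addr0; apply: lerD; last by apply: sumr_ge0 => p _; exact: ent_ge0.
  rewrite !big_seq; apply: ler_sum => p pn.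
  rewrite (_ : (shiftfs p (B k) `&` B n)%fset = shiftfs p (B k))//.
  by apply/fsetIidPl; have := box_shift k pn; rewrite subnK.
apply: (@le_trans _ _ (\sum_(p <- (B (n + k) `\` B (n - k))%fset) (#|A| ^ #|` B k|)%:R)).
  apply: ler_sum => p _; apply: le_trans (ent_crude cM _) _.
  rewrite ler_nat leq_pexp2l//; first by apply/card_gt0P; exists point.
  by rewrite -(card_shiftfs p (B k)) fsubset_leq_card// fsubsetIl.
rewrite big_const_seq count_predT iter_addr_0 -(mulr_natr _ (size _)) ler_wpM2l ?ler0n//.
by rewrite cardfsDS// natrB ?fsubset_leq_card.
Qed.

Definition ent_rate M n : R := ent M (B n) / vol n.

Lemma ent_rate_le M n k : cylmeas M -> invariant M -> (k <= n)%N ->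
  ent_rate M n <= ent_rate M k + (#|A| ^ #|` B k|)%:R / vol k * (shell k n / vol n).
Proof.
move=> cM iM kn; have := ent_avg_le cM kn; rewrite avg_inv// => h.
have k0 := vol_gt0 R d k; have n0 := vol_gt0 R d n.
rewrite /ent_rate -(ler_pM2l k0) -(ler_pM2r n0) mulrA divfK ?vol_neq0//.
apply: le_trans h _; rewrite le_eqVlt; apply/orP; left; apply/eqP.
move: (vol_neq0 R d k) (vol_neq0 R d n).
move: (shell k n) (ent M (B k)) (_%:R) => sh e c.
by move: (vol k) (vol n) => v w v0 w0; field; rewrite ?v0 ?w0.
Qed.

(** The limit is the infimum over boxes, since a box that nearly attains it controls all larger ones
    up to a vanishing shell term. Hence a lower bound [r] valid for each [k] survives in the
    limit. *)
Lemma ent_rate_cvg M : cylmeas M -> invariant M ->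
  cvgn (ent_rate M) /\ (forall r, (forall k, r <= ent_rate M k) -> r <= limn (ent_rate M)).
Proof.
move=> cM iM; pose i := inf (range (ent_rate M)).
have e0 n : 0 <= ent_rate M n by rewrite divr_ge0 ?ent_ge0 ?ler0n.
have hi : has_inf (range (ent_rate M)).
  split; first by exists (ent_rate M 0%N), 0%N.
  by exists 0 => _ [n _ <-].
have ile n : i <= ent_rate M n by apply: ge_inf; [case: hi | exists n].
have cv : ent_rate M @ \oo --> i.
  apply/cvgrPdist_le => e e_gt0.
  have e2 : 0 < e / 2 by lra.
  have [_ [k _ <-] ki] := inf_adherent e2 hi.
  pose c : R := (#|A| ^ #|` B k|)%:R / vol k.
  have c0 : 0 <= c by rewrite divr_ge0 ?ler0n.
  have : (fun n => c * (shell k n / vol n)) @ \oo --> c * 0.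
    by apply: cvgM; [exact: cvg_cst | exact: shell_cvg].
  rewrite mulr0 => /cvgrPdist_le/(_ _ e2) sh.
  near=> n; rewrite distrC ger0_norm ?subr_ge0//.
  have kn : (k <= n)%N by near: n; exact: nbhs_infty_ge.
  have := ent_rate_le cM iM kn; rewrite -/c => h.
  have : `|0 - c * (shell k n / vol n)| <= e / 2 by near: n.
  by rewrite sub0r normrN => /(le_trans (ler_norm _)); rewrite -/i in ki *; lra.
split; first by apply/cvg_ex; exists i.
move=> r rle; rewrite (cvg_lim _ cv)//; apply: lb_le_inf; first by case: hi.
by move=> _ [n _ <-].
Unshelve. all: by end_near. Qed.

End Averages.
(** * Energies and partition functions *)

Section Energy.
Variables (R : realType) (d : nat) (A : pfinType) (Phi : interaction R d A).
Local Notation L := (lattice d).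
Local Notation cfg := (lattice d -> A).
Local Notation B := (box d).
Local Notation e_ := (@Defs.basis d).
Local Notation vol := (vol R d).
Local Notation shell := (shell R d).
Implicit Types (S T Q : {fset L}) (x y : cfg) (p q : L) (F G : cfg -> R).

Definition vtx (a : A) : R := vertex Phi 0 a.
Definition allowed i a b : bool := edge Phi 0 i a b != +oo%E.
(** [fine] sends +oo to 0. Forbidden edges are recorded separately by [allowed], so that energies
    are real numbers. *)
Definition edg i a b : R := fine (edge Phi 0 i a b).

(** Each edge is charged to the endpoint [p] whose partner is [p + e_ i], so that an edge inside [S]
    is counted once. *)
Definition site_en S x p : R :=
  vtx (x p) + \sum_(i < d) (if p + e_ i \in S then edg i (x p) (x (p + e_ i)) else 0).

Definition site_adm S x p : bool :=
  [forall i : 'I_d, (p + e_ i \in S) ==> allowed i (x p) (x (p + e_ i))].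

Definition en S x : R := \sum_(p <- S) site_en S x p.

Definition adm S x : bool := all (site_adm S x) S.

Definition wt S x : R := if adm S x then expR (- en S x) else 0.

Definition part_fun S : R := sumS S (wt S).

(** Real-valued counterpart of [A_fun], with which it agrees on admissible configurations. *)
Definition site_fun x : R :=
  - vtx (x 0) - \sum_(i < d) edg i (x 0) (x (e_ i)).

Lemma edgeE p i a b : edge Phi p i a b = edge Phi 0 i a b.
Proof. by rewrite -{1}(addr0 p) edge_shift. Qed.

Lemma vertexE p a : vertex Phi p a = vtx a.
Proof. by rewrite -{1}(addr0 p) vertex_shift. Qed.

Lemma edg_fin i a b : allowed i a b -> edge Phi 0 i a b = (edg i a b)%:E.
Proof.
move=> ab; rewrite /edg fineK// fin_numE; apply/andP; split=> //.
exact: edge_ninfty.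
Qed.

Lemma admP S x : reflect (forall p i, p \in S -> p + e_ i \in S ->
  allowed i (x p) (x (p + e_ i))) (adm S x).
Proof.
apply: (iffP allP) => [h p i pS piS|h p pS].
  by have /forallP/(_ i)/implyP := h p pS; apply.
by apply/forallP => i; apply/implyP; exact: h.
Qed.

Lemma en_local S : local_on S (en S).
Proof.
move=> x y xy; rewrite /en !big_seq; apply: eq_bigr => p pS.
rewrite /site_en xy//; congr (_ + _); apply: eq_bigr => i _.
by case: ifP => // piS; rewrite xy.
Qed.

Lemma adm_local S x y : agree S x y -> adm S x = adm S y.
Proof.
move=> xy; apply/admP/admP => h p i pS piS; first by rewrite -!xy//; exact: h.
by rewrite !xy//; exact: h.
Qed.

Lemma wt_local S : local_on S (wt S).
Proof. by move=> x y xy; rewrite /wt (adm_local xy) (en_local xy). Qed.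

Lemma adm_sub S T x : (S `<=` T)%fset -> adm T x -> adm S x.
Proof.
move=> /fsubsetP ST /admP h; apply/admP => p i pS piS.
by apply: h; exact: ST.
Qed.

Lemma addr_shiftfs p q S : (p + q \in shiftfs p S) = (q \in S).
Proof. by rewrite in_shiftfs [p + q]addrC addrK. Qed.

Lemma en_shift p S x : en (shiftfs p S) x = en S (trans p x).
Proof.
rewrite /en /shiftfs big_imfset/=; last by move=> a b _ _ /addrI.
apply: eq_bigr => q _; rewrite /site_en /trans; congr (_ + _).
by apply: eq_bigr => i _; rewrite -addrA addr_shiftfs.
Qed.

Lemma adm_shift p S x : adm (shiftfs p S) x = adm S (trans p x).
Proof.
apply/admP/admP => h q i qS qiS.
  by have := h (p + q) i; rewrite -addrA !addr_shiftfs; apply.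
have := h (q - p) i; rewrite addrAC -!in_shiftfs => /(_ qS qiS).
by rewrite /trans [p + (q - p)]addrC [p + (_ - p)]addrC !subrK.
Qed.

(** An edge of [S] with an end where [x] and [y] differ is then contained in [T], so the effect on
    [S] of replacing [x] by [y] can be judged within [T]. *)
Definition inner_diff T S x y := forall q, q \in S -> x q != y q ->
  q \in T /\ forall i, (q + e_ i \in S -> q + e_ i \in T) /\ (q - e_ i \in S -> q - e_ i \in T).

Lemma inner_diff_sym T S x y : inner_diff T S x y -> inner_diff T S y x.
Proof. by move=> h q qS; rewrite eq_sym; exact: h. Qed.

Lemma adm_swap T S x y : inner_diff T S x y -> adm T y -> adm S x -> adm S y.
Proof.
move=> xy /admP hT /admP hS; apply/admP => p i pS piS.
have [e1|n1] := eqVneq (x p) (y p); last first.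
  have [pT /(_ i)[/(_ piS) piT _]] := xy _ pS n1; exact: hT.
have [e2|n2] := eqVneq (x (p + e_ i)) (y (p + e_ i)).
  by rewrite -e1 -e2; exact: hS.
have [piT /(_ i)[_]] := xy _ piS n2; rewrite addrK => /(_ pS) pT; exact: hT.
Qed.

Lemma en_swap T S x y : (T `<=` S)%fset -> inner_diff T S x y ->
  en S x - en S y = en T x - en T y.
Proof.
move=> TS xy; rewrite /en -!sumrB.
rewrite -[LHS](big_fset_incl _ TS); last first.
  move=> p pS pT; have xp : x p = y p.
    by apply/eqP; apply: contraNT pT => /(xy _ pS)[].
  rewrite /site_en xp; apply/eqP; rewrite subr_eq0; apply/eqP; congr (_ + _).
  apply: eq_bigr => i _; case: ifP => // piS; congr edg; apply/eqP.
  by apply: contraNT pT => /(xy _ piS)[_ /(_ i)[_]]; rewrite addrK; apply.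
rewrite !big_seq; apply: eq_bigr => p pT; have pS := fsubsetP TS _ pT.
suff h i : (if p + e_ i \in S then edg i (x p) (x (p + e_ i)) else 0) -
     (if p + e_ i \in S then edg i (y p) (y (p + e_ i)) else 0) =
     (if p + e_ i \in T then edg i (x p) (x (p + e_ i)) else 0) -
     (if p + e_ i \in T then edg i (y p) (y (p + e_ i)) else 0).
  rewrite /site_en [in LHS]opprD [in LHS]addrACA [in RHS]opprD [in RHS]addrACA -!sumrB; congr (_ + _); exact: eq_bigr.
have [piT|piT] := boolP (p + e_ i \in T); first by rewrite (fsubsetP TS _ piT).
case: ifP => // piS; rewrite !subr0.
have -> : x p = y p.
  by apply/eqP; apply: contraNT piT => /(xy _ pS)[_ /(_ i)[h _]]; exact: h.
have -> : x (p + e_ i) = y (p + e_ i).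
  by apply/eqP; apply: contraNT piT => /(xy _ piS)[].
exact: subrr.
Qed.

Lemma ler_sum1 (I : finType) (F : I -> R) i : (forall j, 0 <= F j) -> F i <= \sum_j F j.
Proof. by move=> F0; rewrite (bigD1 i)//= lerDl sumr_ge0. Qed.

Definition en_sup : R := \sum_a `|vtx a| + \sum_(i < d) \sum_a \sum_b `|edg i a b|.

Lemma en_sup_ge0 : 0 <= en_sup.
Proof.
by rewrite addr_ge0// ?sumr_ge0// => i _; rewrite sumr_ge0// => a _; rewrite sumr_ge0.
Qed.

Lemma en_sup_le (P : pred 'I_d) a (b : 'I_d -> A) :
  `|vtx a + \sum_(i < d) (if P i then edg i a (b i) else 0)| <= en_sup.
Proof.
apply: le_trans (ler_normD _ _) _; apply: lerD.
  by apply: (ler_sum1 (F := fun a => `|vtx a|)).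
apply: le_trans (ler_norm_sum _ _ _) _; apply: ler_sum => i _.
have h : `|edg i a (b i)| <= \sum_a \sum_b `|edg i a b|.
  apply: le_trans (ler_sum1 (F := fun a => \sum_b `|edg i a b|) a _).
    by apply: (ler_sum1 (F := fun b => `|edg i a b|)).
  by move=> a'; rewrite sumr_ge0.
by case: ifP => // _; rewrite normr0; apply: le_trans h.
Qed.

Lemma site_en_bound S x p : `|site_en S x p| <= en_sup.
Proof. exact: (en_sup_le (fun i => p + e_ i \in S) _ (fun i => x (p + e_ i))). Qed.

Lemma site_fun_bound x : `|site_fun x| <= en_sup.
Proof.
rewrite /site_fun -opprD normrN.
have := en_sup_le xpredT (x 0) (fun i => x (e_ i)); by [].
Qed.

Lemma count_shift T S q : (\sum_(p <- T) nat_of_bool ((p + q)%R \in S) <= #|` S|)%N.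
Proof.
rewrite -(card_shiftfs (- q) S).
rewrite (eq_bigr (fun p => if p \in shiftfs (- q) S then 1%N else 0%N)); last first.
  by move=> p _; rewrite in_shiftfs opprK; case: ifP.
rewrite -big_mkcond/= big_fset_condE/= -card_fset_sum1.
by apply/fsubset_leq_card/fsubsetP => p; rewrite !inE => /andP[].
Qed.

(** The energy charged to [p] can change only if [p] or some [p + e_ i] is in [S], which happens for
    at most d + 1 times as many sites as [S] has, and then by at most [2 * en_sup]. *)
Lemma en_diff_bound T S x y :
  (forall p, p \in T -> p \notin S -> x p = y p) ->
  `|en T x - en T y| <= 2 * en_sup * d.+1%:R * #|` S|%:R.
Proof.
move=> xy; rewrite /en -sumrB; apply: le_trans (ler_norm_sum _ _ _) _.
apply: (@le_trans _ _ (\sum_(p <- T) 2 * en_sup *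
    ((p + 0 \in S)%:R + \sum_(i < d) (p + e_ i \in S)%:R))).
  rewrite !big_seq; apply: ler_sum => p pT.
  have [h|h] := boolP ((p + 0 \in S) || [exists i : 'I_d, p + e_ i \in S]).
    apply: (@le_trans _ _ (2 * en_sup)).
      apply: le_trans (ler_normB _ _) _.
      by have := site_en_bound T x p; have := site_en_bound T y p; lra.
    rewrite ler_peMr ?mulr_ge0 ?en_sup_ge0//.
    case/orP: h => [->|/existsP[i pi]]; first by rewrite lerDl sumr_ge0.
    apply: (@le_trans _ _ ((p + e_ i \in S)%:R)); first by rewrite pi.
    rewrite -[leLHS]add0r; apply: lerD => //.
    exact: (ler_sum1 (F := fun i : 'I_d => (p + e_ i \in S)%:R)).
  move: h; rewrite negb_or addr0 negb_exists => /andP[pS /forallP piS].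
  have -> : site_en T x p = site_en T y p.
    rewrite /site_en xy//; congr (_ + _); apply: eq_bigr => i _.
    by case: ifP => // piT; rewrite xy.
  by rewrite subrr normr0 !mulr_ge0 ?en_sup_ge0// addr_ge0 ?sumr_ge0.
rewrite -mulr_sumr -(mulrA (2 * en_sup)) ler_wpM2l ?mulr_ge0 ?en_sup_ge0//.
rewrite big_split exchange_big/= -natr_sum -natrM mulSn natrD.
apply: lerD; first by rewrite ler_nat count_shift.
rewrite natrM -[d in d%:R]card_ord mulr_natl -sumr_const; apply: ler_sum => i _.
by rewrite -natr_sum ler_nat count_shift.
Qed.

(** For [p] in [B (n - 1)] every edge charged to [p] stays in [B n], so [site_en] and the translate
    of [site_fun] cancel; only the outer layer contributes, at most [2 * en_sup] per site. *)
Lemma en_site_fun n x : (0 < n)%N ->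
  `|en (B n) x + \sum_(p <- B n) site_fun (trans p x)| <= 2 * en_sup * shell 1 n.
Proof.
move=> n0; rewrite /en -big_split/=.
rewrite -[X in `|X|](big_fset_incl _ (fsubsetDl (B n) (B (n - 1)))); last first.
  move=> p pn; rewrite inE pn andbT negbK => pn1.
  rewrite /site_fun /site_en /trans addr0 -opprD; apply/eqP; rewrite subr_eq0.
  apply/eqP; congr (_ + _); apply: eq_bigr => i _; rewrite ifT//.
  by have := box_add pn1 (basis_box i (ltnSn 0)); rewrite subnK.
apply: le_trans (ler_norm_sum _ _ _) _.
apply: (@le_trans _ _ (\sum_(p <- (B n `\` B (n - 1))%fset) 2 * en_sup)).
  apply: ler_sum => p _; apply: le_trans (ler_normD _ _) _.
  by have := site_en_bound (B n) x p; have := site_fun_bound (trans p x); lra.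
rewrite big_const_seq count_predT iter_addr_0 -(mulr_natr (2 * en_sup)).
by rewrite ler_wpM2l ?mulr_ge0 ?en_sup_ge0// card_box_diff.
Qed.

Lemma energyE S (w : {ffun S -> A}) : energy Phi w =
  ((\sum_(p : S) vtx (w p))%:E + \sum_(p : S) \sum_(i < d)
    (if (val p + e_ i)%R \in S then edge Phi 0%R i (ext w (val p)) (ext w (val p + e_ i)%R) else 0))%E.
Proof.
rewrite /energy -sumEFin; congr (_ + _)%E.
  by apply: eq_bigr => p _; rewrite vertexE.
apply: eq_bigr => p _; under eq_bigr do rewrite big_mkcond/=.
rewrite exchange_big/=; apply: eq_bigr => i _; rewrite -big_mkcond/=.
case: ifPn => piS; last first.
  rewrite big_pred0// => q; apply: contraNF piS => /eqP <-; exact: valP.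
rewrite (big_pred1 [` piS]%fset) => [|q]; last by apply/eqP/eqP => [e|->//]; exact: val_inj.
by rewrite edgeE -!extT.
Qed.

Lemma part_funE S : partition_function Phi S = (part_fun S)%:E.
Proof.
rewrite /partition_function /part_fun /sumS -sumEFin; apply: eq_bigr => w _.
rewrite energyE /wt; case: ifPn => [/admP aw|].
  have -> : en S (ext w) = \sum_(p : S) vtx (w p) + \sum_(p : S) \sum_(i < d)
     (if val p + e_ i \in S then edg i (ext w (val p)) (ext w (val p + e_ i)) else 0).
    rewrite /en big_seq_fsetE -big_split/=; apply: eq_bigr => p _.
    by rewrite /site_en extT.
  rewrite [X in (_ + X)%E](eq_bigr (fun p : S => (\sum_(i < d) (if val p + e_ i \in S
    then edg i (ext w (val p)) (ext w (val p + e_ i)) else 0))%:E)); last first.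
    move=> p _; rewrite -sumEFin; apply: eq_bigr => i _.
    by case: ifP => // piS; rewrite edg_fin//; apply: aw => //; exact: valP.
  by rewrite sumEFin -EFinD -EFinN.
(* One forbidden edge makes the whole energy +oo, since no term is -oo, and the weight is then 0. *)
move=> na; have [p [i [pS piS npi]]] : exists p i, [/\ p \in S, p + e_ i \in S &
    edge Phi 0 i (ext w p) (ext w (p + e_ i)) = +oo%E].
  apply: contrapT => h; move/negP: na; apply; apply/admP => p i pS piS.
  by apply/negP => /eqP e; apply: h; exists p, i.
set s := (\sum_(p : S) \sum_(i < d) _)%E; suff -> : s = +oo%E by rewrite addey.
have ny (q : S) (j : 'I_d) : (if (val q + e_ j)%R \in S then
   edge Phi 0%R j (ext w (val q)) (ext w (val q + e_ j)%R) else 0)%E != -oo%E.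
  by case: ifP => // _; exact: edge_ninfty.
apply/esum_eqyP => [q _|].
  by rewrite esum_eqNy; apply/existsPn => j; rewrite ny.
exists [` pS]%fset => //; split=> //; apply/esum_eqyP => [j _|]; first exact: ny.
by exists i; split=> //; rewrite ifT.
Qed.

End Energy.
(** * From cylinder measures to probabilities *)

Section CylinderSets.
Variables (d : nat) (A : pfinType).
Local Notation L := (lattice d).
Local Notation cfg := (lattice d -> A).
Local Notation B := (box d).
Implicit Types (S T : {fset L}) (x y : cfg) (E F : set (conf d A)).

(** Events determined by finitely many coordinates. Boxes suffice, every finite set being contained
    in one, and one implication suffices by symmetry of [agree]. *)
Definition cylset : set (set (conf d A)) :=
  [set E | exists n, forall x y, agree (B n) x y -> E x -> E y].

Lemma fset_sub_box S : exists n, (S `<=` B n)%fset.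
Proof.
elim/fset1U_rect: S => [|p S pS [n Sn]]; first by exists 0%N; rewrite fsub0set.
exists (maxn n (norm1 p)); apply/fsubsetP => q; rewrite !inE => /predU1P[->|/(fsubsetP Sn)].
  apply/in_boxP => i; apply: leq_trans (leq_maxr _ _).
  by rewrite /norm1 (bigD1 i)//= leq_addr.
exact: (fsubsetP (box_le d (leq_maxl _ _))).
Qed.

Lemma cylset0 : cylset set0. Proof. by exists 0%N. Qed.

Lemma cylsetC E : cylset E -> cylset (~` E).
Proof.
move=> [n h]; exists n => x y xy Ex Ey; apply: Ex.
by apply: h Ey; exact: agree_sym.
Qed.

Lemma cylsetU E F : cylset E -> cylset F -> cylset (E `|` F).
Proof.
move=> [n hE] [m hF]; exists (maxn n m) => x y xy [Ex|Fx]; [left|right].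
  by apply: hE Ex; apply: agree_sub xy; exact/box_le/leq_maxl.
by apply: hF Fx; apply: agree_sub xy; exact/box_le/leq_maxr.
Qed.

Lemma cylset_restr S (P : {ffun S -> A} -> Prop) : cylset [set x | P (restr S x)].
Proof.
have [n Sn] := fset_sub_box S; exists n => x y xy /=.
by rewrite (agree_restr (agree_sub Sn xy)).
Qed.

Lemma cylset_open E : cylset E -> @open (conf_top d A) E.
Proof.
move=> [n h].
have -> : E = \bigcup_(w in [set w : {ffun B n -> A} | E (ext w)]) cyl w.
  apply/seteqP; split=> [x Ex|x [w /= Ew xw]].
    exists (restr (B n) x) => //=; rewrite ext_restr.
    by apply: h Ex; exact/agree_sym/agree_mask.
  apply: h Ew => p pn; have <- : restr (B n) x = w := xw.
  by rewrite ext_restr; exact: agree_mask.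
by apply: bigcup_open => w _; exact: open_cyl.
Qed.

(** The sets containing a box cylinder around [x] form a filter; it converges to [x] in each
    coordinate, hence in the product topology, so it contains [O]. *)
Lemma open_box_sub (O : set (conf_top d A)) (x : conf d A) : open O -> O x ->
  exists n, forall y, agree (B n) x y -> O y.
Proof.
move=> oO Ox.
pose F : set_system (conf_top d A) := [set E | exists n, forall y, agree (B n) x y -> E y].
have FF : Filter F.
  split; first by exists 0%N.
    move=> P Q [n hP] [m hQ]; exists (maxn n m) => y xy; split.
      by apply: hP; apply: agree_sub xy; exact/box_le/leq_maxl.
    by apply: hQ; apply: agree_sub xy; exact/box_le/leq_maxr.
  by move=> P Q PQ [n hP]; exists n => y /hP/PQ.
have Fx : F --> (x : conf_top d A).
  apply/cvg_sup => p; rewrite cvg_image; last first.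
    by apply/seteqP; split=> // a _; exists (fun=> a).
  move=> E /nbhs_singleton Ep; exists [set y | E (y p)]; last first.
    by apply/seteqP; split=> [_ [y /= Ey <-]//|a Ea]; exists (fun=> a).
  have [n pn] := fset_sub_box [fset p]%fset; exists n => y xy /=.
  by rewrite -xy// -fsub1set.
by apply: (Fx O); apply: open_nbhs_nbhs.
Qed.

Lemma measurable_cylset : @measurable _ (conf d A) = <<s cylset >>.
Proof.
apply/seteqP; split.
  apply: smallest_sub; first exact: smallest_sigma_algebra.
  (* The points of [O] whose [n]-th box cylinder stays in [O] form a cylinder event; these countably
     many events exhaust [O]. *)
  move=> O oO; have -> : O = \bigcup_n [set x | forall y, agree (B n) x y -> O y].
    apply/seteqP; split=> [x Ox|x [n _]]; last exact.
    by have [n h] := open_box_sub oO Ox; exists n.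
  apply: (@bigcupT_measurable _ (g_sigma_algebraType cylset)) => n.
  apply: sub_sigma_algebra; exists n => x y xy /= h z yz; apply: h.
  exact: agree_trans yz.
apply: sub_smallest2r; first exact: smallest_sigma_algebra.
exact: cylset_open.
Qed.

(* By compactness, finite additivity on cylinder sets is sigma-additivity. *)
Lemma cylset_trivI_finite (F : nat -> set (conf d A)) :
  (forall n, cylset (F n)) -> trivIset setT F -> cylset (\bigcup_n F n) ->
  exists N, forall n, (N <= n)%N -> F n = set0.
Proof.
move=> cF tF cUF.
have cT : compact [set: conf_top d A].
  have := @tychonoff L (fun _ => discrete_topology A) (fun _ => setT).
  rewrite (_ : [set f | forall i : L, [set: discrete_topology A] (f i)] = setT).
    by apply=> i; exact/finite_compact/finite_finset.
  by apply/seteqP.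
apply: contrapT => h.
pose G N := [set x | (\bigcup_n F n) x /\ forall i, (i < N)%N -> ~ F i x].
have Gne N : G N !=set0.
  apply: contrapT => GN; apply: h; exists N => n Nn; apply/seteqP; split=> // x Fx.
  apply: GN; exists x; split; first by exists n.
  move=> i iN Fi; have /trivIsetP/(_ i n I I) := tF.
  have ni : i != n by rewrite ltn_eqF// (leq_trans iN).
  by move=> /(_ ni)/seteqP[/(_ x) k _]; exact: k.
have cG N : cylset (G N).
  elim: N => [|N IH].
    rewrite (_ : G 0%N = \bigcup_n F n)//.
    by apply/seteqP; split=> [x []//|x Fx]; split.
  rewrite (_ : G N.+1 = ~` (~` G N `|` F N)); first exact/cylsetC/cylsetU/cF/cylsetC.
  rewrite setCU setCK; apply/seteqP; split=> [x [Fx k]|x [[Fx k] FN]].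
    by split; [split=> // i iN; apply: k; rewrite ltnS ltnW | exact: k].
  by split=> // i; rewrite ltnS leq_eqVlt => /predU1P[->//|]; exact: k.
pose Fl : set_system (conf_top d A) := [set E | exists N, G N `<=` E].
have Fp : ProperFilter Fl.
  split; first by move=> [N G0]; have [x /G0] := Gne N.
  split; first by exists 0%N.
    move=> P Q [n hP] [m hQ]; exists (maxn n m) => x [Fx k]; split.
      by apply: hP; split=> // i im; apply: k; rewrite (leq_trans im) ?leq_maxl.
    by apply: hQ; split=> // i im; apply: k; rewrite (leq_trans im) ?leq_maxr.
  by move=> P Q PQ [n hP]; exists n; exact: subset_trans PQ.
have [x [_ clx]] := cT Fl Fp (filterT : Fl setT).
have Gx N : G N x.
  apply: contrapT => nG.
  have : nbhs (x : conf_top d A) (~` G N).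
    by apply: open_nbhs_nbhs; split=> //; apply/cylset_open/cylsetC.
  by move=> /(clx _ _ (ex_intro _ N (@subset_refl _ (G N))))[y [Gy]].
have [[n _ Fnx] _] := Gx 0%N; have [_ /(_ n (ltnSn n))] := Gx n.+1.
exact.
Qed.

End CylinderSets.
Arguments cylset d A : clear implicits.

(** A copy of [conf d A] on which the measurable sets are only the cylinder events, an algebra; the
    original already carries its Borel sigma-algebra. *)
Definition cyltype (d : nat) (A : pfinType) : Type := conf d A.
HB.instance Definition _ d A := Pointed.on (cyltype d A).
HB.instance Definition _ d A := @isAlgebraOfSets.Build default_measure_display (cyltype d A)
  (cylset d A) (@cylset0 d A) (@cylsetU d A) (@cylsetC d A).

(** * Extension of finitely additive laws to Borel probabilities *)

Section Extension.
Variables (R : realType) (d : nat) (A : pfinType).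
Variables (l : set (conf d A) -> R) (l0 : forall E, 0 <= l E).
Variables (lT : l setT = 1)
  (lU : forall E F, E `&` F = set0 -> l (E `|` F) = l E + l F).

Definition lE (E : set (cyltype d A)) : \bar R := (l E)%:E.

Let l_set0 : l set0 = 0.
Proof. by have := lU (setI0 set0); rewrite setU0; lra. Qed.

Let lE0 : lE set0 = 0%E. Proof. by rewrite /lE l_set0. Qed.

Let lE_ge0 E : (0 <= lE E)%E. Proof. by rewrite lee_fin. Qed.

Let lE_sigma : semi_sigma_additive lE.
Proof.
move=> F mF tF mU; have [N FN] := cylset_trivI_finite mF tF mU.
have lbig n : (\sum_(0 <= i < n) lE (F i))%E = lE (\big[setU/set0]_(0 <= i < n) F i).
  elim: n => [|n IH]; first by rewrite !big_geq.
  rewrite !big_nat_recr//= IH -EFinD -lU//.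
  apply/seteqP; split=> // x [] /=; rewrite big_mkord.
  rewrite -bigcup_mkord => -[i /= iltn Fi] Fn.
  have /trivIsetP/(_ i n I I) := tF.
  by rewrite ltn_eqF// => /(_ isT)/seteqP[/(_ x) k _]; exact: k.
have UE n : (N <= n)%N -> \big[setU/set0]_(0 <= i < n) F i = \bigcup_n F n.
  move=> Nn; rewrite big_mkord -bigcup_mkord; apply/seteqP; split=> [x [i _ Fi]|x [i _ Fi]].
    by exists i.
  exists i => //=; rewrite ltnNge; apply/negP => /(leq_trans Nn)/FN F0.
  by rewrite F0 in Fi.
apply: cvg_near_cst; exists N => // n /= Nn; by rewrite lbig UE.
Qed.

HB.instance Definition _ := isMeasure.Build _ _ _ lE lE0 lE_ge0 lE_sigma.

Definition lP (E : set (conf d A)) : \bar R :=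
  (measure_extension lE : {measure set _ -> \bar R}) E.

Let measurable_conf (E : set (conf d A)) : measurable E ->
  measurable (E : set (g_sigma_algebraType (@measurable _ (cyltype d A)))).
Proof. by rewrite measurable_cylset. Qed.

Let lP0 : lP set0 = 0%E. Proof. exact: measure0. Qed.

Let lP_ge0 E : (0 <= lP E)%E. Proof. exact: measure_ge0. Qed.

Let lP_sigma : semi_sigma_additive lP.
Proof.
move=> F mF tF mU; apply: measure_semi_sigma_additive => //.
  by move=> i; exact: measurable_conf.
exact: measurable_conf.
Qed.

HB.instance Definition _ := isMeasure.Build _ _ _ lP lP0 lP_ge0 lP_sigma.

Lemma lPE E : cylset d A E -> lP E = (l E)%:E.
Proof. by move=> cE; rewrite /lP /= /measure_extension measurable_mu_extE. Qed.

Let lPT : lP setT = 1%E.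
Proof. by rewrite lPE ?lT//; exists 0%N. Qed.

HB.instance Definition _ := Measure_isProbability.Build _ _ _ lP lPT.

(** An ultrafilter limit of laws is finitely additive on all events but need not be sigma-additive.
    Only its values on cylinder events are kept; there sigma-additivity is automatic. *)
Lemma cylinder_extension : exists P : probability (conf d A) R,
  forall E, cylset d A E -> P E = (l E)%:E.
Proof. by exists lP; exact: lPE. Qed.

End Extension.

(** * Marginals, supports and integrals of local functions *)

Section Marginals.
Variables (R : realType) (d : nat) (A : pfinType).
Local Notation L := (lattice d).
Local Notation cfg := (lattice d -> A).
Local Notation B := (box d).
Implicit Types (S T : {fset L}) (x y : cfg) (p : L) (F : cfg -> R).
Implicit Types mu nu : probability (conf d A) R.

Definition pr mu S x : R := fine (mu (cyl (restr S (x : conf d A)))).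

Lemma prE mu S x : mu (cyl (restr S x)) = (pr mu S x)%:E.
Proof. by rewrite /pr fineK// fin_num_measure//; exact: measurable_cyl. Qed.

Lemma cylE S x (y : conf d A) : cyl (restr S x) y = agree S x y.
Proof.
apply/propext; split; last by move/agree_restr/esym.
by move=> h; apply/agreeP/eqP; exact: esym.
Qed.

Lemma cylmeas_pr mu : cylmeas (pr mu).
Proof.
split=> [S x|S x y /agree_restr xy|S x p pS|x].
- by rewrite fine_ge0.
- by rewrite /pr xy.
- apply: EFin_inj; rewrite -prE -sumEFin.
  under eq_bigr do rewrite -prE.
  have -> : cyl (restr S x) = \bigcup_(a in [set: A]) cyl (restr (p |` S)%fset (upd x p a)).
    apply/seteqP; split=> y.
      rewrite cylE => xy; exists (y p) => //; rewrite cylE => q; rewrite !inE /upd.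
      by case: eqP => [->//|_] /= /xy.
    move=> [a _]; rewrite !cylE => h q qS; rewrite -h ?inE ?qS ?orbT// /upd ifN//.
    by apply: contraNneq pS => <-.
  rewrite measure_fin_bigcup//=.
  + rewrite [RHS](fsbig_seq _ _ (index_enum_uniq A)).
    have -> : [set` index_enum A] = [set: A] by apply/seteqP; split=> // a _; exact: mem_index_enum.
    by [].
  + apply/trivIsetP => a b _ _ ab; apply/seteqP; split=> // y [].
    rewrite !cylE => /(_ p) + /(_ p); rewrite !inE eqxx /upd eqxx => /(_ isT) ay /(_ isT) yb.
    by rewrite ay yb eqxx in ab.
  + by move=> a _; exact: measurable_cyl.
- apply: EFin_inj; rewrite -prE (_ : cyl _ = setT) ?probability_setT//.
  by apply/seteqP; split=> // y _; rewrite cylE.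
Qed.

Lemma invariant_pr mu : shift_invariant mu -> invariant (pr mu).
Proof.
move=> h p S x; rewrite /pr -(h p (cyl (restr S (trans p x)))); last exact: measurable_cyl.
congr (fine (mu _)); apply/seteqP; split=> y; rewrite /= cylE.
  by move=> /agree_trans_cfg xy; rewrite -[cyl _ _]/(cyl _ (trans p y)) cylE.
by rewrite cylE => h'; apply/agree_trans_cfg.
Qed.

Lemma suppP mu x : supp mu x <-> forall S, 0 < pr mu S x.
Proof.
by split=> h S; have := h S; rewrite prE lte_fin.
Qed.

Let null_box mu n := [set x : conf d A | pr mu (B n) x = 0].

Lemma setC_supp mu : ~` supp mu = \bigcup_n null_box mu n.
Proof.
apply/seteqP; split=> [x /= /suppP h|x [n _ x0] /suppP /(_ (B n))]; last by rewrite x0 ltxx.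
apply: contrapT => k; apply: h => S; have [n Sn] := fset_sub_box S.
apply: (M_pos_sub (cylmeas_pr mu) Sn); rewrite lt_neqAle M_ge0 ?andbT//; last exact: cylmeas_pr.
by apply/eqP => x0; apply: k; exists n.
Qed.

Lemma measurable_null_box mu n : measurable (null_box mu n).
Proof.
rewrite measurable_cylset; apply: sub_sigma_algebra.
have := @cylset_restr d A (B n) (fun w => pr mu (B n) (ext w) = 0).
congr (cylset _ _ _); apply/seteqP; split=> x /=; rewrite ext_restr.
  by rewrite (M_local (cylmeas_pr mu) (@agree_mask _ _ (B n) x)).
by rewrite (M_local (cylmeas_pr mu) (@agree_mask _ _ (B n) x)).
Qed.

Lemma null_box0 mu n : mu (null_box mu n) = 0%E.
Proof.
have -> : null_box mu n = \bigcup_(w in [set w : {ffun B n -> A} | pr mu (B n) (ext w) = 0]) cyl w.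
  apply/seteqP; split=> [x x0|x [w /= w0 xw]].
    exists (restr (B n) x) => //=; rewrite ext_restr.
    by rewrite (M_local (cylmeas_pr mu) (@agree_mask _ _ (B n) x)).
  rewrite /null_box /= -w0; apply: (M_local (cylmeas_pr mu)) => p pn.
  have <- : restr (B n) x = w := xw.
  by rewrite ext_restr agree_mask.
rewrite measure_fin_bigcup//=.
- rewrite fsbig1// => w /= w0; by rewrite -[w]restr_ext prE w0.
- apply: trivIset_preimage1.
- by move=> w _; exact: measurable_cyl.
Qed.

Lemma measurable_supp mu : measurable (supp mu).
Proof.
rewrite -[supp mu]setCK setC_supp; apply: measurableC; apply: bigcupT_measurable => n.
exact: measurable_null_box.
Qed.

Lemma setC_supp0 mu : mu (~` supp mu) = 0%E.
Proof.
apply/eqP; rewrite -measure_le0 setC_supp.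
apply: le_trans (measure_sigma_subadditive _ _ _ (@subset_refl _ _)) _.
- exact: measurable_null_box.
- by apply: bigcupT_measurable => n; exact: measurable_null_box.
by rewrite eseries0// => n _ _; exact: null_box0.
Qed.

(** The support is conull, so it meets every event of positive measure. This turns positive words
    into points of the support, at which all marginals are positive. *)
Lemma pr_gt0_supp mu S x : 0 < pr mu S x -> exists2 z, supp mu z & agree S x z.
Proof.
move=> Sx; apply: contrapT => h.
have : cyl (restr S x) `<=` ~` supp mu.
  by move=> z; rewrite cylE => xz zs; apply: h; exists z.
move=> /le_measure; rewrite !inE => /(_ R mu (measurable_cyl _)).
move=> /(_ (measurableC (measurable_supp mu))).
move=> k; suff : (mu (cyl (restr S x)) <= 0)%E by rewrite prE lee_fin leNgt Sx.
by apply: le_trans k _; rewrite le_eqVlt; apply/orP; left; exact/eqP/setC_supp0.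
Qed.

Lemma supp_pr mu nu S x : supp nu `<=` supp mu -> 0 < pr nu S x -> 0 < pr mu S x.
Proof.
move=> h /pr_gt0_supp[z /h /suppP zs xz].
by rewrite (M_local (cylmeas_pr mu) xz).
Qed.

Lemma measurable_shift p (E : set (conf d A)) : measurable E ->
  measurable (@Defs.shift d A p @^-1` E).
Proof.
have mf : measurable_fun setT (@Defs.shift d A p).
  apply: (measurability (cylset d A)); first exact: measurable_cylset.
  move=> _ [F [n cF] <-]; rewrite setTI measurable_cylset; apply: sub_sigma_algebra.
  have [m sm] := fset_sub_box (shiftfs p (B n)); exists m => x y /(agree_sub sm) /agree_trans_cfg.
  exact: cF.
by move=> mE; rewrite -[X in measurable X]setTI; exact: mf.
Qed.

End Marginals.

Section ShiftMeasure.
Variables (R : realType) (d : nat) (A : pfinType).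
Variables (P : probability (conf d A) R) (p : lattice d).

Definition shiftP (E : set (conf d A)) : \bar R := P (@Defs.shift d A p @^-1` E).

Let shiftP0 : shiftP set0 = 0%E. Proof. by rewrite /shiftP preimage_set0 measure0. Qed.

Let shiftP_ge0 E : (0 <= shiftP E)%E. Proof. exact: measure_ge0. Qed.

Let shiftP_sigma : semi_sigma_additive shiftP.
Proof.
move=> F mF tF mU; rewrite /shiftP preimage_bigcup; apply: measure_semi_sigma_additive.
- by move=> n; exact: measurable_shift.
- apply/trivIsetP => i j _ _ ij; rewrite -preimage_setI.
  by move/trivIsetP : tF => /(_ _ _ I I ij) ->; rewrite preimage_set0.
- by rewrite -preimage_bigcup; exact: measurable_shift.
Qed.

HB.instance Definition _ := isMeasure.Build _ _ _ shiftP shiftP0 shiftP_ge0 shiftP_sigma.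

(** Cylinder events are stable under intersection and generate the Borel sets, so two probabilities
    that agree on them are equal. *)
Lemma shift_cylset : (forall E, cylset d A E -> shiftP E = P E) ->
  forall E, measurable E -> shiftP E = P E.
Proof.
move=> h E mE.
apply: (@measure_unique _ R (conf d A) (cylset d A) (fun=> setT)) => //.
- exact: measurable_cylset.
- by move=> X Y cX cY; rewrite -[X]setCK -[Y]setCK -setCU; apply/cylsetC/cylsetU; exact: cylsetC.
- by move=> _; exists 0%N.
- by rewrite bigcup_const//; exists 0%N.
- move=> _ /=; rewrite /shiftP preimage_setT.
  by apply: le_lt_trans (probability_le1 _ _) _ => //; exact: ltry.
Qed.

End ShiftMeasure.

Section ConullIntegral.
Import HBNNSimple.
Local Open Scope ereal_scope.
Context (dT : measure_display) (T : measurableType dT) (R : realType).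
Variable mu : {measure set T -> \bar R}.

(* [f] need not be measurable, so [ae_eq_integral] does not apply. *)
Lemma integral_conull (X : set T) (f : T -> \bar R) :
  measurable X -> mu (~` X) = 0 -> \int[mu]_x f x = \int[mu]_(x in X) f x.
Proof.
move=> mX X0.
(* The integral of a nonnegative function is a supremum over simple functions below it, and these
   can be cut off outside [X] at no cost. *)
have key (g : T -> \bar R) : (forall x, 0 <= g x) ->
    [set sintegral mu h | h in [set h : {nnsfun T >-> R} | forall x, (h x)%:E <= g x]] =
    [set sintegral mu h | h in [set h : {nnsfun T >-> R} | forall x, (h x)%:E <= (g \_ X) x]].
  move=> g0; apply/seteqP; split=> _ [h /= hg <-].
    exists (proj_nnsfun h mX) => [x|].
      by rewrite -mrestrict /patch; case: ifP.
    rewrite -!integralT_nnsfun; apply: ae_eq_integral => //.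
    - exact/measurable_realfun.measurable_EFinP.
    - exact/measurable_realfun.measurable_EFinP.
    - exists (~` X); split=> //; first exact: measurableC.
      by move=> x k Xx; apply: k => _; rewrite -mrestrict /patch mem_set.
  exists h => //= x; apply: le_trans (hg x) _; rewrite /patch; by case: ifP.
rewrite /integral patch_setT funepos_restrict funeneg_restrict.
congr (ereal_sup _ - ereal_sup _); exact: key.
Qed.

End ConullIntegral.

Section LocalIntegrals.
Variables (R : realType) (d : nat) (A : pfinType) (mu : probability (conf d A) R).
Local Notation cfg := (lattice d -> A).
Local Notation B := (box d).
Implicit Types (S : {fset lattice d}) (F : cfg -> R).

Lemma measurable_local S F : local_on S F -> measurable_fun setT (F : conf d A -> R).
Proof.
move=> lF _ Y mY; rewrite setTI measurable_cylset; apply: sub_sigma_algebra.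
have := cylset_restr (fun w : {ffun S -> A} => Y (F (ext w))).
congr (cylset _ _ _); apply/seteqP; split=> x /=; rewrite ext_restr.
  by rewrite (lF _ _ (@agree_mask _ _ S x)).
by rewrite (lF _ _ (@agree_mask _ _ S x)).
Qed.

Lemma bounded_local S F : local_on S F -> [bounded F x | x in [set: conf d A]].
Proof.
move=> lF; exists (\sum_(w : {ffun S -> A}) `|F (ext w)|); split; first exact: num_real.
move=> c hc x _; apply: le_trans (ltW hc).
rewrite -(lF _ _ (@agree_mask _ _ S x)) -ext_restr.
by rewrite (bigD1 (restr S x))//= lerDl sumr_ge0.
Qed.

Lemma integrable_local S F : local_on S F -> mu.-integrable setT (EFin \o (F : conf d A -> R)).
Proof.
move=> lF; apply: measurable_bounded_integrable => //.
- by apply: le_lt_trans (probability_le1 _ _) _ => //; exact: ltry.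
- exact: measurable_local lF.
- exact: bounded_local lF.
Qed.

Lemma integral_local S F : local_on S F ->
  (\int[mu]_x (F x)%:E = (expect (pr mu) S F)%:E)%E.
Proof.
move=> lF.
have FE : (fun x : conf d A => (F x)%:E) =
    (fun x => \sum_(w <- index_enum {ffun S -> A}) (F (ext w))%:E * (\1_(cyl w) x)%:E)%E.
  apply/funext => x; rewrite (bigD1 (restr S x))//= big1 => [|w wx].
    rewrite indicE mem_set// mule1 adde0 ext_restr.
    by rewrite (lF _ _ (@agree_mask _ _ S x)).
  rewrite indicE memNset ?mule0// => xw; move/eqP: wx; apply.
  by rewrite -[LHS]xw.
rewrite FE integral_sum//; last first.
  move=> w; apply: integrableZl => //; apply: integrable_indic => //.
  exact: measurable_cyl.
rewrite /expect /sumS -sumEFin; apply: eq_bigr => w _.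
rewrite integralZl//; last by apply: integrable_indic => //; exact: measurable_cyl.
rewrite integral_indic//; last exact: measurable_cyl.
by rewrite setIT muleC EFinM; congr (_ * _)%E; rewrite -prE restr_ext.
Qed.

End LocalIntegrals.
(** * Gibbs inequality and the variational principle *)

Section FreeEnergy.
Variables (R : realType) (d : nat) (A : pfinType) (Phi : interaction R d A).
Local Notation L := (lattice d).
Local Notation cfg := (lattice d -> A).
Local Notation B := (box d).
Local Notation vol := (vol R d).
Local Notation shell := (shell R d).
Local Notation e_ := (@Defs.basis d).
Local Notation en := (@en R d A Phi).
Local Notation wt := (@wt R d A Phi).
Local Notation adm := (@adm R d A Phi).
Local Notation site_fun := (@site_fun R d A Phi).
Local Notation part_fun := (@part_fun R d A Phi).
Implicit Types (S T : {fset L}) (x y : cfg) (p q : L) (F : cfg -> R).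
Implicit Types (M : {fset L} -> cfg -> R).
Implicit Types mu nu : probability (conf d A) R.

Definition adm_supported M := forall S x, 0 < M S x -> adm S x.

Lemma wt_ge0 S x : 0 <= wt S x.
Proof. by rewrite /wt; case: ifP => // _; exact: expR_ge0. Qed.

Lemma wt_adm S x : adm S x -> wt S x = expR (- en S x).
Proof. by rewrite /wt => ->. Qed.

Lemma exists_M_gt0 M S : cylmeas M -> exists2 x, mask S x = x & 0 < M S x.
Proof.
move=> cM; apply: contrapT => h.
have : sumS S (fun x => M S x * 1) = 0.
  rewrite /sumS big1// => w _; rewrite mulr1; apply/eqP; apply: contrapT => k; apply: h.
  exists (ext w); first exact: mask_ext.
  by rewrite lt_neqAle M_ge0// andbT eq_sym; apply/negP => /k.
by have := expect_cst cM S 1; rewrite /expect => -> /eqP; rewrite oner_eq0.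
Qed.

Lemma sum_M M S : cylmeas M -> sumS S (M S) = 1.
Proof.
move=> cM; rewrite -(expect_cst cM S 1); apply: eq_sumS => x _; by rewrite mulr1.
Qed.

(** The tangent bound for [eta] at the normalised weights [wt S x * expR (F x) / Z]. With [F = 0] it
    bounds the free energy of [M] by the log partition function; a tilt [F] that leaves the weighted
    sum unchanged has expectation at most the defect in that bound. *)
Lemma gibbs_inequality M S F : cylmeas M -> adm_supported M ->
  ent M S - expect M S (en S) + expect M S F <=
  ln (sumS S (fun x => wt S x * expR (F x))).
Proof.
move=> cM aM; set Z := sumS _ _.
have W0 x : 0 <= wt S x * expR (F x) by rewrite mulr_ge0 ?wt_ge0 ?expR_ge0.
have Zgt0 : 0 < Z.
  have [x mx Mx] := exists_M_gt0 S cM.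
  rewrite /Z /sumS (bigD1 (restr S x))//= ext_restr mx ltr_wpDr ?sumr_ge0//.
  by rewrite mulr_gt0 ?expR_gt0// wt_adm ?expR_gt0// aM.
have key x : eta (M S x) <= M S x * en S x - M S x * F x + M S x * ln Z +
    wt S x * expR (F x) / Z - M S x.
  have := M_ge0 cM S x; rewrite le_eqVlt => /predU1P[<-|Mx].
    by rewrite /eta !mul0r !oppr0 !add0r addr0 divr_ge0// ltW.
  have ax := aM _ _ Mx.
  have Wx : 0 < wt S x * expR (F x) by rewrite wt_adm// mulr_gt0 ?expR_gt0.
  have Wq : 0 < wt S x * expR (F x) / Z by rewrite divr_gt0.
  have := @eta_tangent R (wt S x * expR (F x) / Z) (M S x) (ltW Mx).
  move=> /(_ _ (ltW Wq))/le_trans; apply; first by move=> /eqP; rewrite gt_eqF.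
  rewrite {1}wt_adm// ln_div ?posrE ?mulr_gt0 ?expR_gt0// -expRD expRK.
  rewrite le_eqVlt; apply/orP; left; apply/eqP; ring.
have := ler_sumS (S := S) (fun x _ => key x).
rewrite !(sumS_sub, sumS_add) -/(expect M S (en S)) -/(expect M S F).
rewrite -/(expect M S (fun=> ln Z)) expect_cst// sum_M//.
have -> : sumS S (fun x => wt S x * expR (F x) / Z) = 1.
  under eq_sumS => x _ do rewrite mulrC.
  by rewrite sumS_scale mulVf// gt_eqF.
by rewrite /ent; lra.
Qed.

Section Gibbs.
Variable n : nat.
Let Z := part_fun (B n).
Hypothesis Z0 : 0 < Z.

(** Marginals of the free-boundary Gibbs law on [B n], with [point] at all other sites; so [S] need
    not lie in the box. *)
Definition gibbs S x : R := sumS (B n) (fun w => wt (B n) w / Z * (agreeb S w x)%:R).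

Let W0 w : 0 <= wt (B n) w / Z. Proof. by rewrite divr_ge0 ?wt_ge0 ?(ltW Z0). Qed.

Let W1 : sumS (B n) (fun w => wt (B n) w / Z) = 1.
Proof.
under eq_sumS => x _ do rewrite mulrC.
by rewrite sumS_scale mulVf// gt_eqF.
Qed.

Lemma cylmeas_gibbs : cylmeas gibbs.
Proof.
split=> [S x|S x y xy|S x p pS|x].
- by apply: sumS_ge0 => w _; rewrite mulr_ge0.
- apply: eq_sumS => w _; congr (_ * (nat_of_bool _)%:R).
  by apply/agreeP/agreeP => h; apply: (agree_trans h) => //; exact: agree_sym.
- rewrite /gibbs -sumS_sum; apply: eq_sumS => w _; rewrite -mulr_sumr; congr (_ * _).
  have agreeU1 a : agreeb (p |` S)%fset w (upd x p a) = (a == w p) && agreeb S w x.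
    apply/agreeP/andP => [h|[/eqP -> /agreeP h] q].
      split; first by have := h p; rewrite !inE eqxx /upd eqxx => ->.
      apply/agreeP => q qS; rewrite h ?inE ?qS ?orbT// /upd ifN//.
      by apply: contraNneq pS => <-.
    by rewrite !inE /upd; case: eqP => [->//|_] /= /h.
  rewrite (bigD1 (w p))//= agreeU1 eqxx big1 ?addr0// => a /negbTE ap.
  by rewrite agreeU1 ap.
- rewrite -W1; apply: eq_sumS => w _.
  suff -> : agreeb fset0 w x by rewrite mulr1.
  by apply/agreeP => q; rewrite inE.
Qed.

Lemma gibbs_box x : gibbs (B n) x = wt (B n) x / Z.
Proof.
rewrite -(@sumS_pick R d A (B n) x (fun w => wt (B n) w / Z)); last first.
  by move=> y z /wt_local ->.
by apply: eq_sumS => w _; case: ifP; rewrite (mulr1, mulr0).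
Qed.

Lemma gibbs_adm S x : (S `<=` B n)%fset -> ~~ adm S x -> gibbs S x = 0.
Proof.
move=> Sn Sx; rewrite /gibbs /sumS big1// => w _; case: agreeP => [h|]; last by rewrite mulr0.
rewrite /wt ifN ?mul0r//; apply: contra Sx => /(adm_sub Sn).
by rewrite (adm_local Phi h).
Qed.

Lemma gibbs_free_energy : ent gibbs (B n) - expect gibbs (B n) (en (B n)) = ln Z.
Proof.
rewrite /ent /expect -sumS_sub -[RHS]mulr1 -W1 -sumS_scale; apply: eq_sumS => x _.
rewrite /eta !gibbs_box /wt; case: ifP => ax; last by rewrite !mul0r !oppr0 mulr0 addr0.
rewrite ln_div ?posrE ?expR_gt0// expRK; ring.
Qed.

(** The law with marginals [avg gibbs n], written as a function of arbitrary events: finite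
    additivity is wanted for all of them before the limit is taken. *)
Definition avg_law (E : set (conf d A)) : R :=
  (vol n)^-1 * \sum_(p <- B n) sumS (B n) (fun w => wt (B n) w / Z * (`[<E (trans p w)>])%:R).

Lemma avg_lawE S x : avg_law (cyl (restr S x)) = avg gibbs n S x.
Proof.
rewrite /avg_law /avg; congr (_ * _); apply: eq_bigr => p _; apply: eq_sumS => w _.
congr (_ * (nat_of_bool _)%:R); apply/asboolP/agreeP; rewrite cylE.
  move=> h; apply/agree_trans_cfg; rewrite transNK; exact: agree_sym.
by move=> /agree_trans_cfg; rewrite transNK => h; exact: agree_sym.
Qed.

Lemma avg_law_ge0 E : 0 <= avg_law E.
Proof.
rewrite mulr_ge0 ?invr_ge0 ?ler0n// sumr_ge0// => p _; apply: sumS_ge0 => w _.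
by rewrite mulr_ge0.
Qed.

Lemma avg_lawT : avg_law setT = 1.
Proof.
rewrite /avg_law; under eq_bigr => p _.
  under eq_sumS => w _ do rewrite asboolT// mulr1.
  rewrite W1; over.
rewrite big_const_seq count_predT iter_addr_0 mulVf//; exact: vol_neq0.
Qed.

Lemma avg_lawU (E E' : set (conf d A)) :
  E `&` E' = set0 -> avg_law (E `|` E') = avg_law E + avg_law E'.
Proof.
move=> EE; rewrite /avg_law -mulrDr -big_split/=; congr (_ * _); apply: eq_bigr => p _.
rewrite -sumS_add; apply: eq_sumS => w _; rewrite -mulrDr; congr (_ * _).
rewrite asbool_or -natrD; congr (_%:R).
case: asboolP => //= Ew; case: asboolP => //= Fw.
by have : (E `&` E') (trans p w) by []; rewrite EE.
Qed.

Lemma avg_law_le1 E : avg_law E <= 1.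
Proof.
rewrite -avg_lawT -(setUv E) avg_lawU ?setICr// lerDl; exact: avg_law_ge0.
Qed.

(** Shifting the event shifts the averaging window; both windows contain [B (n - m)] and lie in
    [B (n + m)], and each term is between 0 and 1. *)
Lemma avg_law_shift m p E : p \in B m -> (m <= n)%N ->
  `|avg_law (@Defs.shift d A p @^-1` E) - avg_law E| <= shell m n / vol n.
Proof.
move=> pm mn; pose f q := sumS (B n) (fun w => wt (B n) w / Z * (`[<E (trans q w)>])%:R).
have f0 q : 0 <= f q by apply: sumS_ge0 => w _; rewrite mulr_ge0.
have f1 q : f q <= 1.
  rewrite -W1; apply: ler_sumS => w _; rewrite -[leRHS]mulr1 ler_wpM2l//.
  by rewrite lern1; case: asboolP.
have -> : avg_law (@Defs.shift d A p @^-1` E) = (vol n)^-1 * \sum_(q <- shiftfs p (B n)) f q.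
  rewrite /avg_law /shiftfs big_imfset/=; last by move=> a b _ _ /addrI.
  congr (_ * _); apply: eq_bigr => q _; apply: eq_sumS => w _; congr (_ * (nat_of_bool _)%:R).
  by rewrite (addrC p) -transD.
rewrite /avg_law -/(f _) -mulrBr normrM ger0_norm ?invr_ge0 ?ler0n// mulrC.
rewrite ler_wpM2r ?invr_ge0 ?ler0n//.
have bnd (C : {fset L}) : (B (n - m) `<=` C)%fset -> (C `<=` B (n + m))%fset ->
    \sum_(q <- B (n - m)) f q <= \sum_(q <- C) f q <= \sum_(q <- B (n - m)) f q + shell m n.
  have mono (C1 C2 : {fset L}) : (C1 `<=` C2)%fset ->
      \sum_(q <- C2) f q = \sum_(q <- C1) f q + \sum_(q <- (C2 `\` C1)%fset) f q.
    move=> C12; rewrite (big_fsetID _ (mem C1))/=; congr (_ + _); apply: eq_fbigl => q.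
      by rewrite !inE/=; apply: andb_idl => /(fsubsetP C12).
    by rewrite !inE/= andbC.
  move=> sB sC; rewrite (mono _ _ sB) lerDl sumr_ge0//= lerD2l.
  apply: (@le_trans _ _ (\sum_(q <- (C `\` B (n - m))%fset) 1)); first exact: ler_sum.
  rewrite big_const_seq count_predT iter_addr_0 cardfsDS// natrB ?fsubset_leq_card//.
  by rewrite lerB// ler_nat fsubset_leq_card.
have nn : (n - m <= n)%N := leq_subr m n.
have /andP[a1 a2] := bnd (B n) (box_le d nn) (box_le d (leq_addr m n)).
have /andP[b1 b2] : \sum_(q <- B (n - m)) f q <= \sum_(q <- shiftfs p (B n)) f q <=
    \sum_(q <- B (n - m)) f q + shell m n.
  apply: bnd; last by rewrite addnC; exact: box_shift.
  apply/fsubsetP => q qn; rewrite in_shiftfs -(subnK mn).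
  exact: box_sub.
by rewrite ler_norml; apply/andP; split; lra.
Qed.

End Gibbs.

End FreeEnergy.

(** * Limits of averaged Gibbs laws along an ultrafilter *)

Section Construction.
Variables (R : realType) (d : nat) (A : pfinType) (Phi : interaction R d A).
Local Notation L := (lattice d).
Local Notation cfg := (lattice d -> A).
Local Notation B := (box d).
Local Notation vol := (vol R d).
Local Notation shell := (shell R d).
Local Notation e_ := (@Defs.basis d).
Local Notation en := (@en R d A Phi).
Local Notation adm := (@adm R d A Phi).
Local Notation site_fun := (@site_fun R d A Phi).
Local Notation part_fun := (@part_fun R d A Phi).
Local Notation gibbs := (gibbs Phi).
Implicit Types (S T : {fset L}) (x y : cfg) (p q : L) (F : cfg -> R).

Lemma ultra_cvg01 (U : set_system nat) (u : nat -> R) : UltraFilter U ->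
  (forall n, 0 <= u n <= 1) -> cvg (u @ U).
Proof.
move=> UU u01; have : U (u @^-1` `[0, 1]%classic).
  by apply: filterE => n; rewrite /= in_itv/=; exact: u01.
move=> /(@segment_compact R 0 1 (u @ U) _)[l [_ lU]].
apply/cvg_ex; exists l => V Vl.
have [//|UV] := in_ultra_setVsetC (u @^-1` V) UU.
have [x [/= Vx nVx]] := lU (~` V) V UV Vl.
by [].
Qed.

Lemma eta_usc (U : set_system nat) (u : nat -> R) (l e : R) : Filter U ->
  u @ U --> l -> (forall n, 0 <= u n) -> 0 <= l -> 0 < e ->
  \forall n \near U, eta (u n) <= eta l + e.
Proof.
(* The tangent bound is affine in [u n], hence passes to the limit. The tangent at [l] is exact
   there; for [l = 0] it is replaced by the tangent at [e / 2], whose value at 0 is [e / 2]. *)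
move=> FU ul u0 l0 e0; pose s := if l == 0 then e / 2 else l.
have s0 : 0 < s by rewrite /s; case: eqVneq => [_|ln]; [lra | rewrite lt_neqAle eq_sym ln].
have h : - l * ln s + s - l <= eta l + e / 2.
  by rewrite /s /eta; case: eqVneq => [->|_]; lra.
have : (fun n => - u n * ln s + s - u n) @ U --> - l * ln s + s - l.
  apply: cvgB => //; apply: cvgD; last exact: cvg_cst.
  by apply: cvgM; [exact: cvgN | exact: cvg_cst].
have e2 : 0 < e / 2 by lra.
move=> /cvgrPdist_le/(_ _ e2); apply: filterS => n; rewrite ler_norml => /andP[hn _].
apply: le_trans (@eta_tangent R s (u n) (u0 n) _ (ltW s0)) _; last by lra.
by move=> sz; rewrite sz ltxx in s0.
Qed.

Lemma ent_usc (U : set_system nat) (M : nat -> {fset L} -> cfg -> R) M0 S (e : R) :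
  Filter U -> (forall n, cylmeas (M n)) -> (forall x, (fun n => M n S x) @ U --> M0 S x) ->
  (forall x, 0 <= M0 S x) -> 0 < e ->
  \forall n \near U, ent (M n) S <= ent M0 S + e.
Proof.
move=> FU cM MM M0_ge0 e0.
pose N : R := (#|{ffun S -> A}|)%:R.
have N0 : 0 < N by rewrite ltr0n; apply/card_gt0P; exists [ffun=> point].
have : \forall n \near U, forall w : {ffun S -> A},
    eta (M n S (ext w)) <= eta (M0 S (ext w)) + e / N.
  apply: filter_forall => w; apply: eta_usc => //; last by rewrite divr_gt0.
  by move=> n; exact: M_ge0.
apply: filterS => n h; rewrite /ent /sumS.
apply: le_trans (ler_sum _ (fun w _ => h w)) _.
by rewrite big_split/= sumr_const -mulr_natr divfK// gt_eqF.
Qed.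

Lemma cvg_bigsum (U : set_system nat) (I : Type) (s : seq I) (f : I -> nat -> R) (l : I -> R) :
  Filter U -> (forall i, f i @ U --> l i) ->
  (fun n => \sum_(i <- s) f i n) @ U --> \sum_(i <- s) l i.
Proof.
move=> FU fl; elim: s => [|i s IH].
  rewrite big_nil (_ : (fun n => _) = (fun=> 0)); first exact: cvg_cst.
  by apply/funext => n; rewrite big_nil.
rewrite big_cons (_ : (fun n => _) = (fun n => f i n + \sum_(i <- s) f i n)); first exact: cvgD.
by apply/funext => n; rewrite big_cons.
Qed.

Lemma expect_cvg (U : set_system nat) (M : nat -> {fset L} -> cfg -> R) M0 S F :
  Filter U -> (forall S x, (fun n => M n S x) @ U --> M0 S x) ->
  (fun n => expect (M n) S F) @ U --> expect M0 S F.
Proof.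
move=> FU MM; rewrite /expect /sumS; apply: cvg_bigsum => w.
by apply: cvgM; [exact: MM | exact: cvg_cst].
Qed.

Lemma site_fun_local : local_on (B 1) site_fun.
Proof.
move=> x y xy; rewrite /site_fun xy ?box0//; congr (_ - _).
by apply: eq_bigr => i _; rewrite xy// basis_box.
Qed.

(** Up to boundary terms the energy in [B n] is minus the sum of the translates of [site_fun], and
    the expectation of that sum is the volume times an expectation under the average. *)
Lemma expect_gibbs_site n : 0 < part_fun (B n) -> (0 < n)%N ->
  - expect (gibbs n) (B n) (en (B n)) <=
  vol n * expect (avg (gibbs n) n) (B 1) site_fun + 2 * en_sup Phi * shell 1 n.
Proof.
move=> Z0 n0; have cG := cylmeas_gibbs Z0.
rewrite expect_avg// mulrA divff ?vol_neq0// mul1r.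
have -> : \sum_(p <- B n) expect (gibbs n) (shiftfs p (B 1)) (site_fun \o trans p) =
    \sum_(p <- B n) expect (gibbs n) (B (n + 1)) (site_fun \o trans p).
  rewrite !big_seq; apply: eq_bigr => p pn.
  rewrite [RHS](expect_sub cG (box_shift 1 pn))//.
  by move=> x y /agree_trans_cfg; exact: site_fun_local.
rewrite -(expect_sub cG (box_le d (leq_addr 1 n)) (@en_local _ _ _ Phi _)).
rewrite -expect_sum -expect_opp -lerBlDl -expect_opp -expect_add.
rewrite -(expect_cst cG (B (n + 1)) (2 * en_sup Phi * shell 1 n)).
apply: ler_expect => // x _.
have := en_site_fun Phi x n0; rewrite ler_norml => /andP[h _].
by rewrite /=; lra.
Qed.

Section Limit.
Hypothesis Zpos : forall n, 0 < part_fun (B n).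
Variable (r : R).
(** A lower bound along infinitely many [n] is just what a failure of the upper bound for the
    pressure provides. *)
Hypothesis freq : forall N, exists2 n, (N <= n)%N & r <= ln (part_fun (B n)) / vol n.

Let good := [set n | r <= ln (part_fun (B n)) / vol n].

Let ultra : exists U : set_system nat, [/\ UltraFilter U, U good & \oo `<=` U].
Proof.
have PF : ProperFilter (within good \oo).
  split=> [[N _ NP]|]; last exact: within_filter.
  by have [n Nn gn] := freq N; exact: NP Nn gn.
have [U [UU FU]] := ultraFilterLemma PF; exists U; split=> //.
  by apply: FU; exists 0%N.
by move=> P [N _ NP]; apply: FU; exists N => // n Nn _; exact: NP.
Qed.

(* The shift averages of the free-boundary Gibbs laws converge along an ultrafilter;
   Shearer's inequality bounds their entropy on a fixed box from below. *)
Theorem limit_of_gibbs : exists nu : probability (conf d A) R,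
  [/\ shift_invariant nu, supp nu `<=` admissible Phi &
    forall k, r <= ent_rate (pr nu) k + expect (pr nu) (B 1) site_fun].
Proof.
have [U [UU Ugood Uoo]] := ultra.
pose law n := avg_law Phi n.
have lcv E : cvg ((law^~ E) @ U).
  by apply: ultra_cvg01 => n; rewrite avg_law_ge0//= avg_law_le1.
pose l E : R := lim ((law^~ E) @ U).
have lE E : (law^~ E) @ U --> l E by exact: lcv.
have l_ge0 E : 0 <= l E.
  by apply: limr_ge => //; apply: nearW => n; exact: avg_law_ge0.
have lT : l setT = 1.
  apply: cvg_lim => //; rewrite (_ : law^~ setT = fun=> 1); first exact: cvg_cst.
  by apply/funext => n; exact: avg_lawT.
have lU (E E' : set (conf d A)) : E `&` E' = set0 -> l (E `|` E') = l E + l E'.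
  move=> EE; apply: cvg_lim => //.
  rewrite (_ : law^~ (E `|` E') = fun n => law n E + law n E'); first exact: cvgD.
  by apply/funext => n; exact: avg_lawU.
have [nu nuE] := cylinder_extension l_ge0 lT lU.
have cylC S x : cylset d A (cyl (restr S x)).
  exact: (@cylset_restr d A S (fun w => w = restr S x)).
have prl S x : (fun n => avg (gibbs n) n S x) @ U --> pr nu S x.
  have -> : pr nu S x = l (cyl (restr S x)) by apply: EFin_inj; rewrite -prE nuE.
  rewrite (_ : (fun n => _) = law^~ (cyl (restr S x))); first exact: lE.
  by apply/funext => n; rewrite /law avg_lawE.
have shell0 m : (fun n => shell m n / vol n) @ U --> (0 : R).
  by move=> V /(@shell_cvg R d m); exact: Uoo.
have shell0M c m : (fun n => c * (shell m n / vol n)) @ U --> (0 : R).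
  by rewrite -(mulr0 c); apply: cvgM; [exact: cvg_cst | exact: shell0].
exists nu; split.
- have key p E : cylset d A E -> shiftP nu p E = nu E.
    move=> cE; rewrite /shiftP !nuE//; last first.
      have [n h] := cE; have [m sm] := fset_sub_box (shiftfs p (B n)).
      by exists m => x y /(agree_sub sm)/agree_trans_cfg; exact: h.
    congr (_%:E); apply/eqP; rewrite -subr_eq0; apply/eqP.
    have [m pm] := fset_sub_box [fset p]%fset; rewrite fsub1set in pm.
    apply: (@cvg_unique _ (@Rhausdorff R) _ _ _ _ (cvgB (lE (@Defs.shift d A p @^-1` E)) (lE E))).
    apply/cvgr0Pnorm_le => e e0; near=> n.
    apply: le_trans (avg_law_shift (Zpos n) E pm _) _.
      by near: n; apply: Uoo; exact: nbhs_infty_ge.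
    apply: le_trans (ler_norm _) _; near: n.
    by move/cvgr0Pnorm_le : (shell0 m); exact.
  by move=> p E mE; exact: (shift_cylset (key p) mE).
- move=> x /suppP xs p i; apply/negP => /eqP pi.
  pose S := [fset p; (p + e_ i)%R]%fset; have := xs S.
  have nS : ~~ adm S x.
    apply/negP => /admP/(_ p i); rewrite !inE !eqxx ?orbT => /(_ isT isT)/negP; apply.
    by rewrite -(edgeE Phi p) pi.
  have [m Sm] := fset_sub_box S.
  suff -> : pr nu S x = 0 by rewrite ltxx.
  apply: (@cvg_unique _ (@Rhausdorff R) _ _ _ _ (prl S x)).
  apply/cvgr0Pnorm_le => e e0; near=> n.
  have mn : (m <= n)%N by near: n; apply: Uoo; exact: nbhs_infty_ge.
  have cG := cylmeas_gibbs (Zpos n).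
  rewrite ger0_norm; last by apply: M_ge0; exact: cylmeas_avg.
  apply: (@le_trans _ _ (shell m n / vol n)); last first.
    apply: le_trans (ler_norm _) _; near: n.
    by move/cvgr0Pnorm_le : (shell0 m); exact.
  rewrite /avg mulrC ler_wpM2r ?invr_ge0 ?ler0n//.
  (* A translate of [S] by a site of [B (n - m)] lies inside [B n], where the Gibbs law gives no
     mass to an inadmissible word. *)
  rewrite -(big_fset_incl _ (fsubsetDl (B n) (B (n - m)))); last first.
    move=> q qn; rewrite inE qn andbT negbK => qnm.
    apply: gibbs_adm; last by rewrite adm_shift transNK.
    apply/fsubsetP => s; rewrite in_shiftfs => /(fsubsetP Sm) sm.
    by rewrite -(subrK q s) addrC -(subnK mn); exact: box_add.
  apply: (@le_trans _ _ (\sum_(q <- (B n `\` B (n - m))%fset) 1)).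
    by apply: ler_sum => q _; exact: M_le1.
  by rewrite big_const_seq count_predT iter_addr_0 card_box_diff.
- move=> k; apply/ler_addgt0Pr => e e0.
  have e4 : 0 < e / 4 by lra.
  have v0 := vol_gt0 R d k.
  pose c : R := (#|A| ^ #|` B k|)%:R / vol k.
  (* Four errors share [e]: the entropy and the site expectation of the average against those of the
     limit, the overhang in Shearer's inequality and the boundary energy. *)
  have [n [gn n0 kn [h1 h2 [h3 h4]]]] : exists n, [/\ good n, (0 < n)%N, (k <= n)%N &
      [/\ ent (avg (gibbs n) n) (B k) <= ent (pr nu) (B k) + vol k * (e / 4),
      expect (avg (gibbs n) n) (B 1) site_fun <= expect (pr nu) (B 1) site_fun + e / 4 &
      c * (shell k n / vol n) <= e / 4 /\ 2 * en_sup Phi * (shell 1 n / vol n) <= e / 4]].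
    apply: (@filter_ex _ U).
    near=> n; split; [by near: n | by near: n; apply: Uoo; exact: nbhs_infty_gt
      | by near: n; apply: Uoo; exact: nbhs_infty_ge | split; [| |split]]; near: n.
    - apply: ent_usc => // [n|x|]; last by rewrite mulr_gt0.
        exact/cylmeas_avg/cylmeas_gibbs.
      exact: (M_ge0 (cylmeas_pr nu)).
    - have h0 : (fun n => expect (avg (gibbs n) n) (B 1) site_fun) @ U -->
          expect (pr nu) (B 1) site_fun by exact: expect_cvg prl.
      by move/cvgrPdist_le : h0 => /(_ _ e4); apply: filterS => n; rewrite ler_norml; lra.
    - by move/cvgr0Pnorm_le : (shell0M c k) => /(_ _ e4); apply: filterS => n; exact/le_trans/ler_norm.
    - move/cvgr0Pnorm_le : (shell0M (2 * en_sup Phi) 1%N) => /(_ _ e4).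
      by apply: filterS => n; exact/le_trans/ler_norm.
  have vn := vol_gt0 R d n; have cG := cylmeas_gibbs (Zpos n).
  have a1 := ent_avg_le cG kn.
  have a2 := expect_gibbs_site (Zpos n) n0.
  have a3 := gibbs_free_energy (Zpos n).
  move: gn; rewrite /good /= ler_pdivlMr// -a3 => a4.
  have a5 : ent (gibbs n) (B n) / vol n <= ent (avg (gibbs n) n) (B k) / vol k + c * (shell k n / vol n).
    rewrite ler_pdivrMr// -(ler_pM2l v0); apply: le_trans a1 _.
    rewrite le_eqVlt; apply/orP; left; apply/eqP.
    rewrite /c; move: (vol_neq0 R d k) (vol_neq0 R d n).
    move: (shell k n) (ent _ _) (_%:R) (vol k) (vol n) => s' t' c' v w v' w'.
    by field; rewrite ?v' ?w'.
  have a6 : ent (avg (gibbs n) n) (B k) / vol k <= ent_rate (pr nu) k + e / 4.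
    by rewrite ler_pdivrMr// mulrDl /ent_rate divfK ?vol_neq0// (mulrC (e / 4)).
  have a7 : r <= ent (gibbs n) (B n) / vol n - expect (gibbs n) (B n) (en (B n)) / vol n.
    by rewrite -mulrBl ler_pdivlMr.
  have a8 : - expect (gibbs n) (B n) (en (B n)) / vol n <=
     expect (avg (gibbs n) n) (B 1) site_fun + 2 * en_sup Phi * (shell 1 n / vol n).
    by rewrite ler_pdivrMr// mulrDl [_ * vol n]mulrC -(mulrA (2 * en_sup Phi)) divfK ?vol_neq0.
  clear a1 a2 a3 a4 h1; clearbody c; move: a8; rewrite mulNr; lra.
Unshelve. all: by end_near. Qed.

End Limit.
End Construction.

(** * The pressure as the free energy of an equilibrium state *)

Section Pressure.
Variables (R : realType) (d : nat) (A : pfinType) (Phi : interaction R d A).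
Local Notation L := (lattice d).
Local Notation cfg := (lattice d -> A).
Local Notation B := (box d).
Local Notation vol := (vol R d).
Local Notation shell := (shell R d).
Local Notation e_ := (@Defs.basis d).
Local Notation en := (@en R d A Phi).
Local Notation adm := (@adm R d A Phi).
Local Notation site_fun := (@site_fun R d A Phi).
Local Notation part_fun := (@part_fun R d A Phi).
Implicit Types (S T : {fset L}) (x y : cfg) (p q : L) (F : cfg -> R).
Implicit Types mu nu : probability (conf d A) R.

Lemma admissible_adm S x : admissible Phi x -> adm S x.
Proof. by move=> h; apply/admP => p i pS piS; rewrite /allowed -(edgeE Phi p). Qed.

Lemma adm_supported_pr mu : supp mu `<=` admissible Phi -> adm_supported Phi (pr mu).
Proof.
move=> sa S x /pr_gt0_supp[z /sa za xz].
by rewrite (adm_local Phi xz); exact: admissible_adm.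
Qed.

Lemma entropyE mu : entropy mu = limn (ent_rate (pr mu)).
Proof.
congr (limn _); apply/funext => n; rewrite /ent_rate /ent /sumS [RHS]mulrC [LHS]mulNr -[LHS]mulrN; congr (_ * _).
by rewrite -sumrN; apply: eq_bigr => w _; rewrite /eta /pr restr_ext.
Qed.

Lemma A_funE x : admissible Phi x -> A_fun Phi x = (site_fun x)%:E.
Proof.
move=> ax; rewrite /A_fun /site_fun EFinB EFinN; congr (_ - _)%E.
rewrite -sumEFin; apply: eq_bigr => i _; rewrite edg_fin//.
by have := ax 0 i; rewrite add0r.
Qed.

(** Off the admissible configurations [A_fun] takes conventional values; both integrals are
    restricted to the conull support, where the integrands agree. *)
Lemma integral_A_fun mu : supp mu `<=` admissible Phi ->
  (\int[mu]_x A_fun Phi x = (expect (pr mu) (B 1) site_fun)%:E)%E.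
Proof.
move=> sa; rewrite -(integral_local mu (@site_fun_local _ _ _ Phi)).
have ms := measurable_supp mu; have s0 := setC_supp0 mu.
rewrite (integral_conull _ ms s0) [RHS](integral_conull _ ms s0).
by apply: eq_integral => x /set_mem/sa/A_funE.
Qed.

Lemma free_energyE mu : supp mu `<=` admissible Phi ->
  free_energy Phi mu = (limn (ent_rate (pr mu)) + expect (pr mu) (B 1) site_fun)%:E.
Proof. by move=> sa; rewrite /free_energy entropyE integral_A_fun. Qed.

Lemma expect_en (M : {fset L} -> cfg -> R) n : cylmeas M -> invariant M -> (0 < n)%N ->
  `|expect M (B n) (en (B n)) + vol n * expect M (B 1) site_fun| <= 2 * en_sup Phi * shell 1 n.
Proof.
move=> cM iM n0.
have -> : vol n * expect M (B 1) site_fun =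
    expect M (B (n + 1)) (fun x => \sum_(p <- B n) site_fun (trans p x)).
  rewrite expect_sum /vol -{1}(avg_inv n iM) expect_avg// mulrA divff ?vol_neq0// mul1r.
  rewrite !big_seq; apply: eq_bigr => p pn.
  rewrite [RHS](expect_sub cM (box_shift 1 pn))//.
  by move=> x y /agree_trans_cfg; exact: site_fun_local.
rewrite -(expect_sub cM (box_le d (leq_addr 1 n)) (@en_local _ _ _ Phi _)).
rewrite -expect_add -[X in `|X|]subr0.
have := ler_norm_expect cM (S := B (n + 1)) (G := fun=> 0).
by rewrite expect_cst//; apply => x _; rewrite subr0; exact: en_site_fun.
Qed.

Lemma shell_cvg_mul (c : R) k : (fun n => c * (shell k n / vol n)) @ \oo --> (0 : R).
Proof. by rewrite -(mulr0 c); apply: cvgM; [exact: cvg_cst | exact: shell_cvg]. Qed.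

Lemma expect_en_cvg M : cylmeas M -> invariant M ->
  (fun n => expect M (B n) (en (B n)) / vol n) @ \oo --> - expect M (B 1) site_fun.
Proof.
move=> cM iM; apply/cvgrPdist_le => e e0.
have /cvgr0Pnorm_le/(_ _ e0) sh := shell_cvg_mul (2 * en_sup Phi) 1.
near=> n.
have v0 := vol_gt0 R d n.
have n0 : (0 < n)%N by near: n; exact: nbhs_infty_gt.
rewrite -[X in `|X - _|](mulfK (vol_neq0 R d n)) -mulrBl normrM normfV (gtr0_norm v0).
apply: (@le_trans _ _ (2 * en_sup Phi * (shell 1 n / vol n))).
  rewrite mulrA ler_wpM2r ?invr_ge0 ?(ltW v0)//.
  by rewrite distrC mulNr opprK [_ * vol n]mulrC; exact: expect_en.
by apply: le_trans (ler_norm _) _; near: n.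
Unshelve. all: by end_near. Qed.

Lemma free_energy_cvg M : cylmeas M -> invariant M ->
  (fun n => (ent M (B n) - expect M (B n) (en (B n))) / vol n) @ \oo -->
  limn (ent_rate M) + expect M (B 1) site_fun.
Proof.
move=> cM iM; have [ec _] := ent_rate_cvg cM iM.
have h := expect_en_cvg cM iM.
rewrite (_ : (fun n => _) = (fun n => ent_rate M n - expect M (B n) (en (B n)) / vol n)).
  rewrite -[X in _ + X]opprK; exact: cvgB.
by apply/funext => n; rewrite mulrBl.
Qed.

Lemma part_fun_gt0 M S : cylmeas M -> adm_supported Phi M -> 0 < part_fun S.
Proof.
move=> cM aM; have [x mx Mx] := exists_M_gt0 S cM.
rewrite /part_fun /sumS (bigD1 (restr S x))//= ext_restr mx.
rewrite ltr_wpDr ?sumr_ge0// => [w _|]; first exact: wt_ge0.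
by rewrite wt_adm ?expR_gt0// aM.
Qed.

Variable mu : probability (conf d A) R.
Hypothesis eq_mu : equilibrium_state Phi mu.

Let M := pr mu.
Definition fe : R := limn (ent_rate M) + expect M (B 1) site_fun.

Let imu : shift_invariant mu. Proof. by have [] := eq_mu. Qed.
Let smu : supp mu `<=` admissible Phi. Proof. by have [] := eq_mu. Qed.
Let cM : cylmeas M. Proof. exact: cylmeas_pr. Qed.
Let iM : invariant M. Proof. exact: invariant_pr. Qed.
Let aM : adm_supported Phi M. Proof. exact: adm_supported_pr. Qed.

Lemma part_fun_eq_gt0 S : 0 < part_fun S. Proof. exact: part_fun_gt0 cM aM. Qed.

(** The Gibbs inequality for [mu] gives the lower bound. If the upper one failed by [e] infinitely
    often, [limit_of_gibbs] would produce an invariant law on admissible configurations of free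
    energy at least [fe + e], against the maximality of [mu]. Convergence itself comes out of the
    argument. *)
Lemma log_part_fun_cvg : (fun n => ln (part_fun (B n)) / vol n) @ \oo --> fe.
Proof.
have lo := free_energy_cvg cM iM; rewrite -/fe in lo.
apply/cvgrPdist_le => e e0; near=> n.
have v0 := vol_gt0 R d n.
have h1 : fe - e <= (ent M (B n) - expect M (B n) (en (B n))) / vol n.
  near: n; move/cvgrPdist_le : lo => /(_ _ e0); apply: filterS => n.
  by rewrite ler_norml; lra.
have h2 : (ent M (B n) - expect M (B n) (en (B n))) / vol n <= ln (part_fun (B n)) / vol n.
  rewrite ler_wpM2r ?invr_ge0 ?(ltW v0)//.
  have := gibbs_inequality (B n) (fun=> 0) cM aM.
  rewrite expect_cst// addr0; congr (_ <= ln _); apply: eq_sumS => x _.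
  by rewrite expR0 mulr1.
have h3 : ln (part_fun (B n)) / vol n < fe + e.
  near: n; apply: contrapT => nh.
  have freq N : exists2 n, (N <= n)%N & fe + e <= ln (part_fun (B n)) / vol n.
    apply: contrapT => k; apply: nh; exists N => // n /= Nn.
    by rewrite ltNge; apply/negP => h; apply: k; exists n.
  have [nu [inu snu hnu]] := limit_of_gibbs (fun n => part_fun_eq_gt0 (B n)) freq.
  have [_ _ /(_ nu inu snu)] := eq_mu; rewrite !free_energyE// lee_fin -/fe.
  have [_ /(_ (fe + e - expect (pr nu) (B 1) site_fun))] :=
    ent_rate_cvg (cylmeas_pr nu) (invariant_pr inu).
  have hk k : fe + e - expect (pr nu) (B 1) site_fun <= ent_rate (pr nu) k.
    by have := hnu k; lra.
  move=> /(_ hk); lra.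
by rewrite ler_norml; apply/andP; split; lra.
Unshelve. all: by end_near. Qed.

Lemma pressureE : pressure Phi = fe%:E.
Proof.
rewrite /pressure (_ : (fun n => _) = (fun n => (ln (part_fun (B n)) / vol n)%:E)).
  by apply: cvg_lim => //; apply/fine_cvgP; split; [exact: nearW | exact: log_part_fun_cvg].
apply/funext => n; rewrite part_funE lne_EFin ?part_fun_eq_gt0//.
by rewrite -EFinM mulrC.
Qed.

End Pressure.
(** * Equilibrium states are Gibbs *)

Section LanfordRuelle.
Variables (R : realType) (d : nat) (A : pfinType) (Phi : interaction R d A).
Local Notation L := (lattice d).
Local Notation cfg := (lattice d -> A).
Local Notation B := (box d).
Local Notation vol := (vol R d).
Local Notation e_ := (@Defs.basis d).
Local Notation en := (@en R d A Phi).
Local Notation adm := (@adm R d A Phi).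
Local Notation wt := (@wt R d A Phi).
Local Notation part_fun := (@part_fun R d A Phi).
Implicit Types (S T : {fset L}) (x y w : cfg) (p q : L) (F : cfg -> R).

(** From [ln v <= v - 1] at [v = (1 + u)^-1]; the coefficient 2 is not sharp, but only the order of
    the error matters. *)
Lemma ln1D_ge (u : R) : `|u| <= 1 / 2 -> u - 2 * u ^+ 2 <= ln (1 + u).
Proof.
rewrite ler_norml => /andP[u1 u2].
have u0 : 0 < 1 + u by lra.
have h := ln_le_sub1 (_ : 0 < (1 + u)^-1); rewrite lnV ?posrE// in h.
have {}h := h _; have iu : 0 < (1 + u)^-1 by rewrite invr_gt0.
have {}h := h iu.
suff : u - 2 * u ^+ 2 <= 1 - (1 + u)^-1 by lra.
have -> : 1 - (1 + u)^-1 = u / (1 + u) by field; rewrite gt_eqF.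
rewrite ler_pdivlMr// -subr_ge0.
have -> : u - (u - 2 * u ^+ 2) * (1 + u) = u ^+ 2 * (1 + 2 * u) by ring.
by rewrite mulr_ge0 ?sqr_ge0//; lra.
Qed.

Section Perturbation.
Variables (m : nat) (T : {fset L}) (x y : cfg).
Hypothesis (Tm : (T `<=` B m)%fset) (ax : adm T x) (ay : adm T y).
Hypothesis inner : forall q, q \in T -> x q != y q ->
  forall i, q + e_ i \in T /\ q - e_ i \in T.
Hypothesis nxy : ~ agree T x y.

Let a := expR (en T x).
Let b := expR (en T y).

(** The factors [a] and [b] undo the Boltzmann weights of the two words, so that exchanging [x] and
    [y] at [p] negates [wt] times the translate of [psi]. *)
Definition psi w : R := (agreeb T w x)%:R * a - (agreeb T w y)%:R * b.

Definition paste p (z w : cfg) : cfg := fun r => if r \in shiftfs p T then z (r - p) else w r.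

Definition swap p w : cfg :=
  if agreeb T (trans p w) x then paste p y w
  else if agreeb T (trans p w) y then paste p x w else w.

Lemma agreeb_paste p z z' w : agreeb T (trans p (paste p z w)) z' = agreeb T z z'.
Proof.
have h : agree T (trans p (paste p z w)) z.
  by move=> q qT; rewrite /trans /paste addr_shiftfs qT [p + q]addrC addrK.
apply/agreeP/agreeP => k; last exact: agree_trans h k.
by apply: agree_trans k; exact: agree_sym.
Qed.

Lemma agreeb_xy : agreeb T x y = false. Proof. by apply/agreeP. Qed.
Lemma agreeb_yx : agreeb T y x = false. Proof. by apply/agreeP => h; apply: nxy; exact: agree_sym. Qed.
Lemma agreeb_refl (z : cfg) : agreeb T z z. Proof. by apply/agreeP. Qed.

Lemma paste_id p z z' w : agreeb T (trans p w) z -> paste p z (paste p z' w) = w.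
Proof.
move=> /agreeP h; apply/funext => r; rewrite /paste; case: ifP => rT; last by rewrite rT.
by rewrite -h -?in_shiftfs// /trans addrC subrK.
Qed.

Lemma swapK p w : swap p (swap p w) = w.
Proof.
rewrite {2}/swap; case: ifP => wx.
  by rewrite /swap agreeb_paste agreeb_yx agreeb_paste agreeb_refl paste_id.
case: ifP => wy; last by rewrite /swap wx wy.
by rewrite /swap agreeb_paste agreeb_refl paste_id.
Qed.

Lemma swap_off p w r : r \notin shiftfs p T -> swap p w r = w r.
Proof.
move=> /negbTE rT; rewrite /swap; case: ifP => _; first by rewrite /paste rT.
by case: ifP => _; rewrite // /paste rT.
Qed.

Lemma wt_paste S p z z' w : (shiftfs p T `<=` S)%fset -> agree T (trans p w) z ->
  adm T z -> adm T z' ->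
  (forall q, q \in T -> z q != z' q -> forall i, q + e_ i \in T /\ q - e_ i \in T) ->
  wt S w * expR (en T z) = wt S (paste p z' w) * expR (en T z').
Proof.
move=> pS wz az az' inn; set w' := paste p z' w.
have wz' : agree T (trans p w') z' by apply/agreeP; rewrite agreeb_paste agreeb_refl.
have D : inner_diff (shiftfs p T) S w w'.
  move=> r rS; rewrite /w' /paste; case: ifP => [rT wr|_]; last by rewrite eqxx.
  rewrite in_shiftfs in rT; split=> // i; rewrite !in_shiftfs.
  have wE : w r = z (r - p) by rewrite -wz// /trans addrC subrK.
  rewrite wE in wr; have [h1 h2] := inn _ rT wr i.
  by split=> _; rewrite addrAC.
have aw : adm (shiftfs p T) w by rewrite adm_shift (adm_local Phi wz).
have aw' : adm (shiftfs p T) w' by rewrite adm_shift (adm_local Phi wz').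
rewrite /wt.
have -> : adm S w' = adm S w.
  by apply/idP/idP => h; [exact: (adm_swap (inner_diff_sym D) aw h) | exact: (adm_swap D aw' h)].
case: ifP => // _; rewrite ?mul0r// -!expRD; congr expR.
have := en_swap Phi pS D; rewrite !en_shift (en_local Phi wz) (en_local Phi wz'); lra.
Qed.

Lemma psi_swap S p w : (shiftfs p T `<=` S)%fset ->
  wt S (swap p w) * psi (trans p (swap p w)) = - (wt S w * psi (trans p w)).
Proof.
move=> pS; rewrite {1 2}/swap /psi; case: ifPn => wx.
  rewrite !agreeb_paste agreeb_yx agreeb_refl.
  have -> : agreeb T (trans p w) y = false.
    apply/negP => /agreeP wy; apply: nxy; apply: agree_trans wy; apply: agree_sym.
    exact/agreeP.
  rewrite !mul0r mul1r sub0r subr0 mulrN; congr (- _); rewrite mul1r.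
  by apply/esym/wt_paste => //; exact/agreeP.
case: ifPn => wy; last by rewrite (negbTE wx) (negbTE wy) !mul0r subr0 mulr0 oppr0.
rewrite !agreeb_paste agreeb_xy agreeb_refl !mul0r !mul1r sub0r subr0 mulrN opprK.
apply/esym/wt_paste => //; first exact/agreeP.
by move=> q qT; rewrite eq_sym; exact: inner.
Qed.

(* Sites [q] of [N Z^d] with [N = 2 m + 1], whose translates of [B m] tile a box. *)
Definition scale q : L := [ffun i => q i * ((m + m).+1)%:Z].

Lemma scale_int_inj (u v s : int) : (absz (s - u * ((m + m).+1)%:Z)%R <= m)%N ->
  (absz (s - v * ((m + m).+1)%:Z)%R <= m)%N -> u = v.
Proof.
move=> h h'.
have N0 : 0 <= ((m + m).+1)%:Z by lia.
have [uv|uv|//] := ltgtP u v; exfalso.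
  have : (u + 1) * ((m + m).+1)%:Z <= v * ((m + m).+1)%:Z by rewrite ler_wpM2r//; lia.
  rewrite mulrDl mul1r; move: (u * _) (v * _) h h' => a' b'; lia.
have : (v + 1) * ((m + m).+1)%:Z <= u * ((m + m).+1)%:Z by rewrite ler_wpM2r//; lia.
rewrite mulrDl mul1r; move: (u * _) (v * _) h h' => a' b'; lia.
Qed.

Lemma scale_int_le (u s : int) k : (absz (s - u * ((m + m).+1)%:Z)%R <= m)%N ->
  (absz u <= k)%N -> (absz s <= (m + m).+1 * k + m)%N.
Proof.
move=> h uk.
have N0 : 0 <= ((m + m).+1)%:Z by lia.
have h1 : u * ((m + m).+1)%:Z <= k%:Z * ((m + m).+1)%:Z by rewrite ler_wpM2r//; lia.
have h2 : (- k%:Z) * ((m + m).+1)%:Z <= u * ((m + m).+1)%:Z by rewrite ler_wpM2r//; lia.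
rewrite mulNr in h2; have : k%:Z * ((m + m).+1)%:Z = ((m + m).+1 * k)%N%:Z by rewrite -PoszM mulnC.
move=> e; rewrite e in h1 h2; move: (u * _) ((m + m).+1 * k)%N h h1 h2 => a' b'; lia.
Qed.

Lemma scale_disjoint q q' r : r \in shiftfs (scale q) T -> r \in shiftfs (scale q') T -> q = q'.
Proof.
rewrite !in_shiftfs => /(fsubsetP Tm)/in_boxP h /(fsubsetP Tm)/in_boxP h'.
apply/ffunP => i; have := h i; have := h' i; rewrite !latD !latN !ffunE.
by move=> h1 h2; exact: scale_int_inj h2 h1.
Qed.

Lemma scale_box k q : q \in B k -> (shiftfs (scale q) T `<=` B ((m + m).+1 * k + m))%fset.
Proof.
move=> /in_boxP qk; apply/fsubsetP => r; rewrite in_shiftfs => /(fsubsetP Tm)/in_boxP rm.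
apply/in_boxP => i; have := rm i; have := qk i; rewrite latD latN ffunE.
by move=> h1 h2; exact: scale_int_le h2 h1.
Qed.

(** The factors are removed one at a time. The term linear in [psi] at [q] sums to 0 because
    [swap (scale q)] negates it: the translates of [T] being disjoint, the other factors do not
    notice the exchange. *)
Lemma psi_prod_sum S (s : seq L) t : uniq s ->
  (forall q, q \in s -> (shiftfs (scale q) T `<=` S)%fset) ->
  sumS S (fun w => wt S w * \prod_(q <- s) (1 + t * psi (trans (scale q) w))) = part_fun S.
Proof.
elim: s => [_ _|q s IH]; first by apply: eq_sumS => w _; rewrite big_nil mulr1.
move=> /= /andP[qs us] sS; rewrite -[RHS]IH//; last by move=> q' q's; apply: sS; rewrite inE q's orbT.
pose P w := \prod_(q <- s) (1 + t * psi (trans (scale q) w)).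
have qS : (shiftfs (scale q) T `<=` S)%fset by apply: sS; rewrite inE eqxx.
transitivity (sumS S (fun w => wt S w * P w) +
    t * sumS S (fun w => wt S w * psi (trans (scale q) w) * P w)).
  rewrite -sumS_scale -sumS_add; apply: eq_sumS => w _; rewrite big_cons -/(P w); ring.
suff -> : sumS S (fun w => wt S w * psi (trans (scale q) w) * P w) = 0 by rewrite mulr0 addr0.
set G := fun w => _ * P w; suff : sumS S G = - sumS S G by lra.
rewrite -{1}(@sumS_invol R d A S (swap (scale q)) G).
- rewrite -sumS_opp; apply: eq_sumS => w _; rewrite /G /= psi_swap// mulNr; congr (- (_ * _)).
  rewrite /P !big_seq; apply: eq_bigr => q' q's; congr (1 + t * _).
  suff h : agree T (trans (scale q') (swap (scale q) w)) (trans (scale q') w).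
    rewrite /psi; have E z : agreeb T (trans (scale q') (swap (scale q) w)) z = agreeb T (trans (scale q') w) z.
      by apply/agreeP/agreeP => k; apply: agree_trans k => //; exact: agree_sym.
    by rewrite !E.
  apply/agree_trans_cfg => r rq'; apply: swap_off; apply/negP => rq.
  by move: qs; rewrite (scale_disjoint rq rq') q's.
- move=> w mw; apply/funext => r; rewrite /mask; case: ifP => // rS.
  rewrite swap_off; last by apply: contraFN rS => /(fsubsetP qS).
  by rewrite -mw /mask rS.
- by move=> w _; exact: swapK.
Qed.

Let a0 : 0 < a. Proof. exact: expR_gt0. Qed.
Let b0 : 0 < b. Proof. exact: expR_gt0. Qed.

Lemma psi_small (t : R) w : `|t| * (a + b) <= 1 / 2 -> `|t * psi w| <= 1 / 2.
Proof.
rewrite normrM; apply: le_trans; rewrite ler_wpM2l// /psi.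
apply: le_trans (ler_normB _ _) _; rewrite !normrM !normr_nat !gtr0_norm//.
by apply: lerD; rewrite ler_piMl ?(ltW a0) ?(ltW b0)// lern1 leq_b1.
Qed.

Definition log_tilt t w : R := ln (1 + t * psi w).

Lemma log_tilt_local t : local_on T (log_tilt t).
Proof.
move=> w w' ww'; rewrite /log_tilt /psi.
have E z : agreeb T w z = agreeb T w' z.
  by apply/agreeP/agreeP => k; apply: agree_trans k => //; exact: agree_sym.
by rewrite !E.
Qed.

Lemma expR_log_tilt (t : R) w : `|t| * (a + b) <= 1 / 2 -> expR (log_tilt t w) = 1 + t * psi w.
Proof.
move=> /(@psi_small _ w); rewrite ler_norml => /andP[h _].
by rewrite lnK// posrE; lra.
Qed.

(** The box of radius [(m + m).+1 * k + m] is tiled by translates of [B m], one for each site of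
    [B k]. *)
Lemma vol_scale k : vol ((m + m).+1 * k + m) = ((m + m).+1 ^ d)%:R * vol k.
Proof.
rewrite /vol !card_box -natrM -expnMn; congr ((_ ^ _)%:R).
by rewrite mulnSr; lia.
Qed.

Variable mu : probability (conf d A) R.
Hypothesis eq_mu : equilibrium_state Phi mu.
Let M := pr mu.
Let cM : cylmeas M. Proof. exact: cylmeas_pr. Qed.
Let iM : invariant M. Proof. by apply: invariant_pr; have [] := eq_mu. Qed.
Let aM : adm_supported Phi M. Proof. by apply: adm_supported_pr; have [] := eq_mu. Qed.

(* Tilting the Gibbs weight at all sites of a sparse sublattice by [1 + t psi] does
   not change the partition function, since [swap] negates the weighted [psi]; each
   tilted site then contributes to the defect of the Gibbs inequality, which is
   sublinear in the volume. *)
Lemma expect_log_tilt (t : R) : `|t| * (a + b) <= 1 / 2 -> expect M T (log_tilt t) <= 0.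
Proof.
move=> ht; set G := expect M T _.
pose N : R := ((m + m).+1 ^ d)%:R.
have N0 : 0 < N by rewrite ltr0n expn_gt0.
(* Each of the [vol k] sites contributes [G] to the expectation of [F], and [vol n = N * vol k]. *)
have key k : let n := ((m + m).+1 * k + m)%N in
    G / N <= ln (part_fun (B n)) / vol n - (ent M (B n) - expect M (B n) (en (B n))) / vol n.
  move=> n; pose F w := \sum_(q <- B k) log_tilt t (trans (scale q) w).
  have := gibbs_inequality (B n) F cM aM.
  have -> : sumS (B n) (fun w => wt (B n) w * expR (F w)) = part_fun (B n).
    rewrite -(@psi_prod_sum (B n) (B k) t (fset_uniq _)); last by move=> q; exact: scale_box.
    apply: eq_sumS => w _; congr (_ * _).
    rewrite /F (big_morph expR (@expRD R) (@expR0 R)); apply: eq_bigr => q _.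
    exact: expR_log_tilt.
  have -> : expect M (B n) F = vol k * G.
    rewrite /F expect_sum /vol.
    transitivity (\sum_(q <- B k) G); last first.
      by rewrite big_const_seq count_predT iter_addr_0 -(mulr_natl G).
    rewrite !big_seq; apply: eq_bigr => q qk.
    rewrite (expect_sub cM (scale_box qk)); first exact: expect_shift.
    by move=> z z' /agree_trans_cfg/log_tilt_local.
  have v0 := vol_gt0 R d k; have n0 := vol_gt0 R d n.
  move=> h; rewrite -mulrBl ler_pdivlMr// /n vol_scale -/N.
  have -> : G / N * (N * vol k) = vol k * G by field; rewrite gt_eqF.
  lra.
have c1 := log_part_fun_cvg eq_mu; have c2 := @free_energy_cvg _ _ _ Phi _ cM iM.
have c3 : (fun n => ln (part_fun (B n)) / vol n -
    (ent M (B n) - expect M (B n) (en (B n))) / vol n) @ \oo --> (0 : R).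
  by rewrite -(subrr (fe Phi mu)); exact: cvgB c1 c2.
suff : G / N <= 0 by rewrite pmulr_lle0 ?invr_gt0.
apply/ler_addgt0Pr => e e0; rewrite add0r.
have [K _ hK] : \forall n \near \oo, `|ln (part_fun (B n)) / vol n -
    (ent M (B n) - expect M (B n) (en (B n))) / vol n| <= e.
  by move/cvgr0Pnorm_le : c3; exact.
apply: le_trans (key K) _; apply: le_trans (ler_norm _) (hK _ _) => /=.
by rewrite mulSn -addnA leq_addr.
Qed.

(** Since [t] may have either sign, [t * D <= t ^+ 2 * K] for all small [t] forces [D = 0], where
    [D] is the first-order coefficient of the expected tilt. *)
Lemma lanford_ruelle_neq : M T x * a = M T y * b.
Proof.
have Ex t : expect M T (log_tilt t) = M T x * ln (1 + t * a) + M T y * ln (1 - t * b).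
  have -> : expect M T (log_tilt t) = expect M T (fun w =>
      ln (1 + t * a) * (agreeb T w x)%:R + ln (1 - t * b) * (agreeb T w y)%:R).
    apply: eq_sumS => w _; congr (_ * _); rewrite /log_tilt /psi.
    case: agreeP => wx; case: agreeP => wy.
    - by exfalso; apply: nxy; apply: agree_trans wy; exact: agree_sym.
    - by rewrite mul1r mul0r subr0 mulr1 mulr0 addr0.
    - by rewrite mul1r mul0r sub0r mulr1 mulr0 add0r mulrN.
    - by rewrite !mul0r subr0 !mulr0 !addr0 ln1.
  rewrite expect_add !expect_scale !expect_ind// mulrC; congr (_ + _); exact: mulrC.
pose D := M T x * a - M T y * b; pose K := 2 * (M T x * a ^+ 2 + M T y * b ^+ 2).
have Mx := M_ge0 cM T x; have My := M_ge0 cM T y.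
have K0 : 0 <= K by rewrite mulr_ge0// addr_ge0// mulr_ge0// sqr_ge0.
have ab0 : 0 < a + b by rewrite addr_gt0.
have key (t : R) : `|t| * (a + b) <= 1 / 2 -> t * D <= t ^+ 2 * K.
  move=> ht; have := expect_log_tilt ht; rewrite Ex.
  have hu (c : R) : 0 < c -> c <= a + b -> `|t * c| <= 1 / 2.
    by move=> c0 cab; rewrite normrM (gtr0_norm c0); apply: le_trans ht; rewrite ler_wpM2l.
  have h1 := ln1D_ge (hu a a0 (_ : a <= a + b)); rewrite lerDl (ltW b0) in h1.
  have h2 := ln1D_ge (_ : `|- (t * b)| <= 1 / 2); rewrite normrN in h2.
  have h3 : b <= a + b by rewrite lerDr ltW.
  have {h3}h2 := h2 (hu b b0 h3).
  have h4 : M T x * (t * a - 2 * (t * a) ^+ 2) <= M T x * ln (1 + t * a) by rewrite ler_wpM2l// h1.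
  have h5 : M T y * (- (t * b) - 2 * (- (t * b)) ^+ 2) <= M T y * ln (1 - t * b) by rewrite ler_wpM2l.
  move=> h6; rewrite /D /K.
  have -> : t * (M T x * a - M T y * b) = M T x * (t * a - 2 * (t * a) ^+ 2) +
     M T y * (- (t * b) - 2 * (- (t * b)) ^+ 2) + t ^+ 2 * (2 * (M T x * a ^+ 2 + M T y * b ^+ 2)) by ring.
  lra.
pose s := (2 * (a + b))^-1.
have den : 0 < 2 * (a + b) by lra.
have s0 : 0 < s by rewrite invr_gt0.
have hs (t : R) : `|t| <= s -> `|t| * (a + b) <= 1 / 2.
  move=> ts; apply: (@le_trans _ _ (s * (a + b))); first by rewrite ler_wpM2r// ltW.
  by rewrite /s mulrC ler_pdivrMr//; lra.
have small (e : R) : 0 < e -> exists t : R, [/\ 0 < t, t <= s & t * K <= e].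
  move=> e0; have K1 : 0 < K + 1 by lra.
  exists (Num.min s (e / (K + 1))); split; first by rewrite lt_min s0 divr_gt0.
    by rewrite ge_min lexx.
  apply: (@le_trans _ _ (e / (K + 1) * K)); first by rewrite ler_wpM2r// ge_min lexx orbT.
  by rewrite mulrAC ler_pdivrMr// ler_wpM2l ?(ltW e0)//; lra.
apply/eqP; rewrite -subr_eq0 -/D eq_le; apply/andP; split.
  apply/ler_addgt0Pr => e /small[t [t0 ts tK]]; rewrite add0r; apply: le_trans tK.
  rewrite -(ler_pM2l t0); have := key t (hs t _); rewrite gtr0_norm// => /(_ ts).
  by rewrite expr2 -mulrA.
rewrite -oppr_le0; apply/ler_addgt0Pr => e /small[t [t0 ts tK]]; rewrite add0r; apply: le_trans tK.
rewrite -(ler_pM2l t0); have := key (- t) (hs (- t) _); rewrite normrN gtr0_norm// => /(_ ts).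
by rewrite sqrrN expr2 -mulrA mulNr mulrN.
Qed.

End Perturbation.

Theorem lanford_ruelle mu T x y : equilibrium_state Phi mu -> adm T x -> adm T y ->
  (forall q, q \in T -> x q != y q -> forall i, q + e_ i \in T /\ q - e_ i \in T) ->
  pr mu T x * expR (en T x) = pr mu T y * expR (en T y).
Proof.
move=> eq_mu ax ay inn; have [xy|nxy] := pselect (agree T x y).
  by rewrite (M_local (cylmeas_pr mu) xy) (en_local Phi xy).
have [m Tm] := fset_sub_box T.
exact: (lanford_ruelle_neq Tm ax ay inn nxy eq_mu).
Qed.

End LanfordRuelle.
(** * Consequences of mixing *)

Section Tssm.
Variables (R : realType) (d : nat) (A : pfinType) (Phi : interaction R d A).
Local Notation L := (lattice d).
Local Notation cfg := (lattice d -> A).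
Local Notation B := (box d).
Local Notation vol := (vol R d).
Local Notation shell := (shell R d).
Local Notation e_ := (@Defs.basis d).
Local Notation en := (@en R d A Phi).
Local Notation adm := (@adm R d A Phi).
Local Notation site_fun := (@site_fun R d A Phi).
Implicit Types (S T U V Q D : {fset L}) (x y z w : cfg) (p q : L) (F : cfg -> R).

Lemma norm1N p : norm1 (- p) = norm1 p.
Proof. by apply: eq_bigr => i _; rewrite latN abszN. Qed.

Lemma notin_box n p : p \notin B n -> (n < norm1 p)%N.
Proof.
rewrite in_box negb_forall => /existsP[i]; rewrite -ltnNge => /leq_trans; apply.
by rewrite /norm1 (bigD1 i)//= leq_addr.
Qed.

Lemma box_basisD n p (i : 'I_d) : p \in B n -> p + e_ i \in B n.+1 /\ p - e_ i \in B n.+1.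
Proof.
move=> pn; rewrite -addn1; split; first by rewrite box_add ?basis_box.
by rewrite box_sub ?basis_box.
Qed.

Variable mu : probability (conf d A) R.
Hypothesis eq_mu : equilibrium_state Phi mu.
Let M := pr mu.
Let cM : cylmeas M. Proof. exact: cylmeas_pr. Qed.
Let iM : invariant M. Proof. by apply: invariant_pr; have [] := eq_mu. Qed.
Let aM : adm_supported Phi M. Proof. by apply: adm_supported_pr; have [] := eq_mu. Qed.

(** TSSM in terms of words of positive measure: the words on [U], [V] and [S] are read off [x] and
    [y], and the glued configuration [z] lies in the support. *)
Definition mixing g := forall U V S x y,
  (forall p q, p \in U -> q \in V -> (g <= norm1 (p - q)%R)%N) ->
  agree S x y -> 0 < M (U `|` S)%fset x -> 0 < M (V `|` S)%fset y ->
  exists z, [/\ supp mu z, agree U z x, agree V z y & agree S z x].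

Lemma mixingP : TSSM (supp mu) -> exists g, mixing g.
Proof.
move=> [g hg]; exists g => U V S x y UV xy.
move=> /pr_gt0_supp[x' x's xx'] /pr_gt0_supp[y' y's yy'].
have sx : agree S x' x.
  by apply: agree_sym; apply: agree_sub xx'; exact: fsubsetUr.
have ux : agree U x' x.
  by apply: agree_sym; apply: agree_sub xx'; exact: fsubsetUl.
have vy : agree V y' y.
  by apply: agree_sym; apply: agree_sub yy'; exact: fsubsetUl.
have sy : agree S y' x.
  apply: (@agree_trans _ _ _ _ y); last exact: agree_sym.
  by apply: agree_sym; apply: agree_sub yy'; exact: fsubsetUr.
have dUV : dist_ge g (dist U V).
  case E: (dist U V) => [n|//] /=; have [[p [q [pU qV <-]]] _] := (distP _ _ _).1 E.
  exact: UV.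
have [] := hg U V S (restr U (x : conf d A)) (restr V (y : conf d A)) (restr S (x : conf d A)) dUV.
- by exists x'; split; [split=> //|]; rewrite cylE; exact: agree_sym.
- by exists y'; split; [split=> //|]; rewrite cylE; exact: agree_sym.
move=> z [[[zs]]]; rewrite !cylE => zx zx' zy; exists z.
by split=> //; exact: agree_sym.
Qed.

Definition en_lip : R := 2 * en_sup Phi * d.+1%:R.

Lemma en_lip_ge0 : 0 <= en_lip.
Proof. by rewrite !mulr_ge0// en_sup_ge0. Qed.

(** The Gibbs identity turns the ratio of measures into the exponential of an energy difference,
    bounded by the number of sites of [S], outside which the words agree. *)
Lemma lr_ratio T S x y : 0 < M T x -> 0 < M T y ->
  (forall q, q \in T -> x q != y q -> q \in S /\ forall i, q + e_ i \in T /\ q - e_ i \in T) ->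
  M T x <= expR (en_lip * #|` S|%:R) * M T y.
Proof.
move=> Mx My xy; have := lanford_ruelle eq_mu (aM Mx) (aM My).
move=> /(_ (fun q qT n => (xy q qT n).2)); rewrite -/M => e.
have -> : M T x = expR (en T y - en T x) * M T y.
  rewrite expRD expRN; apply: (mulIf (lt0r_neq0 (expR_gt0 (en T x)))).
  rewrite e; field; exact: lt0r_neq0 (expR_gt0 _).
rewrite ler_wpM2r ?(ltW My)// ler_expR.
apply: le_trans (ler_norm _) _; apply: en_diff_bound => p pT pS.
by apply/eqP; apply: contraNT pS => n; rewrite eq_sym in n; have [] := xy _ pT n.
Qed.

Variable g : nat.
Hypothesis mix_g : mixing g.

(** Number of words on a [g]-ball times a bound on the energetic factor for changing such a word. *)
Definition cond_cst : R := (#|A| ^ #|` B g|)%:R * expR (en_lip * #|` B g|%:R).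

Lemma cond_cst_ge1 : 1 <= cond_cst.
Proof.
rewrite -[1]mulr1; apply: ler_pM => //.
  by rewrite ler1n expn_gt0; apply/orP; left; apply/card_gt0P; exists point.
by rewrite -expR0 ler_expR mulr_ge0// en_lip_ge0.
Qed.

(* Mixing decouples [p] from the shell around its [g]-ball, so that the word on the
   ball can be replaced, at bounded energetic cost, by one with the prescribed value
   at [p]. *)
Lemma cond_lower p Q x : p \notin Q -> 0 < M (p |` Q)%fset x ->
  M Q x <= cond_cst * M (p |` Q)%fset x.
Proof.
(* The extra layer in [T] makes changes inside [S] interior to [T], as [lr_ratio] requires. *)
move=> pQ Mx; pose S := shiftfs p (B g); pose T := shiftfs p (B g.+1).
have pS : p \in S by rewrite in_shiftfs subrr box0.
have ST : (S `<=` T)%fset.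
  by apply/fsubsetP => q; rewrite !in_shiftfs; exact/fsubsetP/box_le.
pose D := ((T `\` S) `\` Q)%fset.
have QD : [disjoint Q & D]%fset by exact: disjoint_setD.
have pD : p \notin D by rewrite !inE pS andbF.
have pQD : [disjoint (p |` Q)%fset & D]%fset by rewrite fdisjointUX fdisjoint1X pD.
rewrite (M_total cM x QD) (M_total cM x pQD) -sumS_scale; apply: ler_sumS => w _.
set y := mix Q x w; set y' := mix _ x w.
have [y0|yn] := eqVneq (M (Q `|` D)%fset y) 0.
  by rewrite y0 mulr_ge0 ?M_ge0// (le_trans _ cond_cst_ge1).
pose E := (S `\` Q)%fset.
have QDE : [disjoint (Q `|` D)%fset & E]%fset.
  by apply/fdisjointP => q; rewrite !inE; case: (q \in Q) => //=; case: (q \in S).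
rewrite (M_total cM y QDE).
have TE : ((Q `|` D) `|` E = Q `|` T)%fset.
  apply/fsetP => q; rewrite !inE; have := fsubsetP ST q.
  by case: (q \in Q) => //=; case: (q \in S) => //= [->|_]; rewrite ?orbT ?orbF.
rewrite TE; set b := expR (en_lip * #|` S|%:R) * M ((p |` Q) `|` D)%fset y'.
have b0 : 0 <= b by rewrite mulr_ge0 ?expR_ge0 ?M_ge0.
apply: (@le_trans _ _ (sumS E (fun=> b) : R)).
  apply: ler_sumS => v _; set Y := mix _ y v.
  have := M_ge0 cM (Q `|` T)%fset Y; rewrite le_eqVlt => /predU1P[<-//|MY].
  have xY : agree Q x Y.
    by move=> q qQ; rewrite /Y /mix inE qQ /= /y /mix qQ.
  have far p' q : p' \in [fset p]%fset -> q \in (T `\` S)%fset -> (g <= norm1 (p' - q)%R)%N.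
    rewrite inE => /eqP ->; rewrite !inE in_shiftfs => /andP[/notin_box h _].
    by rewrite -norm1N opprB ltnW.
  have MY' : 0 < M ((T `\` S) `|` Q)%fset Y.
    apply: M_pos_sub MY => //; apply/fsubsetP => q; rewrite !inE.
    by case: (q \in Q); rewrite ?orbT// orbF => /andP[].
  (* [z] keeps the word of [Y] on the shell and on [Q] but has the symbol of [x] at [p], so on [T]
     it differs from [Y] only inside [S]. *)
  have [z [zs zp zT zQ]] := mix_g far xY Mx MY'.
  have Mz S' : 0 < M S' z by exact: (suppP mu z).1.
  have YT q : q \in Q -> Y q = z q by move=> qQ; rewrite zQ// xY.
  have := @lr_ratio (Q `|` T)%fset S Y z MY (Mz _).
  move=> /(_ _)/le_trans; apply.
    move=> q; rewrite inE => /orP[qQ|qT] ne; first by rewrite YT ?eqxx in ne.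
    have qS : q \in S.
      by apply: contraNT ne => qS; rewrite zT// !inE qS.
    split=> // i; have [h1 h2] : q - p + e_ i \in B g.+1 /\ q - p - e_ i \in B g.+1.
      by apply: box_basisD; rewrite -in_shiftfs.
    by rewrite !inE !in_shiftfs [q + _ - p]addrAC h1 [q - _ - p]addrAC h2 !orbT.
  rewrite /b ler_wpM2l ?expR_ge0//.
  have -> : M ((p |` Q) `|` D)%fset y' = M ((p |` Q) `|` D)%fset z.
    apply: (M_local cM) => q; rewrite !inE -orbA => /or3P[/eqP->|qQ|/and3P[qQ qS qT]].
    - by rewrite /y' /mix !inE eqxx /= zp ?inE.
    - by rewrite /y' /mix !inE qQ orbT zQ.
    - rewrite zT ?inE ?qS//; have qp : q != p by apply: contraNneq qS => ->.
      by rewrite /y' /Y /y /mix !inE (negbTE qp) (negbTE qQ) /= qS qT.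
  apply: M_mono => //; apply/fsubsetP => q; rewrite !inE -orbA.
  case/or3P => [/eqP->|->//|/and3P[_ _ ->]]; last by rewrite orbT.
  by rewrite (fsubsetP ST)// orbT.
rewrite sumS_const /b mulrA /cond_cst card_shiftfs ler_wpM2r ?M_ge0//.
rewrite ler_wpM2r ?expR_ge0// ler_nat leq_pexp2l//.
  by apply/card_gt0P; exists point.
by rewrite -(card_shiftfs p (B g)) fsubset_leq_card// fsubsetDl.
Qed.

Lemma cond_lower_multi D Q x : [disjoint D & Q]%fset -> 0 < M (D `|` Q)%fset x ->
  M Q x <= cond_cst ^+ #|` D| * M (D `|` Q)%fset x.
Proof.
elim/fset1U_rect: D => [|p D pD IH].
  by move=> _; rewrite fset0U cardfs0 expr0 mul1r.
rewrite fdisjointUX fdisjoint1X => /andP[pQ dj].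
rewrite -fsetUA cardfsU1 pD exprS => Mx.
have MDQ : 0 < M (D `|` Q)%fset x by apply: M_pos_sub Mx => //; rewrite fsubsetUr.
apply: le_trans (IH dj MDQ) _; rewrite -mulrA mulrCA ler_wpM2l//.
  by rewrite exprn_ge0// (le_trans _ cond_cst_ge1).
by apply: cond_lower => //; rewrite inE negb_or pD.
Qed.

(** Logarithm of the ratio of [M] to the unnormalised Gibbs weight; its expectation under [M] is
    energy minus entropy in [B n]. *)
Definition log_ratio n x : R := ln (M (B n) x) + en (B n) x.

Definition ratio_cst : R := ln cond_cst + en_lip.

Lemma ratio_cst_ge0 : 0 <= ratio_cst.
Proof. by rewrite addr_ge0 ?en_lip_ge0// ln_ge0// cond_cst_ge1. Qed.

(** Mixing glues the word of [x] deep inside to that of [y] on the outermost layer. The glued [z]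
    has the same [log_ratio] as [y] by the Gibbs identity, and it agrees with [x] off a shell whose
    sites cost [ratio_cst] each. *)
Lemma log_ratio_dist n x y : (g < n)%N -> 0 < M (B n) x -> 0 < M (B n) y ->
  `|log_ratio n x - log_ratio n y| <= ratio_cst * shell g.+1 n.
Proof.
(* One layer is enough for [V] because the interaction is nearest-neighbour; the gap of [g] layers
   is for mixing. *)
move=> gn Mx My; pose U := B (n - g.+1); pose V := (B n `\` B (n - 1))%fset.
have UB : (U `<=` B n)%fset by rewrite box_le ?leq_subr.
have far p q : p \in U -> q \in V -> (g <= norm1 (p - q)%R)%N.
  rewrite !inE => pU /andP[qn _]; rewrite -norm1N opprB ltnW// notin_box//.
  apply: contra qn => h; rewrite -(subrK p q).
  have -> : (n - 1 = g + (n - g.+1))%N by lia.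
  exact: box_add.
have xy0 : agree fset0 x y by move=> q; rewrite inE.
have Ux : 0 < M (U `|` fset0)%fset x by rewrite fsetU0; exact: M_pos_sub UB Mx.
have Vy : 0 < M (V `|` fset0)%fset y.
  by rewrite fsetU0; apply: M_pos_sub My => //; exact: fsubsetDl.
have [z [zs zx zy _]] := mix_g far xy0 Ux Vy.
have Mz S : 0 < M S z by exact: (suppP mu z).1.
have zyE : log_ratio n z = log_ratio n y.
  have inner q : q \in B n -> z q != y q ->
      forall i, q + e_ i \in B n /\ q - e_ i \in B n.
    move=> qn ne i; have qn1 : q \in B (n - 1).
      by apply: contraNT ne => qn1; rewrite zy// !inE qn1.
    by have := box_basisD i qn1; have -> : (n - 1).+1 = n by lia.
  have := congr1 (@ln R) (lanford_ruelle eq_mu (aM (Mz (B n))) (aM My) inner).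
  rewrite -/M !lnM ?posrE ?expR_gt0 ?expRK//.
rewrite -zyE; pose W := (B n `\` U)%fset.
have WU : [disjoint W & U]%fset by rewrite fdisjoint_sym disjoint_setD.
have WUE : (W `|` U = B n)%fset by rewrite fsetUC fsetU_setD.
have K0 : 0 < cond_cst by apply: lt_le_trans cond_cst_ge1.
have lnK0 : 0 <= ln cond_cst by rewrite ln_ge0// cond_cst_ge1.
have half u v : 0 < M (B n) u -> 0 < M (B n) v -> agree U u v ->
    ln (M (B n) u) <= ln (M (B n) v) + ln cond_cst * #|` W|%:R.
  move=> Mu Mv uv.
  have : M U v <= cond_cst ^+ #|` W| * M (B n) v.
    by rewrite -WUE; apply: cond_lower_multi => //; rewrite WUE.
  rewrite -(M_local cM uv) => /(le_trans (M_mono cM u UB)).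
  rewrite -ler_ln ?posrE ?mulr_gt0 ?exprn_gt0// => h; apply: le_trans h _.
  by rewrite lnM ?posrE ?exprn_gt0// lnXn// addrC mulr_natr.
have h1 := half _ _ Mx (Mz _) (agree_sym zx).
have h2 := half _ _ (Mz _) Mx zx.
have h3 : `|en (B n) x - en (B n) z| <= en_lip * #|` W|%:R.
  apply: en_diff_bound => q qn; rewrite !inE qn andbT negbK => qU.
  by rewrite zx.
have h4 : ratio_cst * #|` W|%:R <= ratio_cst * shell g.+1 n.
  by rewrite ler_wpM2l ?ratio_cst_ge0// card_box_diff.
apply: le_trans h4; rewrite /log_ratio /ratio_cst mulrDl.
move: h1 h2 h3; move: (ln cond_cst * _) (en_lip * _) (ln (M _ x)) (ln (M _ z)) => c1 c2 l1 l2.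
rewrite !ler_norml => h1 h2 /andP[h3 h4]; apply/andP; split; lra.
Qed.

Lemma expect_log_ratio_cvg nu : shift_invariant nu -> supp nu `<=` supp mu ->
  (fun n => - expect (pr nu) (B n) (log_ratio n) / vol n) @ \oo --> fe Phi mu.
Proof.
move=> inu sn; have cN := cylmeas_pr nu.
have c1 := @free_energy_cvg _ _ _ Phi _ cM iM; rewrite -/(fe Phi mu) in c1.
apply/cvgrPdist_le => e e0.
have e2 : 0 < e / 2 by lra.
have /cvgr0Pnorm_le/(_ _ e2) sh := @shell_cvg_mul R d (2 * ratio_cst) g.+1.
move/cvgrPdist_le : c1 => /(_ _ e2) c1.
near=> n; have v0 := vol_gt0 R d n.
have gn : (g < n)%N by near: n; exact: nbhs_infty_gt.
have E : ent M (B n) - expect M (B n) (en (B n)) = - expect M (B n) (log_ratio n).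
  rewrite /log_ratio expect_add opprD; congr (_ - _).
  by rewrite /expect -sumS_opp.
have h : `|expect (pr nu) (B n) (log_ratio n) - expect M (B n) (log_ratio n)| <=
    2 * ratio_cst * shell g.+1 n.
  (* Both expectations are compared with the value at one common word, whence the factor 2. *)
  have [b _ Mb] := exists_M_gt0 (B n) cM.
  have h1 : `|expect M (B n) (log_ratio n) - log_ratio n b| <= ratio_cst * shell g.+1 n.
    rewrite -[X in _ - X](expect_cst cM (B n)); apply: ler_norm_expect => // x Mx.
    exact: log_ratio_dist.
  have h2 : `|expect (pr nu) (B n) (log_ratio n) - log_ratio n b| <= ratio_cst * shell g.+1 n.
    rewrite -[X in _ - X](expect_cst cN (B n)); apply: ler_norm_expect => // x Mx.
    by apply: log_ratio_dist => //; exact: supp_pr sn Mx.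
  rewrite -mulrA; move: h1 h2; rewrite !ler_norml; lra.
have h1 : `|fe Phi mu - (ent M (B n) - expect M (B n) (en (B n))) / vol n| <= e / 2 by near: n.
have h2 : `|2 * ratio_cst * (shell g.+1 n / vol n)| <= e / 2 by near: n.
have h3 : `|(expect (pr nu) (B n) (log_ratio n) - expect M (B n) (log_ratio n)) / vol n| <= e / 2.
  apply: le_trans h2; rewrite normrM normfV (gtr0_norm v0).
  apply: le_trans (ler_norm _); rewrite mulrA ler_wpM2r// invr_ge0 ltW//.
move: h1 h3; rewrite E !mulNr mulrBl !ler_norml; lra.
Unshelve. all: by end_near. Qed.

End Tssm.
(** * Conditional probabilities given the past *)

Section LexOrder.
Variable d : nat.
Implicit Types (p q r : lattice d).

Lemma lexltP q p : reflect
  (exists2 i : 'I_d, (forall j : 'I_d, (j < i)%N -> q j = p j) & (q i < p i)%R) (lexlt q p).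
Proof.
apply: (iffP existsP) => [[i /andP[/forallP h qp]]|[i h qp]].
  by exists i => // j ji; have := h j; rewrite ji => /eqP.
by exists i; rewrite qp andbT; apply/forallP => j; apply/implyP => /h ->.
Qed.

Lemma lexlt_irr p : lexlt p p = false.
Proof. by apply/lexltP => -[i _]; rewrite ltxx. Qed.

Lemma lexlt_trans q p r : lexlt p q -> lexlt q r -> lexlt p r.
Proof.
move=> /lexltP[i pq pqi] /lexltP[j qr qrj]; apply/lexltP.
case: (ltngtP i j) => [ij|ji|/val_inj ij].
- exists i; last by rewrite -qr.
  by move=> l li; rewrite pq// qr// (ltn_trans li).
- exists j; last by rewrite pq.
  by move=> l lj; rewrite pq ?qr// (ltn_trans lj).
- subst j; exists i; last exact: lt_trans qrj.
  by move=> l li; rewrite pq// qr.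
Qed.

Lemma lexlt_total p q : p != q -> lexlt p q || lexlt q p.
Proof.
move=> pq; have /existsP[i0 i0P] : [exists i, p i != q i].
  rewrite -negb_forall; apply: contra pq => /forallP h.
  by apply/eqP/ffunP => i; apply/eqP.
case: (@arg_minnP _ i0 (fun i => p i != q i) val i0P) => i pqi imin.
have h (j : 'I_d) : (j < i)%N -> p j = q j.
  by move=> ji; apply/eqP; apply: contraTT ji => /imin; rewrite -leqNgt.
apply/orP; move: pqi; rewrite neq_lt => /orP[lt|lt]; [left|right]; apply/lexltP; exists i => //.
by move=> j /h.
Qed.

Lemma lexltD2l r p q : lexlt (r + p) (r + q) = lexlt p q.
Proof.
apply/lexltP/lexltP => -[i h pq]; exists i; move: pq; rewrite ?latD ?ltrD2l//.
  by move=> _ j /h; rewrite !latD => /addrI.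
by move=> _ j /h e; rewrite !latD e.
Qed.

Lemma lexlt_max (D : {fset lattice d}) : D != fset0 ->
  exists2 p, p \in D & forall q, q \in D -> q != p -> lexlt q p.
Proof.
elim/fset1U_rect: D => [|p D pD IH _]; first by rewrite eqxx.
have [->|/IH[m mD mm]] := @eqVneq {fset lattice d} D fset0.
  by exists p => [|q]; rewrite !inE ?eqxx// orbF => /eqP->; rewrite eqxx.
have mp : m != p by apply: contraNneq pD => <-.
have /orP[lt|lt] := lexlt_total mp.
  exists p => [|q]; first by rewrite !inE eqxx.
  rewrite !inE => /predU1P[->|qD _]; first by rewrite eqxx.
  have [->//|qm] := eqVneq q m; exact: lexlt_trans (mm _ qD qm) lt.
exists m => [|q]; first by rewrite !inE mD orbT.
by rewrite !inE => /predU1P[->//|]; exact: mm.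
Qed.

Lemma in_past k p : (p \in past d k) = (p \in box d k) && lexlt p 0.
Proof. by rewrite !inE. Qed.

Lemma past_le m n : (m <= n)%N -> (past d m `<=` past d n)%fset.
Proof.
move=> mn; apply/fsubsetP => p; rewrite !in_past => /andP[pm ->].
by rewrite (fsubsetP (box_le d mn)).
Qed.

End LexOrder.

Section ChainRule.
Variables (R : realType) (d : nat) (A : pfinType).
Variables (M : {fset lattice d} -> (lattice d -> A) -> R) (cM : cylmeas M).
Implicit Types (D Q : {fset lattice d}).

Definition cond Q x : R := M (0 |` Q)%fset x / M Q x.

Lemma cond_local Q : local_on (0 |` Q)%fset (cond Q).
Proof.
move=> x y xy; rewrite /cond (M_local cM xy); congr (_ / _).
by apply: (M_local cM); apply: agree_sub xy; exact: fsubsetUr.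
Qed.

Definition before D p : {fset lattice d} := [fset q in D | lexlt q p]%fset.

(** Telescoping: the lexicographically last site has all the rest of [D] before it, and its removal
    leaves the [before] sets of the other sites unchanged. *)
Lemma chain_rule D x : 0 < M D x ->
  ln (M D x) = \sum_(p <- D) ln (M (p |` before D p)%fset x / M (before D p) x).
Proof.
elim: {D}#|` D| {-2}D (leqnn #|` D|) => [|n IH] D; [rewrite leqn0 cardfs_eq0 => /eqP-> _|move=> Dn MD].
  by rewrite big_seq_fset0; have [_ _ _ ->] := cM; rewrite ln1.
have [->|/lexlt_max[p pD pm]] := eqVneq D fset0.
  by rewrite big_seq_fset0; have [_ _ _ ->] := cM; rewrite ln1.
pose E := (D `\ p)%fset.
have DE : D = (p |` E)%fset by rewrite fsetD1K.
have bD : before D p = E.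
  apply/fsetP => q; rewrite !inE; case: (eqVneq q p) => [->|qp] /=.
    by rewrite lexlt_irr andbF.
  by case: (boolP (q \in D)) => //= qD; rewrite pm.
have ME : 0 < M E x by apply: M_pos_sub MD => //; exact: fsubD1set.
have En : (#|` E| <= n)%N by have := cardfsD1 p D; rewrite pD; move: Dn; rewrite -/E; lia.
rewrite (big_fsetD1 p)//= bD -DE ln_div ?posrE// -/E.
have -> : \sum_(q <- E) ln (M (q |` before D q)%fset x / M (before D q) x) =
    \sum_(q <- E) ln (M (q |` before E q)%fset x / M (before E q) x).
  rewrite !big_seq; apply: eq_bigr => q qE; suff -> : before D q = before E q by [].
  apply/fsetP => r; rewrite !inE; case: (eqVneq r p) => [->|//] /=.
  rewrite pD /=; apply: negbTE; apply/negP => pq; move: qE; rewrite !inE => /andP[qp qD].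
  by have := lexlt_trans pq (pm _ qD qp); rewrite lexlt_irr.
by rewrite -IH// subrK.
Qed.

End ChainRule.

Section Ssm.
Variables (R : realType) (d : nat) (A : pfinType).
Local Notation L := (lattice d).
Local Notation cfg := (lattice d -> A).
Local Notation B := (box d).
Local Notation P := (past d).
Implicit Types (S T U V Q D W : {fset L}) (x y z w : cfg) (p q : L) (F : cfg -> R).
Variable mu : probability (conf d A) R.
Let M := pr mu.
Let cM : cylmeas M. Proof. exact: cylmeas_pr. Qed.

Lemma condpE S T x :
  condp mu (cyl (restr S (x : conf d A))) (cyl (restr T (x : conf d A))) = M (S `|` T)%fset x / M T x.
Proof.
rewrite /condp /M /pr; congr (fine (mu _) / _); apply/seteqP; split=> y; rewrite /= !cylE.
  by move=> [h k] p; rewrite inE => /orP[/h|/k].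
by move=> h; split; apply: agree_sub h; [exact: fsubsetUl|exact: fsubsetUr].
Qed.

Lemma subrestr_restr S T (ST : (S `<=` T)%fset) x :
  subrestr ST (restr T (x : conf d A)) = restr S (x : conf d A).
Proof. by apply/ffunP => p; rewrite !ffunE. Qed.

Lemma notin_boundary W p : p \in boundary W -> p \notin W.
Proof. by move/in_boundary => []. Qed.

(** [MRF] speaks of words on all of [W]; summing over the sites of [W] outside [U] passes to words
    on [U]. *)
Lemma MRF_marginal W T U x : MRF mu -> (boundary W `<=` T)%fset -> [disjoint T & W]%fset ->
  (U `<=` W)%fset -> 0 < M T x ->
  M (U `|` T)%fset x / M T x = M (U `|` boundary W)%fset x / M (boundary W) x.
Proof.
move=> [_ mrf] bT TW UW MT; set b := boundary W.
have dT : [disjoint (U `|` T)%fset & (W `\` U)%fset]%fset.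
  apply/fdisjointP => p; rewrite !inE => /orP[->//|pT].
  by rewrite (negbTE (fdisjointP TW _ pT)) andbF.
have db : [disjoint (U `|` b)%fset & (W `\` U)%fset]%fset.
  apply/fdisjointP => p; rewrite !inE => /orP[->//|pT].
  by rewrite (negbTE (notin_boundary pT)) andbF.
have E V : ((U `|` V) `|` (W `\` U) = W `|` V)%fset.
  by rewrite fsetUAC fsetU_setD.
rewrite (M_total cM x dT) (M_total cM x db) mulrC -sumS_scale [RHS]mulrC -sumS_scale.
apply: eq_sumS => w _; rewrite !E; set y := mix _ x w; set y' := mix _ x w.
have yT : agree T y x by move=> p pT; rewrite /y /mix inE pT orbT.
have yb : agree b y' x by move=> p pT; rewrite /y' /mix inE pT orbT.
have yy : agree (W `|` b)%fset y' y.
  move=> p; rewrite !inE /y /y' /mix !inE; case: (boolP (p \in U)) => //= pU.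
  case: (boolP (p \in b)) => [/(fsubsetP bT)->//|_]; rewrite orbF => pW.
  by case: ifPn => // /(fdisjointP TW); rewrite pW.
rewrite -(M_local cM yT) -(M_local cM yb) (M_local cM yy).
have yb' : agree b y' y by apply: agree_sub yy; exact: fsubsetUr.
rewrite (M_local cM yb') mulrC [RHS]mulrC -!condpE mrf//.
  by rewrite subrestr_restr.
by rewrite prE lte_fin -/M (M_local cM yT).
Qed.

Definition ker W x : R := M (0 |` boundary W)%fset x / M (boundary W) x.

(** One distance [k] serves every finite [W]; this uniformity in the window is what the argument
    takes from SSM. *)
Definition mixing_rate (e : R) k := forall W x y, 0 \in W ->
  0 < M (boundary W) x -> 0 < M (boundary W) y -> x 0 = y 0 ->
  (forall p, p \in boundary W -> x p != y p -> (k <= norm1 p)%N) ->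
  `|ker W x - ker W y| <= e.

Lemma SSM_rate e : SSM mu -> 0 < e -> exists k, mixing_rate e k.
Proof.
move=> [_ [f [f0 fc ssm]]] e0; move/cvgrPdist_le : fc => /(_ _ e0)[k _ fk].
exists k => W x y W0 Mx My xy0 far.
have sub0 : ([fset 0%R] `<=` W)%fset by rewrite fsub1set.
have := ssm W [fset 0%R]%fset sub0 (restr _ (x : conf d A))
  (restr _ (x : conf d A)) (restr _ (y : conf d A)).
rewrite {2}(@agree_restr _ _ [fset 0%R]%fset x y); last by move=> p; rewrite inE => /eqP->.
rewrite !condpE !prE !lte_fin => /(_ Mx My)/le_trans; apply.
rewrite cardfs1 mul1r; case E: (dist _ _) => [n|] /=; last exact: ltW.
have [[p [q [pU qD <-]]] _] := (distP _ _ _).1 E.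
apply: le_trans (ler_norm _) _; rewrite -normrN -sub0r; apply: fk => /=.
move: pU; rewrite inE => /eqP->; rewrite sub0r norm1N.
move: qD => /imfsetP[/= r rb ->].
have : restr (boundary W) (x : conf d A) r != restr (boundary W) (y : conf d A) r by [].
rewrite !ffunE => ne.
by apply: far => //; exact: valP.
Qed.

(** The origin and what follows it in [B k]. Boundary sites inside [B k] belong to the past [P k],
    so two boundary words with the same past can differ only off [B k]. *)
Definition window k : {fset L} := (B k `\` P k)%fset.

Lemma window0 k : 0 \in window k.
Proof. by rewrite /window in_fsetD in_past lexlt_irr andbF /= box0. Qed.

Lemma window_past k Q : (forall q, q \in Q -> lexlt q 0) -> [disjoint Q & window k]%fset.
Proof.
move=> Qp; apply/fdisjointP => q /Qp q0; rewrite /window in_fsetD in_past q0 andbT.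
by case: (q \in B k).
Qed.

(* The conditional law of the origin given [Q] is an average of the kernels of
   [window k], whose boundary words may differ from [y] only off [box k]. *)
Lemma cond_ker e k Q x y : MRF mu -> mixing_rate e k ->
  (forall q, q \in Q -> lexlt q 0) -> (P k `<=` Q)%fset -> 0 < M Q x ->
  supp mu y -> agree (0 |` P k)%fset x y -> `|cond M Q x - ker (window k) y| <= e.
Proof.
move=> mrf mix_k Qp kQ MQ /suppP My xy; set W := window k; set b := boundary W.
have QW : [disjoint Q & W]%fset by exact: window_past.
(* The boundary sites not in [Q] are added to the condition and averaged out afterwards; given a
   word on [Q1] the Markov property yields the kernel. *)
pose Q1 := (Q `|` (b `\` Q))%fset.
have Q0 : 0 \notin Q by apply/negP => /Qp; rewrite lexlt_irr.
have b0 : 0 \notin b by apply/negP => /notin_boundary; rewrite window0.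
have bQ1 : (b `<=` Q1)%fset.
  by apply/fsubsetP => p pb; rewrite !inE pb andbT orbN.
have Q1W : [disjoint Q1 & W]%fset.
  apply/fdisjointP => p; rewrite /Q1 in_fsetU in_fsetD.
  by move=> /orP[/(fdisjointP QW _)//|/andP[_ /notin_boundary]].
have d1 : [disjoint Q & (b `\` Q)]%fset by exact: disjoint_setD.
have d2 : [disjoint (0 |` Q) & (b `\` Q)]%fset.
  by rewrite fdisjointUX fdisjoint1X d1 andbT !inE (negbTE b0) andbF.
have main : `|M (0 |` Q)%fset x - ker W y * M Q x| <= e * M Q x.
  rewrite (M_total cM x d1) (M_total cM x d2) -!sumS_scale -sumS_sub.
  apply: le_trans (ler_norm_sum _ _ _) _.
  apply: ler_sum => i _; move: (ext i) => w.
  set z := mix (0 |` Q)%fset x w; set z' := mix Q x w.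
  have zz : agree Q1 z' z.
    move=> p pQ; rewrite /z /z' /mix !inE; case: (eqVneq p 0) => //= p0.
    by exfalso; have := fdisjointP Q1W _ pQ; rewrite p0 window0.
  rewrite -/Q1 (M_local cM zz) -fsetUA -/Q1.
  have := M_ge0 cM Q1 z; rewrite le_eqVlt => /predU1P[z0|Mz].
    have -> : M (0 |` Q1)%fset z = 0.
      apply/eqP; rewrite eq_le M_ge0// andbT z0.
      by apply: M_mono => //; exact: fsubsetUr.
    by rewrite -z0 !mulr0 subr0 normr0.
  have := MRF_marginal mrf bQ1 Q1W (U := [fset 0]%fset) (x := z).
  rewrite fsub1set window0 => /(_ isT Mz) e1.
  have -> : M (0 |` Q1)%fset z = ker W z * M Q1 z.
    by rewrite /ker -e1 divfK// gt_eqF.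
  rewrite -mulrBl normrM (gtr0_norm Mz) ler_wpM2r ?(ltW Mz)//.
  apply: mix_k => //.
  - exact: window0.
  - exact: M_pos_sub bQ1 Mz.
  - by rewrite -xy ?inE ?eqxx// /z /mix !inE eqxx.
  move=> p pb zy; apply: ltnW; apply: notin_box; apply: contra zy => pk.
  have pP : p \in P k by have := notin_boundary pb; rewrite in_fsetD pk andbT negbK.
  have pP0 : p \in (0 |` P k)%fset by rewrite in_fset1U pP orbT.
  by rewrite -(xy _ pP0) /z /mix in_fset1U (fsubsetP kQ)// orbT.
have -> : cond M Q x - ker W y = (M (0 |` Q)%fset x - ker W y * M Q x) / M Q x.
  by rewrite mulrBl mulfK ?gt_eqF.
by rewrite normrM normfV (gtr0_norm MQ) ler_pdivrMr.
Qed.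

(** Both conditional probabilities lie within [e] of the kernel at one point [y] of the support. *)
Lemma cond_dist e k Q x : MRF mu -> mixing_rate e k ->
  (forall q, q \in Q -> lexlt q 0) -> (P k `<=` Q)%fset -> 0 < M (0 |` Q)%fset x ->
  `|cond M Q x - cond M (P k) x| <= 2 * e.
Proof.
move=> mrf mix_k Qp kQ MQ.
have /pr_gt0_supp[y ys xy] : 0 < M (0 |` P k)%fset x.
  by apply: M_pos_sub MQ => //; apply: fsetUS.
have h1 := cond_ker mrf mix_k Qp kQ (M_pos_sub cM (fsubsetUr _ _) MQ) ys xy.
have h2 : `|cond M (P k) x - ker (window k) y| <= e.
  apply: cond_ker => //.
    by move=> q; rewrite in_past => /andP[].
  by apply: M_pos_sub MQ => //; apply: fsubset_trans kQ (fsubsetUr _ _).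
by move: h1 h2; rewrite !ler_norml; lra.
Qed.

End Ssm.
(** * The pressure formula *)

Section Information.
Variables (R : realType) (d : nat) (A : pfinType) (Phi : interaction R d A).
Local Notation L := (lattice d).
Local Notation cfg := (lattice d -> A).
Local Notation B := (box d).
Local Notation P := (past d).
Local Notation vol := (vol R d).
Local Notation shell := (shell R d).
Local Notation site_fun := (@site_fun R d A Phi).
Implicit Types (S T D Q : {fset L}) (x y w : cfg) (p q : L) (F : cfg -> R).
Variables (mu nu : probability (conf d A) R) (g : nat).
Hypothesis eq_mu : equilibrium_state Phi mu.
Hypothesis mix_g : mixing mu g.
Hypothesis ssm_mu : SSM mu.
Hypothesis inu : shift_invariant nu.
Hypothesis sn : supp nu `<=` supp mu.
Let M := pr mu.
Let N := pr nu.
Let cM : cylmeas M. Proof. exact: cylmeas_pr. Qed.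
Let iM : invariant M. Proof. by apply: invariant_pr; have [] := eq_mu. Qed.
Let cN : cylmeas N. Proof. exact: cylmeas_pr. Qed.
Let iN : invariant N. Proof. exact: invariant_pr. Qed.
Let K : R := cond_cst Phi g.
Let K1 : 1 <= K. Proof. exact: cond_cst_ge1. Qed.
Let K0 : 0 < K. Proof. exact: lt_le_trans K1. Qed.

Definition in_past_half Q := forall q, q \in Q -> lexlt q 0.

Lemma past_half k : in_past_half (P k).
Proof. by move=> q; rewrite in_past => /andP[]. Qed.

Lemma cond_ge Q x : in_past_half Q -> 0 < M (0 |` Q)%fset x -> K^-1 <= cond M Q x.
Proof.
move=> Qp Mx; have Q0 : 0 \notin Q by apply/negP => /Qp; rewrite lexlt_irr.
have MQ : 0 < M Q x by apply: M_pos_sub Mx => //; exact: fsubsetUr.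
rewrite /cond ler_pdivlMr// mulrC ler_pdivrMr// mulrC.
exact (cond_lower eq_mu mix_g Q0 Mx).
Qed.

Lemma cond_le1 Q x : 0 < M (0 |` Q)%fset x -> cond M Q x <= 1.
Proof.
move=> Mx; have MQ : 0 < M Q x by apply: M_pos_sub Mx => //; exact: fsubsetUr.
by rewrite /cond ler_pdivrMr// mul1r M_mono// fsubsetUr.
Qed.

Lemma ln_cond_bound Q x : in_past_half Q -> 0 < M (0 |` Q)%fset x ->
  `|- ln (cond M Q x)| <= ln K.
Proof.
move=> Qp Mx; have c1 := cond_ge Qp Mx; have c2 := cond_le1 Mx.
rewrite normrN ler0_norm ?ln_le0//.
have : ln K^-1 <= ln (cond M Q x).
  by rewrite ler_ln ?posrE ?invr_gt0// (lt_le_trans _ c1)// invr_gt0.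
by rewrite lnV ?posrE// lerNl.
Qed.

(** [K] bounds the derivative of [ln] on the half-line from [K^-1]; differences of probabilities
    thus control differences of information. *)
Lemma ln_dist (a b : R) : K^-1 <= a -> K^-1 <= b -> `|ln a - ln b| <= K * `|a - b|.
Proof.
have half (s t : R) : K^-1 <= s -> K^-1 <= t -> ln s - ln t <= K * `|s - t|.
  move=> Ks Kt; have s0 : 0 < s by apply: lt_le_trans Ks; rewrite invr_gt0.
  have t0 : 0 < t by apply: lt_le_trans Kt; rewrite invr_gt0.
  rewrite -ln_div ?posrE//; apply: le_trans (ln_le_sub1 (divr_gt0 s0 t0)) _.
  have -> : s / t - 1 = t^-1 * (s - t) by rewrite mulrBr mulVf ?gt_eqF// mulrC.
  apply: (@le_trans _ _ (t^-1 * `|s - t|)).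
    by rewrite ler_wpM2l ?ler_norm// invr_ge0 ltW.
  by rewrite ler_wpM2r// -[K]invrK lef_pV2// posrE// invr_gt0.
move=> Ka Kb; have h1 := half _ _ Ka Kb; have h2 := half _ _ Kb Ka.
by rewrite distrC in h2; rewrite ler_norml; apply/andP; split; lra.
Qed.

Let mrf : MRF mu. Proof. by have [] := ssm_mu. Qed.

Let Msupp x S : supp mu x -> 0 < M S x. Proof. by move/suppP. Qed.

Lemma pcond_cvg x : supp mu x -> (fun n => cond M (P n) x) @ \oo --> pcond mu x.
Proof.
move=> xs; have -> : pcond mu x = limn (fun n => cond M (P n) x).
  by congr (limn _); apply/funext => n; exact: condpE.
apply/cauchy_cvgP/cauchy_exP => e e0.
have e3 : 0 < e / 3 by lra.
have [k mix_k] := SSM_rate ssm_mu e3.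
exists (cond M (P k) x); suff : \forall n \near \oo, ball (cond M (P k) x) e (cond M (P n) x) by [].
near=> n; rewrite /ball /= distrC.
apply: (@le_lt_trans _ _ (2 * (e / 3))); last by lra.
apply: (cond_dist mrf mix_k) => //; first exact: past_half.
  by apply: past_le; near: n; exact: nbhs_infty_ge.
exact: Msupp.
Unshelve. all: by end_near. Qed.

Lemma pcond_ge x : supp mu x -> K^-1 <= pcond mu x.
Proof.
move=> xs; have c := pcond_cvg xs; rewrite -(cvg_lim _ c)//.
apply: limr_ge; first by apply/cvg_ex; exists (pcond mu x).
by apply: nearW => n; apply: cond_ge; [exact: past_half | exact: Msupp].
Qed.

Definition info x : R := - ln (pcond mu x).

Lemma informationE x : supp mu x -> information mu x = (info x)%:E.
Proof.
move=> xs; rewrite /information lne_EFin//.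
by rewrite (lt_le_trans _ (pcond_ge xs))// invr_gt0.
Qed.

Lemma info_dist (e : R) : 0 < e -> exists k, forall x Q, supp mu x -> in_past_half Q ->
  (P k `<=` Q)%fset -> `|- ln (cond M Q x) - info x| <= e.
Proof.
(* Two applications of [cond_dist] cost [2 * e'] each and the limit costs [e']; [ln_dist] multiplies
   by [K]. *)
move=> e0; pose e' := e / (5 * K).
have e'0 : 0 < e' by rewrite divr_gt0// mulr_gt0.
have [k mix_k] := SSM_rate ssm_mu e'0; exists k => x Q xs Qp kQ.
rewrite /info opprK addrC.
have Mx S : 0 < M S x by exact: Msupp.
apply: le_trans (ln_dist (pcond_ge xs) (cond_ge Qp (Mx _))) _.
suff h : `|pcond mu x - cond M Q x| <= 5 * e'.
  apply: (@le_trans _ _ (K * (5 * e'))); first by rewrite ler_wpM2l// ltW.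
  by rewrite /e' mulrA [K * 5]mulrC mulrCA divff ?mulr1// gt_eqF// mulr_gt0.
have [n kn hn] : exists2 n, (k <= n)%N & `|pcond mu x - cond M (P n) x| <= e'.
  have /cvgrPdist_le/(_ _ e'0)[m _ hm] := pcond_cvg xs.
  by exists (maxn k m); [exact: leq_maxl | apply: hm; exact: leq_maxr].
have h1 := cond_dist mrf mix_k Qp kQ (Mx _).
have h2 := cond_dist mrf mix_k (@past_half n) (past_le d kn) (Mx _).
move: hn h1 h2; rewrite -/M !ler_norml; lra.
Qed.

Let X := supp mu.
Let mX : measurable X. Proof. exact: measurable_supp. Qed.

Let nuX0 : nu (~` X) = 0%E.
Proof.
apply: (@subset_measure0 _ _ _ _ _ (~` supp nu)) => //.
- exact: measurableC.
- by apply: measurableC; exact: measurable_supp.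
- by apply: subsetC.
- exact: setC_supp0.
Qed.

Let ln_cond_local Q : local_on (0 |` Q)%fset (fun x => - ln (cond M Q x)).
Proof. by move=> x y xy; rewrite (cond_local cM xy). Qed.

(** A pointwise limit of local functions on the support, where [info_dist] gives convergence;
    measurability is therefore claimed only there. *)
Lemma measurable_info : measurable_fun X (info : conf d A -> R).
Proof.
apply: (@measurable_realfun.measurable_fun_cvg _ (conf d A) R X
  (fun n x => - ln (cond M (P n) x)) info).
  by move=> n; apply: measurable_funTS; exact: measurable_local (@ln_cond_local (P n)).
move=> x xs; apply/cvgrPdist_le => e /info_dist[k hk]; near=> n.
rewrite distrC; apply: hk => //; first exact: past_half.
by apply: past_le; near: n; exact: nbhs_infty_ge.
Unshelve. all: by end_near. Qed.

Lemma integrable_info : nu.-integrable X (EFin \o (info : conf d A -> R)).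
Proof.
apply: measurable_bounded_integrable => //.
- by apply: le_lt_trans (probability_le1 _ mX) _; exact: ltry.
- exact: measurable_info.
have [k hk] := info_dist ltr01.
exists (ln K + 1); split; first exact: num_real.
move=> c cK x xs; apply: le_trans (ltW cK).
have h1 := hk x (P k) xs (@past_half k) (fsubset_refl _).
have h2 := ln_cond_bound (@past_half k) (@Msupp x (0 |` P k)%fset xs).
move: h1 h2; rewrite !ler_norml; lra.
Qed.

Definition mean_info : R := fine (\int[nu]_(x in X) (info x)%:E).

Lemma mean_infoE : (\int[nu]_(x in X) (info x)%:E = mean_info%:E)%E.
Proof. by rewrite /mean_info fineK//; apply: (integrable_fin_num mX); exact: integrable_info. Qed.

Let integral_suppE S F : local_on S F -> (\int[nu]_(x in X) (F x)%:E = (expect N S F)%:E)%E.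
Proof. by move=> lF; rewrite -(integral_conull _ mX nuX0) (integral_local nu lF). Qed.

Let integrable_supp S F : local_on S F -> nu.-integrable X (EFin \o (F : conf d A -> R)).
Proof. by move=> /(integrable_local nu); apply: integrableS. Qed.

Lemma integral_information :
  (\int[nu]_x (information mu x + A_fun Phi x) =
   (mean_info + expect N (B 1) site_fun)%:E)%E.
Proof.
have [_ sa _] := eq_mu; have sl := @site_fun_local _ _ _ Phi.
rewrite (integral_conull _ mX nuX0) EFinD -mean_infoE -(integral_suppE sl).
rewrite -(integralD_EFin mX integrable_info (integrable_supp sl)).
by apply: eq_integral => x /set_mem xs; rewrite informationE// A_funE//; exact: sa.
Qed.

(** The uniform bound of [info_dist] is integrated: adding [e] or [- e] to the local function puts
    it above or below [info] on the support. *)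
Lemma mean_info_dist (e : R) : 0 < e -> exists k, forall Q, in_past_half Q ->
  (P k `<=` Q)%fset -> `|expect N (0 |` Q)%fset (fun x => - ln (cond M Q x)) - mean_info| <= e.
Proof.
move=> /info_dist[k hk]; exists k => Q Qp kQ.
pose F (c : R) x := - ln (cond M Q x) + c.
have lF c : local_on (0 |` Q)%fset (F c).
  by move=> x y xy; rewrite /F (cond_local cM xy).
have EF c : expect N (0 |` Q)%fset (F c) = expect N (0 |` Q)%fset (fun x => - ln (cond M Q x)) + c.
  by rewrite expect_add expect_cst.
have up : mean_info <= expect N (0 |` Q)%fset (F e).
  rewrite -lee_fin -mean_infoE -(integral_suppE (lF e)); apply: le_integral => //.
  - exact: integrable_info.
  - exact: integrable_supp (lF e).
  move=> x /set_mem xs; rewrite lee_fin /F.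
  by have := hk x Q xs Qp kQ; rewrite ler_norml; lra.
have lo : expect N (0 |` Q)%fset (F (- e)) <= mean_info.
  rewrite -lee_fin -mean_infoE -(integral_suppE (lF (- e))); apply: le_integral => //.
  - exact: integrable_supp (lF (- e)).
  - exact: integrable_info.
  move=> x /set_mem xs; rewrite lee_fin /F.
  by have := hk x Q xs Qp kQ; rewrite ler_norml; lra.
move: up lo; rewrite !EF ler_norml; lra.
Qed.

(** The part of [B n] that precedes [p], seen from [p]: in this frame it lies in the past of the
    origin. *)
Definition past_in n p : {fset L} := shiftfs (- p) (before (B n) p).

Lemma past_in_half n p : in_past_half (past_in n p).
Proof.
move=> q; rewrite in_shiftfs opprK !inE => /andP[_].
by rewrite -(lexltD2l p q) addr0 addrC.
Qed.

Lemma past_in_sub n k p : (k <= n)%N -> p \in B (n - k) -> (P k `<=` past_in n p)%fset.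
Proof.
move=> kn pn; apply/fsubsetP => q; rewrite in_past => /andP[qk q0].
rewrite in_shiftfs opprK !inE; apply/andP; split.
  by rewrite -(subnK kn) addrC box_add.
by rewrite -[X in lexlt _ X]addr0 [q + p]addrC lexltD2l.
Qed.

(** Invariance enters twice: that of [nu] moves each expectation to the origin, that of [mu] moves
    the conditional probabilities inside it. *)
Lemma expect_ln_chain n :
  - expect N (B n) (fun x => ln (M (B n) x)) =
  \sum_(p <- B n) expect N (0 |` past_in n p)%fset (fun x => - ln (cond M (past_in n p) x)).
Proof.
rewrite -expect_opp.
rewrite (@eq_expect _ _ _ _ cN _ _ (fun x => \sum_(p <- B n)
    - ln (M (p |` before (B n) p)%fset x / M (before (B n) p) x))); last first.
  by move=> x /(supp_pr sn) Mx; rewrite sumrN -(chain_rule cM Mx).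
rewrite expect_sum !big_seq; apply: eq_bigr => p pn.
set Q := past_in n p.
have bE : before (B n) p = shiftfs p Q.
  by apply/fsetP => q; rewrite !in_shiftfs opprK subrK.
have pbE : (p |` before (B n) p)%fset = shiftfs p (0 |` Q)%fset.
  by apply/fsetP => q; rewrite bE !(in_shiftfs, in_fset1U) subr_eq0.
rewrite pbE bE -[RHS](expect_shift p _ _ iN).
rewrite (@expect_sub _ _ _ _ cN (shiftfs p (0 |` Q)%fset)).
- by apply: eq_sumS => x _; rewrite /= /cond !iM.
- rewrite -pbE; apply/fsubsetP => q; rewrite !inE => /orP[/eqP->//|/andP[]//].
- move=> x y xy; congr (- ln (_ / _)); apply: (M_local cM) => //.
  by apply: agree_sub xy; rewrite -pbE -bE; exact: fsubsetUr.
Qed.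

Lemma expect_ln_cvg :
  (fun n => - expect N (B n) (fun x => ln (M (B n) x)) / vol n) @ \oo --> mean_info.
Proof.
apply/cvgrPdist_le => e e0; have e2 : 0 < e / 2 by lra.
have [k hk] := mean_info_dist e2.
(* Near the boundary the visible past may miss part of [P k]; such terms are only bounded, by
   [ln K], and there are few of them. *)
pose C : R := ln K + `|mean_info|.
have C0 : 0 <= C by rewrite addr_ge0// ln_ge0.
have /cvgr0Pnorm_le/(_ _ e2) sh := @shell_cvg_mul R d C k.
near=> n; have v0 := vol_gt0 R d n.
have kn : (k <= n)%N by near: n; exact: nbhs_infty_ge.
rewrite expect_ln_chain.
pose t p := expect N (0 |` past_in n p)%fset (fun x => - ln (cond M (past_in n p) x)).
have h1 p : p \in B n -> `|t p - mean_info| <= e / 2 + (p \notin B (n - k))%:R * C.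
  move=> pn; case: (boolP (p \in B (n - k))) => pk /=.
    by rewrite mul0r addr0; apply: hk; [exact: past_in_half | exact: past_in_sub].
  rewrite mul1r; apply: (@le_trans _ _ C); last by rewrite lerDr ltW.
  apply: le_trans (ler_normB _ _) _; rewrite lerD2r -[t p]subr0.
  have := ler_norm_expect cN (S := (0 |` past_in n p)%fset) (G := fun=> 0).
  rewrite expect_cst//; apply => x Nx; rewrite subr0; apply: ln_cond_bound.
    exact: past_in_half.
  exact: supp_pr sn Nx.
have h2 : `|(\sum_(p <- B n) t p) - vol n * mean_info| <= e / 2 * vol n + C * shell k n.
  have vE (c : R) : \sum_(p <- B n) c = vol n * c.
    by rewrite big_const_seq count_predT iter_addr_0 mulr_natl.
  rewrite -vE -sumrB; apply: le_trans (ler_norm_sum _ _ _) _.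
  apply: (@le_trans _ _ (\sum_(p <- B n) (e / 2 + (p \notin B (n - k))%:R * C))).
    by rewrite !big_seq; apply: ler_sum => p; exact: h1.
  rewrite big_split/= vE [vol n * _]mulrC lerD2l -mulr_suml mulrC ler_wpM2l//.
  apply: le_trans (card_box_diff R d k n).
  rewrite -natr_sum ler_nat (eq_bigr (fun p => if p \notin B (n - k) then 1 else 0)%N); last first.
    by move=> p _; case: ifP.
  rewrite -big_mkcond sum1_count -size_filter uniq_leq_size ?filter_uniq ?fset_uniq//.
  by move=> p; rewrite mem_filter => /andP[h1' h2']; rewrite in_fsetD h1'.
have h3 : `|C * (shell k n / vol n)| <= e / 2 by near: n.
rewrite -[X in `|X - _|](mulfK (vol_neq0 R d n)) -mulrBl normrM normfV (gtr0_norm v0).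
rewrite ler_pdivrMr// distrC mulrC [_ * vol n]mulrC; apply: le_trans h2 _.
have : C * shell k n <= e / 2 * vol n.
  by rewrite -ler_pdivrMr// -mulrA; apply: le_trans (ler_norm _) h3.
have -> : vol n * e = e / 2 * vol n + e / 2 * vol n.
  by rewrite -mulrDl -splitr mulrC.
by rewrite lerD2l.
Unshelve. all: by end_near. Qed.

(** The limit per site of minus the [nu]-average of [log_ratio] is computed twice: as the free
    energy of [mu], and by separating information from energy. *)
Lemma fe_mean_info : fe Phi mu = mean_info + expect N (B 1) site_fun.
Proof.
have c1 := expect_log_ratio_cvg eq_mu mix_g inu sn.
have c2 := expect_ln_cvg.
have h := @expect_en_cvg _ _ _ Phi _ cN iN.
have c3 : (fun n => - expect N (B n) (fun x => ln (M (B n) x)) / vol n -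
    expect N (B n) (en Phi (B n)) / vol n) @ \oo --> mean_info + expect N (B 1) site_fun.
  by rewrite -[X in _ + X]opprK; exact: cvgB.
rewrite -(cvg_lim _ c1)// -(cvg_lim _ c3)//.
congr (limn _); apply/funext => n; rewrite -mulrBl /log_ratio expect_add opprD.
by [].
Qed.

End Information.

Theorem corollary7 (R : realType) (d : nat) (hd : (0 < d)%N) (A : pfinType)
    (Phi : interaction R d A) (mu nu : probability (conf d A) R) :
  equilibrium_state Phi mu ->
  shift_invariant nu ->
  supp nu `<=` supp mu ->
  TSSM (supp mu) ->
  SSM mu ->
  pressure Phi = (\int[nu]_x (information mu x + A_fun Phi x))%E.
Proof.
move=> eq_mu inu sn /mixingP[g mix_g] ssm_mu.
rewrite (pressureE eq_mu) (integral_information eq_mu mix_g ssm_mu sn).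
by rewrite (fe_mean_info eq_mu mix_g ssm_mu inu sn).
Qed.
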